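(* Let $(\bm u,\xi,\phi,\psi)$ be the solution of the coupled weak system (W1)–(W4) and let $\{(\bm u^i,\xi^i,\phi^i,\psi^i)\}_{i\ge0}$ be the sequence generated, from an arbitrary initial guess, by the iterative decoupled scheme (I1)–(I4), both given in the context. Set $\bm e_u^i=\bm u^i-\bm u$, $e_\xi^i=\xi^i-\xi$, $e_\phi^i=\phi^i-\phi$, $e_\psi^i=\psi^i-\psi$. Then the scheme is strictly contractive: there is a positive constant $C_\mu$ such that, for all $i\ge1$, $$\|\partial_t e_\xi^i\|_{L^2(0,T_f;W)}\le L_{\mathrm{con}}\,\|\partial_t e_\xi^{i-1}\|_{L^2(0,T_f;W)},\qquad L_{\mathrm{con}}:=\frac{1}{\sqrt{1+2\lambda C_\mu}}<1.$$ Moreover, as $i\to\infty$, the iterates converge to the unique weak solution of the coupled system in the following sense: $$\bm e_u^i\to\bm 0\ \text{in }L^\infty(0,T_f;\bm V),\quad e_\xi^i\to0\ \text{in }L^\infty(0,T_f;W),\quad e_\phi^i\to0\ \text{in }L^\infty(0,T_f;Q),\quad e_\psi^i\to0\ \text{in }L^\infty(0,T_f;S).$$ Consequently, the iterative scheme is globally convergent.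
   Context: $\Omega\subset\mathbb R^d$, $d\in\{2,3\}$, is an open bounded domain with Lipschitz boundary $\Gamma$, partitioned into disjoint parts with $\Gamma=\overline{\Gamma_D}\cup\overline{\Gamma_N}$ and $|\Gamma_D|>0$; $T_f>0$. $(\cdot,\cdot)$, $\|\cdot\|$ are the $L^2(\Omega)$ inner product and norm. $\varepsilon(\bm u)=\frac12(\nabla\bm u+\nabla\bm u^T)$. $\bm V=[H^1_{\Gamma_D}(\Omega)]^d$ (zero trace on $\Gamma_D$), $W=L^2(\Omega)$, $Q=S=H^1_0(\Omega)$. It is recalled (standing) that there is $C_{is}>0$ with $C_{is}\|w\|\le\sup_{\bm 0\ne\bm v\in\bm V}(\nabla\cdot\bm v,w)/\|\bm v\|_{H^1}$ for all $w\in W$, and that Korn's inequality $\|\bm v\|_{H^1}\le C_K\|\varepsilon(\bm v)\|$ holds on $\bm V$. Assumptions: $\alpha,\beta,\lambda,\mu,K,D$ are strictly positive constants; $c_1,c_2,b_0,\gamma\ge0$ are constants with $c_1-b_0\ge0$, $c_2-b_0\ge0$; $\bm u_0\in\bm V$, $\phi_0\in Q$, $\psi_0\in S$; $\bm f\in H^1(0,T_f;[L^2(\Omega)]^d)$; $g,h\in H^1(0,T_f;L^2(\Omega))$; $\xi_0:=-\lambda\nabla\cdot\bm u_0+\alpha\phi_0+\beta\psi_0$. Coupled weak system: for a.e. $t\in(0,T_f]$, $(\bm u(t),\xi(t),\phi(t),\psi(t))\in\bm V\times W\times Q\times S$ satisfies (W1) $2\mu(\varepsilon(\bm u),\varepsilon(\bm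 v))-(\xi,\nabla\cdot\bm v)=(\bm f,\bm v)$ for all $\bm v\in\bm V$; (W2) $(\nabla\cdot\bm u,w)+\frac1\lambda(\xi,w)-\frac\alpha\lambda(\phi,w)-\frac\beta\lambda(\psi,w)=0$ for all $w\in W$; (W3) $(c_1+\frac{\alpha^2}{\lambda})(\partial_t\phi,q)+(\frac{\alpha\beta}{\lambda}-b_0)(\partial_t\psi,q)-\frac\alpha\lambda(\partial_t\xi,q)+K(\nabla\phi,\nabla q)+\gamma(\phi-\psi,q)=(g,q)$ for all $q\in Q$; (W4) $(c_2+\frac{\beta^2}{\lambda})(\partial_t\psi,s)+(\frac{\alpha\beta}{\lambda}-b_0)(\partial_t\phi,s)-\frac\beta\lambda(\partial_t\xi,s)+D(\nabla\psi,\nabla s)+\gamma(\psi-\phi,s)=(h,s)$ for all $s\in S$; with initial conditions $\bm u(0)=\bm u_0$, $\xi(0)=\xi_0$, $\phi(0)=\phi_0$, $\psi(0)=\psi_0$. The solution is sought in $H^1(0,T_f;\bm V)\times H^1(0,T_f;W)\times H^1(0,T_f;Q)\times H^1(0,T_f;S)$. Iterative decoupled scheme: for $i\ge1$, given $\xi^{i-1}$ (the initial guess, $i=0$, is an arbitrary state): Step 1 (transport): for a.e. $t\in(0,T_f]$ find $(\phi^i,\psi^i)\in Q\times S$ such that (I1) $(c_1+\frac{\alpha^2}{\lambda})(\partial_t\phi^i,q)+(\frac{\alpha\beta}{\lambda}-b_0)(\partial_t\psi^i,q)+K(\nabla\phi^i,\nabla q)+\gamma(\phi^i-\psi^i,q)=(g,q)+\frac\alpha\lambda(\partial_t\xi^{i-1},q)$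 for all $q\in Q$; (I2) $(c_2+\frac{\beta^2}{\lambda})(\partial_t\psi^i,s)+(\frac{\alpha\beta}{\lambda}-b_0)(\partial_t\phi^i,s)+D(\nabla\psi^i,\nabla s)+\gamma(\psi^i-\phi^i,s)=(h,s)+\frac\beta\lambda(\partial_t\xi^{i-1},s)$ for all $s\in S$. Step 2 (mechanics): for a.e. $t\in(0,T_f]$ find $(\bm u^i,\xi^i)\in\bm V\times W$ such that (I3) $2\mu(\varepsilon(\bm u^i),\varepsilon(\bm v))-(\xi^i,\nabla\cdot\bm v)=(\bm f,\bm v)$ for all $\bm v\in\bm V$; (I4) $(\nabla\cdot\bm u^i,w)+\frac1\lambda(\xi^i,w)=\frac\alpha\lambda(\phi^i,w)+\frac\beta\lambda(\psi^i,w)$ for all $w\in W$. The iterates carry the same initial values as the exact solution, so that all errors vanish at $t=0$. The initial guess has $\partial_t\xi^0\in L^2(0,T_f;W)$. *)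

(* Defs.v *)
From HB Require Import structures.
From mathcomp Require Import all_boot all_order all_algebra.
From mathcomp Require Import all_classical all_reals all_analysis.
From mathcomp Require Import ess_sup_inf.

Set Implicit Arguments.
Unset Strict Implicit.
Unset Printing Implicit Defensive.

Import Order.TTheory GRing.Theory Num.Theory.
Import numFieldNormedType.Exports.

Local Open Scope classical_set_scope.
Local Open Scope ring_scope.

(* MathComp-Analysis, over an arbitrary [R : realType]. *)

(** * Lebesgue measure on R^n *)

Section rV_measurable.
Context (R : realType) (n : nat).

Let coord (i : 'I_n) (v : 'rV[R]_n) : R := v 0 i.

Let rV_set0 : g_sigma_preimage coord set0.
Proof. exact: sigma_algebra0. Qed.

Let rV_setC A : g_sigma_preimage coord A -> g_sigma_preimage coord (~` A).
Proof. exact: sigma_algebraC. Qed.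

Let rV_bigcup (F : (set _)^nat) : (forall i, g_sigma_preimage coord (F i)) ->
  g_sigma_preimage coord (\bigcup_i F i).
Proof. exact: sigma_algebra_bigcup. Qed.

(* The product sigma-algebra, as the library does for [n.-tuple]; on [R^n] it
   is the Borel sigma-algebra. *)
HB.instance Definition _ :=
  @isMeasurable.Build (measure_tuple_display default_measure_display) 'rV[R]_n
    (g_sigma_preimage coord) rV_set0 rV_setC rV_bigcup.

Lemma measurable_rV_coord (i : 'I_n) :
  measurable_fun [set: 'rV[R]_n] (fun v : 'rV[R]_n => v 0 i).
Proof.
move=> _ Y mY; rewrite setTI; apply: sub_sigma_algebra => /=.
rewrite -bigcup_seq/=; exists i => /=; first by rewrite mem_index_enum.
by exists Y => //; rewrite setTI.
Qed.

Lemma measurable_rV d (T : measurableType d) (f : T -> 'rV[R]_n) :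
  (forall i, measurable_fun [set: T] (fun x => f x 0 i)) ->
  measurable_fun [set: T] f.
Proof.
move=> mf _ A mA; rewrite setTI.
have : preimage_set_system [set: T] f (g_sigma_preimage coord) (f @^-1` A).
  by exists A => //; rewrite setTI.
rewrite -g_sigma_preimage_comp; apply: smallest_sub.
  exact: sigma_algebra_measurable.
rewrite -bigcup_seq => B [i _ [C mC <-]]; rewrite setTI.
by rewrite -[X in measurable X]setTI; apply: mf.
Qed.

End rV_measurable.

Section lebesgue_rV.
Context (R : realType).

Definition rV_cons n (p : measurableTypeR R * 'rV[R]_n) : 'rV[R]_n.+1 :=
  \row_(i < n.+1) oapp (p.2 0) p.1 (unlift ord0 i).

Definition rV_uncons n (v : 'rV[R]_n.+1) : measurableTypeR R * 'rV[R]_n :=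
  (v 0 ord0, \row_(i < n) v 0 (lift ord0 i)).

Lemma rV_consK n : cancel (@rV_cons n) (@rV_uncons n).
Proof.
move=> [x v]; rewrite /rV_uncons /rV_cons !mxE unlift_none/=; congr pair.
by apply/rowP => i; rewrite !mxE liftK.
Qed.

Lemma measurable_rV_cons n : measurable_fun [set: measurableTypeR R * 'rV[R]_n] (@rV_cons n).
Proof.
apply: measurable_rV => i; case: (unliftP ord0 i) => [j ->|->].
  rewrite (_ : (fun _ => _) = (fun v : 'rV[R]_n => v 0 j) \o snd).
    apply: measurableT_comp; first exact: measurable_rV_coord.
    exact: measurable_snd.
  by apply/funext => p /=; rewrite /rV_cons mxE liftK.
rewrite (_ : (fun _ => _) = fst); first exact: measurable_fst.
by apply/funext => p /=; rewrite /rV_cons mxE unlift_none.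
Qed.

Lemma measurable_rV_uncons n :
  measurable_fun [set: 'rV[R]_n.+1] (@rV_uncons n).
Proof.
apply/measurable_fun_pairP; split; first exact: measurable_rV_coord.
apply: measurable_rV => i.
rewrite (_ : (fun _ => _) = fun v : 'rV[R]_n.+1 => v 0 (lift ord0 i)).
  exact: measurable_rV_coord.
by apply/funext => v /=; rewrite mxE.
Qed.

Section step.
Context n (mu : {sigma_finite_measure set 'rV[R]_n -> \bar R}).

Definition lebesgue_rV_step : set 'rV[R]_n.+1 -> \bar R :=
  pushforward (@lebesgue_measure R \x mu)%E (@rV_cons n).

Let step0 : lebesgue_rV_step set0 = 0%E.
Proof. by rewrite /lebesgue_rV_step /pushforward preimage_set0 measure0. Qed.

Let step_ge0 A : (0 <= lebesgue_rV_step A)%E.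
Proof. by rewrite /lebesgue_rV_step /pushforward; exact: measure_ge0. Qed.

Let mcons A : measurable A -> measurable (@rV_cons n @^-1` A).
Proof.
by move=> mA; rewrite -[X in measurable X]setTI; exact: measurable_rV_cons.
Qed.

Let step_sigma_additive : semi_sigma_additive lebesgue_rV_step.
Proof.
move=> F mF tF mUF; rewrite /lebesgue_rV_step /pushforward preimage_bigcup.
apply: measure_semi_sigma_additive.
- by move=> k; exact: mcons.
- apply/trivIsetP => /= i j _ _ ij; rewrite -preimage_setI.
  by move/trivIsetP : tF => /(_ _ _ _ _ ij) ->//; rewrite preimage_set0.
- by rewrite -preimage_bigcup; exact: mcons.
Qed.

HB.instance Definition _ := isMeasure.Build _ _ _ lebesgue_rV_step
  step0 step_ge0 step_sigma_additive.

Let step_sigma_finite : sigma_finite setT lebesgue_rV_step.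
Proof.
have /sigma_finiteP[G [TG ndG Goo]] := sigma_finiteT (@lebesgue_measure R).
have /sigma_finiteP[F [TF ndF Foo]] := sigma_finiteT mu.
exists (fun k => @rV_uncons n @^-1` (G k `*` F k)).
  apply/esym/seteqP; split => // v _.
  have [k _ Gk] : (\bigcup_k G k) (rV_uncons v).1 by rewrite -TG.
  have [l _ Fl] : (\bigcup_l F l) (rV_uncons v).2 by rewrite -TF.
  exists (maxn k l) => //; split.
    by move: Gk; exact/subsetPset/ndG/leq_maxl.
  by move: Fl; exact/subsetPset/ndF/leq_maxr.
move=> k; have [mG Gk] := Goo k; have [mF Fk] := Foo k.
have mGF : measurable (G k `*` F k) by exact: measurableX.
split.
  by rewrite -[X in measurable X]setTI; apply: measurable_rV_uncons.
rewrite /lebesgue_rV_step /pushforward -comp_preimage.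
rewrite (_ : _ \o _ = id); last by apply/funext => p; exact: rV_consK.
by rewrite preimage_id product_measure1E// lte_mul_pinfty// ge0_fin_numE.
Qed.

HB.instance Definition _ := Measure_isSigmaFinite.Build _ _ _ lebesgue_rV_step
  step_sigma_finite.
End step.

Fixpoint lebesgue_rV n : {sigma_finite_measure set 'rV[R]_n -> \bar R} :=
  if n is m.+1 then lebesgue_rV_step (lebesgue_rV m) else \d_(0 : 'rV[R]_0).

End lebesgue_rV.

(** * Lipschitz domains and surface measure *)

Section geometry.
Context (R : realType) (d : nat).
Local Notation E := 'rV[R]_d.

Definition dotp (x y : E) : R := \sum_(i < d) x 0 i * y 0 i.

(* The library's norm on ['rV_d] is the sup norm. *)
Definition enorm (x : E) : R := Num.sqrt (dotp x x).

Definition boundary (Omega : set E) : set E := closure Omega `\` interior Omega.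

(* Near each boundary point, Omega is the strict epigraph, in some unit
   direction n, of a Lipschitz function on the hyperplane orthogonal to n;
   [y - dotp y n *: n] is the projection of y onto that hyperplane. *)
Definition lipschitz_boundary (Omega : set E) : Prop :=
  forall x, boundary Omega x ->
  exists (r L : R) (n : E) (gam : E -> R),
    [/\ 0 < r, enorm n = 1,
        forall y z, `|gam y - gam z| <= L * enorm (y - z) &
        forall y, enorm (y - x) < r ->
          (Omega y <-> gam (y - dotp y n *: n) < dotp y n)].

Definition lipschitz_domain (Omega : set E) : Prop :=
  [/\ open Omega, connected Omega, bounded_set Omega &
      lipschitz_boundary Omega].

Local Open Scope ereal_scope.

(* The point 0 makes the diameter of the empty set 0 rather than -oo. *)
Definition diameter (A : set E) : \bar R :=
  ereal_sup (0 |` [set (enorm (p.1 - p.2))%:E | p in A `*` A]).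

Definition hausdorff_pre (s : nat) (delta : R) (A : set E) : \bar R :=
  ereal_inf [set \sum_(0 <= k <oo) diameter (F k) ^+ s |
    F in [set F : nat -> set E |
      A `<=` \bigcup_k F k /\ forall k, diameter (F k) <= delta%:E]].

Definition hausdorff (s : nat) (A : set E) : \bar R :=
  ereal_sup [set hausdorff_pre s delta A | delta in [set delta | (0 < delta)%R]].

(* The (d-1)-dimensional Hausdorff measure, without the normalising constant:
   only null sets and convergence in L^2 of the boundary are used. *)
Definition surface (A : set E) : \bar R := hausdorff d.-1 A.

(* GD and GN are the Dirichlet and Neumann parts; their measurability is what
   makes their surface measure meaningful. *)
Definition boundary_partition (Omega GD GN : set E) : Prop :=
  [/\ measurable GD /\ measurable GN,
      GD `<=` boundary Omega /\ GN `<=` boundary Omega,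
      GD `&` GN = set0,
      boundary Omega = closure GD `|` closure GN &
      0 < surface GD].

End geometry.

(** * Lebesgue and Sobolev spaces *)

Definition compactly_supported_in (R : realType) (T : topologicalType)
    (U : set T) (f : T -> R) : Prop :=
  exists2 K : set T, compact K /\ K `<=` U & forall x, ~ K x -> f x = 0.

Section sobolev.
Context (R : realType) (d : nat) (Omega : set 'rV[R]_d).
Local Notation E := 'rV[R]_d.
Local Notation leb := (lebesgue_rV R d).

Definition L2 : set (E -> R) := [set f : E -> R | measurable_fun Omega f /\
  (\int[leb]_(x in Omega) ((f x) ^+ 2)%:E < +oo)%E].

Definition ip (f g : E -> R) : R := \int[leb]_(x in Omega) (f x * g x).

Definition nL2 (f : E -> R) : R := Num.sqrt (ip f f).

Definition partial (i : 'I_d) (f : E -> R) : E -> R :=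
  fun x => 'D_(delta_mx 0 i) f x.

Definition smooth (f : E -> R) : Prop :=
  forall (s : seq 'I_d) x, differentiable (foldr partial f s) x.

(* C_c^oo(Omega) *)
Definition test_fun : set (E -> R) :=
  [set f | smooth f /\ compactly_supported_in Omega f].

(* An element of H^1 is represented by the pair (v, grad v). As the gradient is
   only determined up to a null set, equality in H^1 is [nH1 (v - w) = 0]. *)
Definition hfun : Type := ((E -> R) * ('I_d -> E -> R))%type.

Definition grad_pair (f : E -> R) : hfun := (f, fun i => partial i f).

Definition weak_grad (v : hfun) : Prop :=
  forall (theta : E -> R) (i : 'I_d), test_fun theta ->
  ip v.1 (partial i theta) = - ip (v.2 i) theta.

Definition H1 : set hfun :=
  [set v | [/\ L2 v.1, forall i, L2 (v.2 i) & weak_grad v]].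

Definition ip_grad (v w : hfun) : R := \sum_(i < d) ip (v.2 i) (w.2 i).

Definition nH1 (v : hfun) : R := Num.sqrt (ip v.1 v.1 + ip_grad v v).

(* The closure of C_c^oo(Omega) in H^1. *)
Definition H10 : set hfun :=
  [set v | H1 v /\ exists2 f : nat -> E -> R, (forall n, test_fun (f n)) &
    nH1 (v - grad_pair (f n)) @[n --> \oo] --> 0].

(* tau is the trace of v in L^2 of the boundary: the trace operator is the
   continuous extension of the restriction of smooth functions. *)
Definition trace (v : hfun) (tau : E -> R) : Prop :=
  measurable_fun (boundary Omega) tau /\
  exists f : nat -> E -> R,
    [/\ forall n, smooth (f n),
        nH1 (v - grad_pair (f n)) @[n --> \oo] --> 0 &
        (\int[@surface R d]_(x in boundary Omega) ((f n x - tau x) ^+ 2)%:E)%E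
          @[n --> \oo] --> 0%E].

Definition H1_zero_trace (GD : set E) : set hfun :=
  [set v | H1 v /\ exists2 tau, trace v tau &
    surface (GD `&` [set x | tau x != 0]) = 0%E].

Definition vfield : Type := 'I_d -> E -> R.

Definition L2v : set vfield := [set f | forall k, L2 (f k)].

Definition ipv (f g : vfield) : R := \sum_(k < d) ip (f k) (g k).

Definition nL2v (f : vfield) : R := Num.sqrt (ipv f f).

Definition hvec : Type := 'I_d -> hfun.

Definition hval (u : hvec) : vfield := fun k => (u k).1.

Definition divg (u : hvec) : E -> R := \sum_(k < d) (u k).2 k.

Definition eps (u : hvec) (i j : 'I_d) : E -> R :=
  2^-1 *: ((u i).2 j + (u j).2 i).

Definition ip_eps (u v : hvec) : R :=
  \sum_(i < d) \sum_(j < d) ip (eps u i j) (eps v i j).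

Definition nH1v (u : hvec) : R :=
  Num.sqrt (ipv (hval u) (hval u) + \sum_(k < d) ip_grad (u k) (u k)).

Definition VD (GD : set E) : set hvec :=
  [set u | forall k, H1_zero_trace GD (u k)].

Definition inf_sup (GD : set E) : Prop :=
  exists2 Cis : R, 0 < Cis & forall w, L2 w ->
  ((Cis * nL2 w)%:E <=
   ereal_sup [set (ip (divg v) w / nH1v v)%:E |
                v in [set v | VD GD v /\ nH1v v != 0%R]])%E.

Definition korn (GD : set E) : Prop :=
  exists2 CK : R, 0 < CK & forall v, VD GD v -> nH1v v <= CK * Num.sqrt (ip_eps v v).

End sobolev.

(** * Spaces of functions of time with values in a (semi)normed space *)

Section bochner.
Context (R : realType) (V : lmodType R).
Local Notation mu := (@lebesgue_measure R).

Record step_data := StepData {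
  step_size : nat;
  step_dom : 'I_step_size -> set (measurableTypeR R);
  step_val : 'I_step_size -> V }.

Definition step_fun (c : step_data) (t : R) : V :=
  \sum_(k < step_size c) \1_(step_dom k) t *: step_val k.

Definition step_int (D : set R) (c : step_data) : V :=
  \sum_(k < step_size c) fine (mu (D `&` step_dom k)) *: step_val k.

(* X is a linear subspace of V and N a seminorm on it. *)
Context (X : set V) (N : V -> R).

Definition step_in (c : step_data) : Prop :=
  forall k : 'I_(step_size c), measurable (step_dom k) /\ X (step_val k).

Definition strongly_measurable (D : set R) (u : R -> V) : Prop :=
  {ae mu, forall t, D t -> X (u t)} /\
  exists2 c : nat -> step_data, (forall n, step_in (c n)) &
    {ae mu, forall t, D t -> N (u t - step_fun (c n) t) @[n --> \oo] --> 0}.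

Definition bochner_integral (D : set R) (u : R -> V) (I : V) : Prop :=
  [/\ X I, strongly_measurable D u &
    exists c : nat -> step_data,
      [/\ forall n, step_in (c n),
          (\int[mu]_(t in D) (N (u t - step_fun (c n) t))%:E)%E
            @[n --> \oo] --> 0%E &
          N (I - step_int D (c n)) @[n --> \oo] --> 0]].

Context (T : R).

(* L^2(0,T;X) *)
Definition time_L2 (u : R -> V) : Prop :=
  strongly_measurable `]0, T[ u /\
  (\int[mu]_(t in `]0%R, T[) ((N (u t)) ^+ 2)%:E < +oo)%E.

(* Test functions of class C^1, not C^oo: the two classes define the same weak
   derivative. *)
Definition time_test : set (R -> R) :=
  [set theta : R -> R | [/\ forall t, derivable theta t 1, continuous (derive1 theta) &
                   compactly_supported_in `]0, T[ theta]].

Definition time_weak_deriv (u du : R -> V) : Prop :=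
  forall theta, time_test theta -> exists2 I : V,
    bochner_integral `]0, T[ (fun t => derive1 theta t *: u t) I &
    bochner_integral `]0, T[ (fun t => theta t *: du t) (- I).

(* u is the representative of its class that is continuous on [0,T], which
   gives a meaning to u(0); du is its weak time derivative. *)
Definition time_H1 (u du : R -> V) : Prop :=
  [/\ time_L2 u, time_L2 du, time_weak_deriv u du &
      forall t, t \in `[0, T] -> X (u t) /\
        N (u s - u t) @[s --> within `[0, T] (nbhs t)] --> 0].

Definition time_L2_norm (u : R -> V) : R :=
  Num.sqrt (\int[mu]_(t in `]0, T[) ((N (u t)) ^+ 2)).

Definition time_Linf_norm (u : R -> V) : \bar R :=
  ess_sup mu ((fun t => (N (u t))%:E) \_ `]0, T[).

End bochner.

(** * The coupled problem and the decoupled iteration *)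

(* kK and kD are the diffusion coefficients K and D. *)
Record coefficients (R : realType) := Coefficients {
  alpha : R; beta : R; lambda : R; mu : R; kK : R; kD : R;
  c1 : R; c2 : R; b0 : R; gamma : R }.

Definition admissible (R : realType) (p : coefficients R) : Prop :=
  [/\ [/\ 0 < alpha p, 0 < beta p & 0 < lambda p],
      [/\ 0 < mu p, 0 < kK p & 0 < kD p],
      [/\ 0 <= c1 p, 0 <= c2 p, 0 <= b0 p & 0 <= gamma p],
      0 <= c1 p - b0 p & 0 <= c2 p - b0 p].

Section problem.
Context (R : realType) (d : nat) (Omega GD : set 'rV[R]_d) (T : R).
Local Notation E := 'rV[R]_d.
Local Notation "'( f , g )" := (ip Omega f g).
Local Notation V := (VD Omega GD).
Local Notation W := (L2 Omega).
Local Notation Q := (H10 Omega).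

Record sources := Sources {
  src_f : R -> vfield R d;
  src_g : R -> E -> R;
  src_h : R -> E -> R }.

Definition regular_sources (F : sources) : Prop :=
  [/\ exists df, time_H1 (L2v Omega) (nL2v Omega) T (src_f F) df,
      exists dg, time_H1 W (nL2 Omega) T (src_g F) dg &
      exists dh, time_H1 W (nL2 Omega) T (src_h F) dh].

Record initial_data := InitialData {
  init_u : hvec R d;
  init_phi : hfun R d;
  init_psi : hfun R d }.

Definition regular_initial_data (I0 : initial_data) : Prop :=
  [/\ V (init_u I0), Q (init_phi I0) & Q (init_psi I0)].

Record evolution := Evolution {
  ev_u : R -> hvec R d;   ev_du : R -> hvec R d;
  ev_xi : R -> E -> R;    ev_dxi : R -> E -> R;
  ev_phi : R -> hfun R d; ev_dphi : R -> E -> R;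
  ev_psi : R -> hfun R d; ev_dpsi : R -> E -> R }.

Context (p : coefficients R) (F : sources) (I0 : initial_data).

Definition init_xi : E -> R :=
  - lambda p *: divg (init_u I0) + alpha p *: (init_phi I0).1
    + beta p *: (init_psi I0).1.

Definition initial_u_xi (z : evolution) : Prop :=
  nH1v Omega (ev_u z 0 - init_u I0) = 0 /\ nL2 Omega (ev_xi z 0 - init_xi) = 0.

Definition mechanics (z : evolution) (t : R) : Prop :=
  (forall v, V v ->
     2 * mu p * ip_eps Omega (ev_u z t) v - '(ev_xi z t, divg v)
     = ipv Omega (src_f F t) (hval v)) /\
  (forall w, W w ->
     '(divg (ev_u z t), w) + (lambda p)^-1 * '(ev_xi z t, w)
     - alpha p / lambda p * '((ev_phi z t).1, w)
     - beta p / lambda p * '((ev_psi z t).1, w) = 0).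

(* dxi is the time derivative of the total pressure that feeds the transport
   equations: the current one in the coupled system, the previous one in the
   iteration. *)
Definition transport (dxi : R -> E -> R) (z : evolution) (t : R) : Prop :=
  (forall q, Q q ->
     (c1 p + alpha p ^+ 2 / lambda p) * '(ev_dphi z t, q.1)
     + (alpha p * beta p / lambda p - b0 p) * '(ev_dpsi z t, q.1)
     - alpha p / lambda p * '(dxi t, q.1)
     + kK p * ip_grad Omega (ev_phi z t) q
     + gamma p * '((ev_phi z t).1 - (ev_psi z t).1, q.1)
     = '(src_g F t, q.1)) /\
  (forall s, Q s ->
     (c2 p + beta p ^+ 2 / lambda p) * '(ev_dpsi z t, s.1)
     + (alpha p * beta p / lambda p - b0 p) * '(ev_dphi z t, s.1)
     - beta p / lambda p * '(dxi t, s.1)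
     + kD p * ip_grad Omega (ev_psi z t) s
     + gamma p * '((ev_psi z t).1 - (ev_phi z t).1, s.1)
     = '(src_h F t, s.1)).

Definition regular_u_xi (z : evolution) : Prop :=
  time_H1 V (nH1v Omega) T (ev_u z) (ev_du z) /\
  time_H1 W (nL2 Omega) T (ev_xi z) (ev_dxi z).

(* H^1(0,T;Q) *)
Definition time_H1_H10 (phi : R -> hfun R d) (dphi : R -> E -> R) : Prop :=
  exists2 Dphi, time_H1 Q (nH1 Omega) T phi Dphi &
    forall t, dphi t = (Dphi t).1.

(* L^2(0,T;Q) and H^1(0,T;L^2): the regularity under which each transport step
   makes sense, its data being only L^2 in space and time *)
Definition time_parabolic (phi : R -> hfun R d) (dphi : R -> E -> R) : Prop :=
  time_L2 Q (nH1 Omega) T phi /\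
  time_H1 W (nL2 Omega) T (fun t => (phi t).1) dphi.

Definition coupled_solution (z : evolution) : Prop :=
  [/\ regular_u_xi z,
      time_H1_H10 (ev_phi z) (ev_dphi z) /\ time_H1_H10 (ev_psi z) (ev_dpsi z),
      {ae (@lebesgue_measure R), forall t, t \in `]0, T] ->
         mechanics z t /\ transport (ev_dxi z) z t},
      initial_u_xi z &
      nH1 Omega (ev_phi z 0 - init_phi I0) = 0 /\
      nH1 Omega (ev_psi z 0 - init_psi I0) = 0].

(* Of the initial guess [z 0], only the existence of a square integrable time
   derivative of its total pressure is required. *)
Definition decoupled_iteration (z : nat -> evolution) : Prop :=
  time_H1 W (nL2 Omega) T (ev_xi (z 0)) (ev_dxi (z 0)) /\
  forall i,
    [/\ regular_u_xi (z i.+1),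
        time_parabolic (ev_phi (z i.+1)) (ev_dphi (z i.+1)) /\
          time_parabolic (ev_psi (z i.+1)) (ev_dpsi (z i.+1)),
        {ae (@lebesgue_measure R), forall t, t \in `]0, T] ->
           transport (ev_dxi (z i)) (z i.+1) t /\ mechanics (z i.+1) t},
        initial_u_xi (z i.+1) &
        nL2 Omega ((ev_phi (z i.+1) 0).1 - (init_phi I0).1) = 0 /\
        nL2 Omega ((ev_psi (z i.+1) 0).1 - (init_psi I0).1) = 0].

Definition err_dxi (z : evolution) (y : evolution) : R :=
  time_L2_norm (nL2 Omega) T (ev_dxi y - ev_dxi z).

Definition converges_to (y : nat -> evolution) (z : evolution) : Prop :=
  [/\ time_Linf_norm (nH1v Omega) T (ev_u (y i) - ev_u z) @[i --> \oo] --> 0%E,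
      time_Linf_norm (nL2 Omega) T (ev_xi (y i) - ev_xi z) @[i --> \oo] --> 0%E,
      time_Linf_norm (nH1 Omega) T (ev_phi (y i) - ev_phi z)
        @[i --> \oo] --> 0%E &
      time_Linf_norm (nH1 Omega) T (ev_psi (y i) - ev_psi z)
        @[i --> \oo] --> 0%E].

Definition same_evolution (y z : evolution) : Prop :=
  forall t, t \in `[0, T] ->
    [/\ nH1v Omega (ev_u y t - ev_u z t) = 0,
        nL2 Omega (ev_xi y t - ev_xi z t) = 0,
        nH1 Omega (ev_phi y t - ev_phi z t) = 0 &
        nH1 Omega (ev_psi y t - ev_psi z t) = 0].

End problem.

(* Main.v *)
Require Import Defs.
From mathcomp Require Import all_boot all_order all_algebra.
From mathcomp Require Import all_classical all_reals all_analysis.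
From mathcomp Require Import ess_sup_inf measurable_realfun ring lra.

(* Let e be the errors, Cis the inf-sup constant, [C = Cis^2 / (2 mu)] and
   [rho = alpha e_phi + beta e_psi].

   Mechanics. The error equations are linear, hence satisfied by the increments
   of the errors between two times. Testing with the increment itself and using
   the inf-sup condition gives [(1 + 2 lambda C) |d e_xi|^2 <= |d rho|^2]. This is
   passed to difference quotients, so the mechanics equations, which are not
   known to be differentiable in time, are never differentiated.

   Transport. The energy [En = K |grad e_phi|^2 + D |grad e_psi|^2
   + gamma |e_phi - e_psi|^2] equals [(F1, e_phi) + (F2, e_psi)], where F1 and F2
   collect the time derivatives, and as it is quadratic and nonnegative,
   [En t - En s <= 2 ((F1 t, d e_phi) + (F2 t, d e_psi))]. Integrating over t with
   t - s fixed, and letting t - s tend to 0, bounds En at almost every time by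
   twice the integral of [(F1, e_phi') + (F2, e_psi')], although the gradients
   have no time derivative. As [c_i >= b_0 >= 0], Young's inequality turns this into
   [int |rho'|^2 <= int |dxi|^2], where dxi is the error in the time derivative of
   the previous pressure, together with a bound on En by the same integral.

   The two estimates give the contraction, and the bound on En gives convergence
   of phi and psi through Poincare's inequality, then that of xi and u. Uniqueness
   follows as a coupled solution is a constant iteration. *)

Set Implicit Arguments.
Unset Strict Implicit.
Unset Printing Implicit Defensive.

Import Order.TTheory GRing.Theory Num.Theory.
Import numFieldNormedType.Exports.

Local Open Scope classical_set_scope.
Local Open Scope ring_scope.


(** * Null sets, translations and limits *)

(** The obstacle is regularity in time. A transport iterate lies in L2(0,T;Q) with a time derivative
    only in L2(0,T;L2), so that derivative is not an admissible test function, whereas the value of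
    an error at another time is, being a difference of elements of [H10]. This is why all estimates
    are made on increments. A weak time derivative is used in a single form, [wreg]: the pairing of
    an increment with a fixed element is the integral of the pairing of the derivative, off one null
    set of times. The way back to the derivatives is the convergence of difference quotients in L2
    in time, proved for any semi-inner product by approximating the derivative with step functions
    and applying scalar differentiation to their indicators. The number 1 + 2 lambda C is what is
    kept of (1 + lambda C)^2, which Young's inequality extracts from (1 + lambda C) |X|^2 <= (r,
    X). *)

Section null_sets.
Context d (X : measurableType d) (R : realType).
Variable m : {measure set X -> \bar R}.
Local Open Scope ereal_scope.
Import HBNNSimple.

(* No measurability is required of the integrands: the integral of a
   nonnegative function is the supremum of those of the simple functions
   below it. *)
Lemma ge0_le_integral_null (N : set X) (f g : X -> \bar R) :
  measurable N -> m N = 0 -> (forall x, 0 <= f x) -> (forall x, 0 <= g x) ->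
  (forall x, ~ N x -> f x <= g x) -> \int[m]_x f x <= \int[m]_x g x.
Proof.
move=> mN N0 f0 g0 fg.
rewrite (ge0_integralTE _ f0) (ge0_integralTE _ g0).
apply/ge_ereal_sup => _ [h /= hf <-].
have mCN := measurableC mN.
(* Cutting a simple function below [f] to the complement of [N] puts it below [g] without changing
   its integral. *)
apply: ereal_sup_ubound => /=; exists (proj_nnsfun h mCN).
  move=> x; rewrite -mrestrict patchE; case: ifPn => [|_]; last exact: g0.
  by rewrite inE => Nx; exact: (le_trans (hf x) (fg x Nx)).
rewrite -!integralT_nnsfun.
rewrite [RHS](@ge0_negligible_integral _ _ _ _ _ N)//; last first.
- by move=> x _; rewrite lee_fin.
- exact/measurable_EFinP.
rewrite setTD [RHS]integral_mkcond; apply: eq_integral => x _.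
by rewrite -mrestrict !patchE; case: ifPn.
Qed.

(** The positive and the negative part are each compared in both directions off [N]. Neither [D] nor
    [f] is measurable here, so the lemma applies to time integrals before measurability is
    established. *)
Lemma integral_null_setD (N D : set X) (f : X -> \bar R) :
  measurable N -> m N = 0 ->
  \int[m]_(x in D) f x = \int[m]_(x in D `\` N) f x.
Proof.
move=> mN N0.
have pos (g : X -> \bar R) : (forall x, 0 <= g x) ->
    \int[m]_(x in D) g x = \int[m]_(x in D `\` N) g x.
  move=> g0; rewrite [LHS]integral_mkcond [RHS]integral_mkcond.
  have r0 (E : set X) x : 0 <= (g \_ E) x by rewrite patchE; case: ifP.
  apply/eqP; rewrite eq_le; apply/andP; split.
    apply: (ge0_le_integral_null mN N0) => // x Nx; rewrite !patchE.
    case: ifPn => [xD|_]; last by case: ifP.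
    by rewrite ifT//; apply: mem_set; split => //; exact: set_mem.
  apply: (ge0_le_integral_null mN N0) => // x Nx; rewrite !patchE.
  case: ifPn => [|_]; last by case: ifP.
  by rewrite inE => -[Dx _]; rewrite mem_set.
by rewrite integralE [RHS]integralE pos// pos.
Qed.

Lemma eq_integral_null (N D : set X) (f g : X -> \bar R) :
  measurable N -> m N = 0 -> (forall x, D x -> ~ N x -> f x = g x) ->
  \int[m]_(x in D) f x = \int[m]_(x in D) g x.
Proof.
move=> mN N0 fg; rewrite (integral_null_setD _ _ mN N0).
rewrite [RHS](integral_null_setD _ _ mN N0); apply: eq_integral => x.
by rewrite inE => -[Dx Nx]; exact: fg.
Qed.

End null_sets.

Section translation.
Context (R : realType).
Local Notation mu := (@lebesgue_measure R).
Local Open Scope ereal_scope.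

Let sub_h (h t : measurableTypeR R) : measurableTypeR R := (t - h)%R.

Let msub_h h : measurable_fun setT (sub_h h).
Proof. exact: measurable_funB. Qed.

Let pre_itv h (a b : R) : sub_h h @^-1` `]a, b]%classic = `](a + h)%R, (b + h)%R]%classic.
Proof.
by apply/funext => t; rewrite /preimage/= /sub_h !in_itv/= ltrBrDr lerBlDr.
Qed.

(** A measure with the right value on the intervals ]a, b] is the Lebesgue measure, and a
    translation preserves their lengths. *)
Lemma lebesgue_measure_shift (h : R) (A : set R) : measurable A ->
  pushforward mu (fun t : measurableTypeR R => (t - h)%R : measurableTypeR R) A = mu A.
Proof.
move=> mA; apply/esym.
pose m := pushforward mu (fun t : measurableTypeR R => (t - h)%R : measurableTypeR R).
apply: (@lebesgue_measure_unique _ m) => //=; first exact: (@msub_h h).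
move=> _ _ [[a b]] _ <-.
rewrite /m /pushforward (pre_itv h a b) /= !lebesgue_measure_itv/=.
by rewrite !lte_fin ltrD2r; case: ifP => // _; congr EFin; ring.
Qed.

Lemma ge0_integral_shift (h : R) (f : R -> \bar R) :
  measurable_fun [set: R] f -> (forall t, 0 <= f t) ->
  \int[mu]_t f (t - h)%R = \int[mu]_t f t.
Proof.
move=> mf f0.
have := @ge0_integral_pushforward _ _ _ _ _ (sub_h h) (msub_h h) mu setT f.
move=> /(_ measurableT mf (fun t _ => f0 t)); rewrite preimage_setT => <-.
by apply: eq_measure_integral => A mA _; rewrite -[RHS](lebesgue_measure_shift h mA).
Qed.

Lemma null_shift (h : R) (N : set R) : measurable N -> mu N = 0 ->
  measurable [set t | N (t - h)%R] /\ mu [set t | N (t - h)%R] = 0.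
Proof.
move=> mN N0; split; last by rewrite -N0 -[RHS](lebesgue_measure_shift h mN).
by rewrite -[X in measurable X]setTI; exact: (@msub_h h measurableT _ mN).
Qed.

(** By Tonelli: a point [r] belongs to the windows of exactly the [t] in [r, r + h], a set of
    measure [h]. *)
Lemma integral_window (h : R) (k : R -> \bar R) : (0 <= h)%R ->
  measurable_fun [set: R] k -> (forall t, 0 <= k t) ->
  \int[mu]_t \int[mu]_(r in `[(t - h)%R, t]) k r = h%:E * \int[mu]_r k r.
Proof.
move=> h0 mk k0.
(* The window condition is put on [t - r], so that joint measurability is that of an indicator
   composed with a subtraction. *)
pose f (z : measurableTypeR R * measurableTypeR R) : \bar R :=
  k z.2 * (\1_(`[0%R, h]%classic : set R) (z.1 - z.2)%R)%:E.
have mf : measurable_fun setT f.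
  apply: emeasurable_funM.
    exact: (measurableT_comp mk measurable_snd).
  apply/measurable_EFinP.
  apply: (@measurableT_comp _ _ _ _ _ _ (\1_(`[0%R, h]%classic : set R) : R -> R)).
    exact: measurable_indic.
  exact: (measurable_funB measurable_fst measurable_snd).
have f0 z : 0 <= f z by rewrite mule_ge0// lee_fin.
have fubini_f := @fubini_tonelli _ _ _ _ R mu mu f mf f0.
have inE1 t r : (\1_(`[0%R, h]%classic : set R) (t - r)%R : R) = \1_(`[(t - h)%R, t]%classic) r.
  rewrite !indicE; congr (_%:R); congr nat_of_bool; apply/idP/idP; rewrite !inE/= !in_itv/= => /andP[? ?]; apply/andP; split; lra.
have inE2 t r : (\1_(`[0%R, h]%classic : set R) (t - r)%R : R) = \1_(`[r, (r + h)%R]%classic) t.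
  rewrite !indicE; congr (_%:R); congr nat_of_bool; apply/idP/idP; rewrite !inE/= !in_itv/= => /andP[? ?]; apply/andP; split; lra.
transitivity (\int[mu]_t \int[mu]_r f (t, r)).
  apply: eq_integral => t _; rewrite [LHS]integral_mkcond.
  apply: eq_integral => r _; rewrite /f [(_, _).1]/= [(_, _).2]/= inE1 patchE indicE.
  by case: (r \in _); rewrite ?mule1 ?mule0.
etransitivity; first exact: fubini_f.
transitivity (\int[mu]_r (h%:E * k r)); last by apply: ge0_integralZl_EFin.
apply: eq_integral => r _.
transitivity (\int[mu]_t (k r * (\1_(`[r, (r + h)%R]%classic) t)%:E)).
  by apply: eq_integral => t _; rewrite /f [(_, _).1]/= [(_, _).2]/= inE2.
have -> : \int[mu]_t (k r * (\1_(`[r, (r + h)%R]%classic) t)%:E) =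
    k r * \int[mu]_t (\1_(`[r, (r + h)%R]%classic) t)%:E.
  apply: (@ge0_integralZl _ _ R mu setT measurableT
    (fun t => (\1_(`[r, (r + h)%R]%classic) t)%:E)).
  - by apply/measurable_EFinP; exact: measurable_indic.
  - by move=> t _; rewrite lee_fin.
  - exact: k0.
rewrite integral_indic; [|exact: measurableT|exact: measurable_itv].
rewrite setIT; transitivity (k r * h%:E); last exact: muleC.
congr (_ * _); change (mu `[r, (r + h)%R]%classic = h%:E).
rewrite lebesgue_measure_itv/= lte_fin ltrDl.
case: ifPn => [_|]; first by rewrite -EFinB addrC addKr.
by rewrite -leNgt => hle; rewrite (_ : h = 0%R)//; apply/eqP; rewrite eq_le hle h0.
Qed.

End translation.

Lemma squeeze_dist (R : realType) (T : Type) (F : set_system T) {FF : Filter F}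
    (f g : T -> R) (l : R) :
  (\forall x \near F, `|l - f x| <= g x) -> g x @[x --> F] --> 0 ->
  f x @[x --> F] --> l.
Proof.
move=> fg g0; apply/cvgrPdist_le => e e0.
move/cvgrPdist_le : g0 => /(_ e e0).
apply: filterS2 fg => x fgx; rewrite sub0r normrN.
exact: le_trans (le_trans fgx (ler_norm _)).
Qed.

Section ereal_limits.
Context (R : realType).
Local Open Scope ereal_scope.

Lemma ge0_cvge0P (f : nat -> \bar R) : (forall n, 0 <= f n) ->
  (f n @[n --> \oo] --> 0) <->
  (forall e : R, (0 < e)%R -> \forall n \near \oo, f n <= e%:E).
Proof.
move=> f0; split=> [f_cvg e e0|H].
  have /fine_cvgP[fnum fcvg] := f_cvg.
  move/cvgrPdist_le : fcvg => /(_ e e0) fcvg.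
  near=> n; have fn : f n \is a fin_num by near: n.
  have : (`|0 - fine (f n)| <= e)%R by near: n.
  by rewrite sub0r normrN ger0_norm ?fine_ge0// -lee_fin fineK.
apply/fine_cvgP; split.
  have := H 1%R ltr01; apply: filterS => n fn.
  by rewrite ge0_fin_numE// (le_lt_trans fn)// ltry.
apply/cvgrPdist_le => e e0; have := H e e0; apply: filterS => n fn.
have fin : f n \is a fin_num by rewrite ge0_fin_numE// (le_lt_trans fn)// ltry.
by rewrite sub0r normrN ger0_norm ?fine_ge0// -lee_fin /= fineK.
Unshelve. all: by end_near. Qed.

Lemma cvge0_near (f : nat -> \bar R) (e : R) : (forall n, 0 <= f n) ->
  (0 < e)%R -> f n @[n --> \oo] --> 0 -> \forall n \near \oo, f n <= e%:E.
Proof. by move=> f0 e0 /(ge0_cvge0P f0)/(_ _ e0). Qed.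

Lemma near_cvge0 (f : nat -> \bar R) : (forall n, 0 <= f n) ->
  (forall e : R, (0 < e)%R -> \forall n \near \oo, f n <= e%:E) ->
  f n @[n --> \oo] --> 0.
Proof. by move=> f0 fe; apply/(ge0_cvge0P f0). Qed.

End ereal_limits.

(** * Monotonicity and linearity of integrals *)

Section integral_monotone.
Context d (X : measurableType d) (R : realType).
Variable m : {measure set X -> \bar R}.
Local Open Scope ereal_scope.

Lemma ge0_le_integral_all (D : set X) (f g : X -> \bar R) :
  (forall x, D x -> 0 <= f x) -> (forall x, D x -> f x <= g x) ->
  \int[m]_(x in D) f x <= \int[m]_(x in D) g x.
Proof.
move=> f0 fg; rewrite integral_mkcond (integral_mkcond D g).
apply: (@ge0_le_integral_null _ _ _ _ set0) => // x.
- by rewrite patchE; case: ifPn => //; rewrite inE => /f0.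
- rewrite patchE; case: ifPn => //; rewrite inE => Dx.
  exact: (le_trans (f0 x Dx) (fg x Dx)).
- by move=> _; rewrite !patchE; case: ifPn => //; rewrite inE => /fg.
Qed.

Lemma ge0_le_integral_set (D E : set X) (f : X -> \bar R) :
  D `<=` E -> (forall x, E x -> 0 <= f x) ->
  \int[m]_(x in D) f x <= \int[m]_(x in E) f x.
Proof.
move=> DE f0; rewrite integral_mkcond (integral_mkcond E).
apply: (@ge0_le_integral_null _ _ _ _ set0) => // x.
- by rewrite patchE; case: ifPn => //; rewrite inE => /DE /f0.
- by rewrite patchE; case: ifPn => //; rewrite inE => /f0.
move=> _; rewrite !patchE; case: ifPn; rewrite ?inE => xD.
  by rewrite ifT// inE; exact: DE.
by case: ifPn => //; rewrite inE => /f0.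
Qed.

End integral_monotone.

Section real_integrals.
Context d (X : measurableType d) (R : realType).
Variable m : {measure set X -> \bar R}.
Variables (D : set X) (mD : measurable D).
Implicit Types f g : X -> R.
Local Notation integ f := (m.-integrable D (EFin \o f)).

Lemma eq_integ f g : (forall x, D x -> f x = g x) -> integ f -> integ g.
Proof.
by move=> fg; apply: (eq_integrable mD) => x; rewrite inE => Dx /=; rewrite fg.
Qed.

Lemma integD f g : integ f -> integ g -> integ (fun x => f x + g x).
Proof. by move=> if_ ig; exact: (integrableD mD if_ ig). Qed.

Lemma integB f g : integ f -> integ g -> integ (fun x => f x - g x).
Proof. by move=> if_ ig; exact: (integrableB mD if_ ig). Qed.

Lemma integZ (a : R) f : integ f -> integ (fun x => a * f x).
Proof. by move=> if_; exact: (integrableZl mD a if_). Qed.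

Lemma integ_sum (I : Type) (r : seq I) (h : I -> X -> R) :
  (forall i, integ (h i)) -> integ (fun x => \sum_(i <- r) h i x).
Proof.
move=> ih; apply: (eq_integrable mD (fun x => \sum_(i <- r) (h i x)%:E)%E).
  by move=> x _; rewrite /= sumEFin.
by apply: integrable_sum => // i _; exact: ih.
Qed.

Lemma le_integ f g : measurable_fun D f -> (forall x, D x -> `|f x| <= g x) ->
  integ g -> integ f.
Proof.
move=> mf fg; apply: (le_integrable mD); first exact/measurable_EFinP.
by move=> x Dx; rewrite /= lee_fin (le_trans (fg x Dx))// ler_norm.
Qed.

Lemma integ_measurable f : integ f -> measurable_fun D f.
Proof. by move=> /integrableP[/measurable_EFinP]. Qed.

Lemma ge0_integ f : measurable_fun D f -> (forall x, D x -> 0 <= f x) ->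
  (\int[m]_(x in D) (f x)%:E < +oo)%E -> integ f.
Proof.
move=> mf f0 fi; apply/integrableP; split; first exact/measurable_EFinP.
apply: le_lt_trans fi; apply: ge0_le_integral_all => x Dx //=.
by rewrite ger0_norm ?f0.
Qed.

Lemma integ_lty f : integ f -> (\int[m]_(x in D) (f x)%:E < +oo)%E.
Proof. by move=> /(integrable_fin_num mD); rewrite fin_numE ltey => /andP[]. Qed.

Lemma integ_cst (c : R) : (m D < +oo)%E -> integ (fun=> c).
Proof.
move=> fD; apply/integrableP; split; first exact/measurable_EFinP.
rewrite [ltLHS](_ : _ = (`|c|%:E * m D)%E); last exact: integral_cst.
exact: lte_mul_pinfty.
Qed.

Lemma integ_bounded f (c : R) : (m D < +oo)%E -> measurable_fun D f ->
  (forall x, D x -> `|f x| <= c) -> integ f.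
Proof. by move=> fD mf fc; apply: le_integ fc _ => //; exact: integ_cst. Qed.

Lemma EFin_Rintegral f : integ f ->
  (\int[m]_(x in D) (f x)%:E)%E = (\int[m]_(x in D) f x)%:E.
Proof. by move=> if_; rewrite /Rintegral fineK//; exact: integrable_fin_num. Qed.

Lemma Rintegral_sum (I : Type) (r : seq I) (h : I -> X -> R) :
  (forall i, integ (h i)) ->
  \int[m]_(x in D) (\sum_(i <- r) h i x) = \sum_(i <- r) \int[m]_(x in D) h i x.
Proof.
move=> ih; rewrite [LHS]/Rintegral.
rewrite [X in fine X](_ : _ = (\int[m]_(x in D) (\sum_(i <- r) (h i x)%:E))%E); last first.
  by apply: eq_integral => x _; rewrite sumEFin.
rewrite integral_sum//; under eq_bigr do rewrite EFin_Rintegral//.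
by rewrite sumEFin.
Qed.

End real_integrals.

Arguments eq_integ {d X R} m {D} mD f {g}.
Arguments integD {d X R} m {D} mD {f g}.
Arguments integB {d X R} m {D} mD {f g}.
Arguments integZ {d X R} m {D} mD a {f}.
Arguments integ_sum {d X R} m {D} mD {I} r {h}.
Arguments le_integ {d X R} m {D} mD {f} g.
Arguments integ_measurable {d X R} m {D f}.
Arguments ge0_integ {d X R} m {D} {f}.
Arguments integ_lty {d X R} m {D} mD {f}.
Arguments integ_cst {d X R} m {D} mD c.
Arguments integ_bounded {d X R} m {D} mD {f} c.
Arguments EFin_Rintegral {d X R} m {D} mD {f}.
Arguments Rintegral_sum {d X R} m {D} mD {I} r {h}.

(** * Window averages and mean oscillation *)

Section oscillation.
Context (R : realType).
Local Notation mu := (@lebesgue_measure R).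
Local Open Scope ereal_scope.

Definition window n (t : R) : set R := `[(t - n.+1%:R^-1)%R, t]%classic.

Lemma measurable_window n t : measurable (window n t).
Proof. exact: measurable_itv. Qed.
Hint Resolve measurable_window : core.

Lemma measure_window n t : mu (window n t) = (n.+1%:R^-1 : R)%:E.
Proof.
rewrite /window lebesgue_measure_itv/= lte_fin ltrBlDr ltrDl invr_gt0 ltr0n.
by rewrite /= -EFinB opprB addrC subrK.
Qed.

(** The backward Steklov mean: the factor is the inverse length of the window. *)
Definition avg n (k : R -> \bar R) (t : R) : \bar R :=
  n.+1%:R%:E * \int[mu]_(r in window n t) k r.

Lemma avg_ge0 n k t : (forall r, 0 <= k r) -> 0 <= avg n k t.
Proof. by move=> k0; rewrite mule_ge0 ?integral_ge0// lee_fin. Qed.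

Lemma le_avg n (k l : R -> \bar R) t :
  (forall r, 0 <= k r) -> (forall r, window n t r -> k r <= l r) ->
  avg n k t <= avg n l t.
Proof.
move=> k0 kl; rewrite /avg lee_wpmul2l ?lee_fin//.
by apply: ge0_le_integral_all => // r; exact: kl.
Qed.

Lemma avg_cst n (c : R) t : (0 <= c)%R -> avg n (fun=> c%:E) t = c%:E.
Proof.
move=> c0; rewrite /avg integral_cst; last exact: measurable_window.
rewrite [X in _ * (_ * X)](measure_window n t) -!EFinM; congr EFin.
by field; rewrite addrC natr1 pnatr_eq0.
Qed.

Lemma avgD n (k l : R -> \bar R) t :
  (forall r, 0 <= k r) -> (forall r, 0 <= l r) ->
  measurable_fun [set: R] k -> measurable_fun [set: R] l ->
  avg n (fun r => k r + l r) t = avg n k t + avg n l t.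
Proof.
move=> k0 l0 mk ml; rewrite /avg ge0_integralD//.
- by rewrite ge0_muleDr ?integral_ge0.
- exact: measurable_window.
- exact: measurable_funTS.
- exact: measurable_funTS.
Qed.

(** The integrand may depend on the centre [t] as well, as it does in [osc]; measurability in [t] is
    that of the inner integral in Tonelli's theorem. *)
Lemma measurable_avg2 n (k : R -> R -> \bar R) :
  measurable_fun [set: R * R] (fun z => k z.1 z.2) ->
  (forall t r, 0 <= k t r) -> measurable_fun [set: R] (fun t => avg n (k t) t).
Proof.
move=> mk k0; apply: measurable_funeM; pose h : R := (n.+1%:R^-1)%R.
pose f (z : measurableTypeR R * measurableTypeR R) : \bar R :=
  k z.1 z.2 * (\1_(`[0%R, h]%classic : set R) (z.1 - z.2)%R)%:E.
have mf : measurable_fun setT f.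
  apply: emeasurable_funM; first exact: mk.
  apply/measurable_EFinP.
  apply: (@measurableT_comp _ _ _ _ _ _ (\1_(`[0%R, h]%classic : set R) : R -> R)).
    exact: measurable_indic.
  exact: (measurable_funB measurable_fst measurable_snd).
have f0 z : 0 <= f z by rewrite mule_ge0// lee_fin.
have winE (t r : R) : ((t - r)%R \in (`[0%R, h]%classic : set R)) = (r \in window n t).
  apply/idP/idP; rewrite /window !inE/= !in_itv/= -/h => /andP[? ?]; apply/andP; split; lra.
have := @measurable_fun_fubini_tonelli_F _ _ _ _ R mu f mf f0.
apply: eq_measurable_fun => t _; rewrite /fubini_F [RHS]integral_mkcond.
apply: eq_integral => r _; rewrite /f patchE indicE.
rewrite winE.
by case: ifPn; rewrite ?mule1 ?mule0.
Qed.

(** The factor in [avg] cancels the window length produced by [integral_window]. An error that is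
    small in L1 thus stays small after averaging, uniformly in [n]. *)
Lemma integral_avg n (k : R -> \bar R) : measurable_fun [set: R] k ->
  (forall t, 0 <= k t) -> \int[mu]_t avg n k t = \int[mu]_t k t.
Proof.
move=> mk k0; have := @integral_window _ (n.+1%:R^-1)%R k.
rewrite invr_ge0 ler0n => /(_ isT mk k0) H.
have m1 : measurable_fun [set: R] (avg n k).
  apply: (@measurable_avg2 n (fun _ r => k r)) => //.
  exact: (measurableT_comp mk measurable_snd).
have -> : \int[mu]_t k t = n.+1%:R%:E * ((n.+1%:R^-1)%:E * \int[mu]_t k t).
  by rewrite muleA -EFinM divff ?pnatr_eq0// mul1e.
rewrite -H -ge0_integralZl_EFin//.
- by move=> t _; exact: integral_ge0.
have := @measurable_funeM _ _ _ _ _ (n.+1%:R^-1)%:E m1.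
apply: eq_measurable_fun => t _.
by rewrite /avg muleA -EFinM mulVf ?pnatr_eq0// mul1e.
Qed.

Definition osc n (g : R -> R) (t : R) : \bar R :=
  avg n (fun r => `|g r - g t|%:E) t.

Lemma osc_ge0 n g t : 0 <= osc n g t.
Proof. by apply: avg_ge0 => r; rewrite lee_fin. Qed.

Lemma measurable_osc n g : measurable_fun [set: R] g ->
  measurable_fun [set: R] (osc n g).
Proof.
move=> mg; apply: (@measurable_avg2 n (fun t r => `|g r - g t|%:E)).
  apply/measurable_EFinP; apply: measurableT_comp => //.
  apply: measurable_funB.
    exact: (measurableT_comp mg measurable_snd).
  exact: (measurableT_comp mg measurable_fst).
by move=> *; rewrite lee_fin.
Qed.

(** The triangle inequality through [f r] and [f t]. It reduces the oscillation of [g] to that of an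
    approximation [f]. *)
Lemma le_osc n (f g : R -> R) t :
  measurable_fun [set: R] f -> measurable_fun [set: R] g ->
  osc n g t <= avg n (fun r => `|g r - f r|%:E) t + (osc n f t + `|g t - f t|%:E).
Proof.
move=> mf mg; have m1 : measurable_fun [set: R] (fun r => `|g r - f r|%:E).
  by apply/measurable_EFinP; apply: measurableT_comp => //; exact: measurable_funB.
have m2 : measurable_fun [set: R] (fun r => `|f r - f t|%:E).
  by apply/measurable_EFinP; apply: measurableT_comp => //; exact: measurable_funB.
have m3 : measurable_fun [set: R] (fun r => `|f r - f t|%:E + `|g t - f t|%:E).
  by apply: emeasurable_funD => //; exact: measurable_cst.
rewrite -[X in _ + (_ + X)](@avg_cst n _ t)//.
rewrite -(@avgD n (fun r => `|f r - f t|%:E) (fun=> `|g t - f t|%:E))//.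
have n0 r : 0 <= `|f r - f t|%:E + `|g t - f t|%:E by rewrite adde_ge0// lee_fin.
rewrite -avgD//.
apply: le_avg => r; first by rewrite lee_fin.
move=> _; rewrite -!EFinD lee_fin.
have -> : (g r - g t = (g r - f r) + ((f r - f t) + (f t - g t)))%R by ring.
rewrite (le_trans (ler_normD _ _))// lerD2l.
by rewrite (le_trans (ler_normD _ _))// lerD2l distrC.
Qed.

Context (T : R) (T0 : (0 < T)%R).
Let E : set R := `]0%R, T[%classic.

(** For [t] in the open interval the window eventually stays in a neighbourhood inside [E], where
    continuity applies; cutting to [E] can only create jumps at the end points, which are not in
    [E]. Twice a bound of the function dominates. *)
Lemma osc_continuous_cvg (G0 : R -> R) : continuous G0 ->
  \int[mu]_(t in E) osc n (G0 \_ E) t @[n --> \oo] --> 0.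
Proof.
move=> cG.
have mE : measurable E by exact: measurable_itv.
set G := G0 \_ E.
have mG : measurable_fun [set: R] G.
  apply: (iffLR (measurable_restrictT _ mE)); apply: measurable_funTS.
  exact: continuous_measurable_fun.
have [M M0 GM] : exists2 M : R, (0 <= M)%R & forall t, (`|G t| <= M)%R.
  have [c _ cM] := @EVT_max R (fun t => `|G0 t|%R) 0%R T (ltW T0) (fun x => @continuous_subspaceT _ _ _ _ (fun y => cvg_norm (cG y)) x).
  exists `|G0 c|%R => // t; rewrite /G patchE; case: ifPn => [|_]; last by rewrite normr0.
  rewrite inE /E/= in_itv/= => /andP[t0 t1].
  by apply: (cM t); rewrite in_itv/= !ltW.
have oscM n t : osc n G t <= (M + M)%:E.
  rewrite -(@avg_cst n _ t) ?addr_ge0//; apply: le_avg => // r _.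
  by rewrite lee_fin (le_trans (ler_normB _ _))// lerD.
have ptw t : E t -> osc n G t @[n --> \oo] --> 0.
  move=> Et; apply: near_cvge0 => [n|e e0]; first exact: osc_ge0.
  have oE : \forall r \near t, E r by apply: open_nbhs_nbhs; split => //; exact: itv_open.
  have cGt : \forall r \near t, (`|G0 t - G0 r| <= e)%R.
    by have /cvgrPdist_le/(_ _ e0) := cG t.
  have Hn : nbhs t (fun r => E r /\ (`|G0 t - G0 r| <= e)%R) by exact: filterI.
  move/nbhs_ballP : Hn => [del /= del0 Hdel].
  have [N _ HN] := near_infty_natSinv_lt (PosNum del0).
  exists N => //= n Nn; rewrite -(avg_cst n t (ltW e0)).
  apply: le_avg => [r|r /=]; first by rewrite lee_fin.
  rewrite /window/= in_itv/= => /andP[r1 r2].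
  have [|Er Ger] := Hdel r.
    rewrite /ball/= ger0_norm ?subr_ge0//.
    by apply: le_lt_trans (HN n Nn); rewrite lerBlDr addrC -lerBlDr.
  by rewrite lee_fin /G !patchE !mem_set// distrC.
have ptw_ae : {ae mu, forall t, E t -> (fun n => osc n G t) @ \oo --> (cst 0 : R -> \bar R) t}.
  by apply: aeW => t; exact: ptw.
have iM : mu.-integrable E (cst (M + M)%:E : R -> \bar R).
  apply/integrableP; split; first exact: measurable_cst.
  rewrite [ltLHS](_ : _ = `|(M + M)%:E| * mu E); last exact: integral_cst.
  by rewrite /E lebesgue_measure_itv/= lte_fin T0 -EFinB -EFinM ltry.
have dom_ae : {ae mu, forall t n, E t -> `|osc n G t| <= (cst (M + M)%:E : R -> \bar R) t}.
  by apply: aeW => t n _; rewrite gee0_abs ?osc_ge0//; exact: oscM.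
have [_ _] := @dominated_convergence _ _ R mu E mE (fun n => osc n G) (cst 0) (cst (M + M)%:E)
  (fun n => measurable_funTS (measurable_osc n mG)) (measurable_cst _) ptw_ae iM dom_ae.
by rewrite integral0.
Qed.

(** Continuous functions are dense in L1 of the interval, and the three terms of [le_osc] are each
    made at most [e / 3]. *)
Lemma osc_cvg (g : R -> R) : measurable_fun [set: R] g ->
  mu.-integrable E (EFin \o g) -> (forall t, ~ E t -> g t = 0%R) ->
  \int[mu]_(t in E) osc n g t @[n --> \oo] --> 0.
Proof.
move=> mg ig g0.
have mE : measurable E by exact: measurable_itv.
have Efin : mu E < +oo by rewrite /E lebesgue_measure_itv/= lte_fin T0 ltry.
have [g_ [cg_ ig_ g_g]] := approximation_continuous_integrable mE Efin ig.
apply: near_cvge0 => [n|e e0].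
  by apply: integral_ge0 => t _; exact: osc_ge0.
have e3 : (0 < e / 3)%R by rewrite divr_gt0.
have i0 n : 0 <= \int[mu]_(t in E) `|(g t - g_ n t)%:E| by exact: integral_ge0.
have := cvge0_near i0 e3 g_g.
move=> [k _ /(_ k (leqnn k))] /= gk.
(* As [g] vanishes outside [E], cutting the approximation there keeps the error zero on the parts of
   the windows that leave [E]. *)
pose G := g_ k \_ E.
have mG : measurable_fun [set: R] G.
  apply: (iffLR (measurable_restrictT _ mE)); apply: measurable_funTS.
  exact: continuous_measurable_fun (cg_ k).
have mgG : measurable_fun [set: R] (fun t => `|g t - G t|%:E).
  by apply/measurable_EFinP; apply: measurableT_comp => //; exact: measurable_funB.
have intgG : \int[mu]_(t in E) `|g t - G t|%:E = \int[mu]_(t in E) `|g t - g_ k t|%:E.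
  by apply: eq_integral => t Et; rewrite /G patchE Et.
have intgGT : \int[mu]_t `|g t - G t|%:E = \int[mu]_(t in E) `|g t - G t|%:E.
  rewrite [RHS]integral_mkcond; apply: eq_integral => t _; rewrite [in RHS]patchE.
  case: ifPn => // tE; rewrite /G patchE (negbTE tE) g0 ?subrr ?normr0//.
  by move=> Et; rewrite mem_set in tE.
have o0 n : 0 <= \int[mu]_(t in E) osc n G t.
  by apply: integral_ge0 => t _; exact: osc_ge0.
have := cvge0_near o0 e3 (osc_continuous_cvg (cg_ k)).
apply: filterS => n oscG.
have mavg : measurable_fun [set: R] (avg n (fun r => `|g r - G r|%:E)).
  apply: (@measurable_avg2 n (fun _ r => `|g r - G r|%:E)) => //.
  exact: (measurableT_comp mgG measurable_snd).
apply: (@le_trans _ _ (\int[mu]_(t in E) (avg n (fun r => `|g r - G r|%:E) t +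
   (osc n G t + `|g t - G t|%:E)))).
  apply: ge0_le_integral_all => t _; first exact: osc_ge0.
  exact: le_osc.
rewrite ge0_integralD//; last 4 first.
- by move=> t _; apply: avg_ge0.
- exact: measurable_funTS.
- by move=> t _; apply: adde_ge0 => //; exact: osc_ge0.
- by apply: emeasurable_funD; apply: measurable_funTS => //; exact: measurable_osc.
rewrite ge0_integralD//; last 3 first.
- by move=> t _; exact: osc_ge0.
- by apply: measurable_funTS; exact: measurable_osc.
- exact: measurable_funTS.
have -> : e = (e / 3 + (e / 3 + e / 3))%R by field.
rewrite !EFinD; apply: leeD; last apply: leeD.
- apply: (@le_trans _ _ (\int[mu]_t (avg n (fun r => `|g r - G r|%:E) t))).
    by apply: ge0_le_integral_set => // t _; apply: avg_ge0.
  by rewrite integral_avg// intgGT intgG.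
- exact: oscG.
- by rewrite intgG.
Qed.

End oscillation.

(** * Strong measurability for a semi-inner product *)

(** Bilinearity is required on a subspace [X] only, because integrals are additive only for
    integrable functions. The form may be degenerate, because functions that agree almost everywhere
    are not identified. *)
Record semi_ip (R : realType) (V : lmodType R) (X : set V) (B : V -> V -> R) : Prop :=
  SemiIp {
  sip_dom0 : X 0;
  sip_domD : forall u v, X u -> X v -> X (u + v);
  sip_domZ : forall (a : R) u, X u -> X (a *: u);
  sipC : forall u v, B u v = B v u;
  sipD : forall u v w, X u -> X v -> X w -> B (u + v) w = B u w + B v w;
  sipZ : forall a u w, X u -> X w -> B (a *: u) w = a * B u w;
  sip_ge0 : forall u, 0 <= B u u }.

Definition snorm (R : realType) (V : lmodType R) (B : V -> V -> R) (u : V) : R :=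
  Num.sqrt (B u u).

Section semi_ip_theory.
Context (R : realType) (V : lmodType R) (X : set V) (B : V -> V -> R).
Hypothesis hB : semi_ip X B.
Local Notation N := (snorm B).

Lemma sip_domN u : X u -> X (- u).
Proof. by move=> Xu; rewrite -scaleN1r; exact: (sip_domZ hB). Qed.

Lemma sip_domB u v : X u -> X v -> X (u - v).
Proof. by move=> Xu Xv; apply: (sip_domD hB) => //; exact: sip_domN. Qed.

Lemma sip_dom_sum (I : Type) (r : seq I) (P : pred I) (F : I -> V) :
  (forall i, P i -> X (F i)) -> X (\sum_(i <- r | P i) F i).
Proof. by move=> XF; apply: big_ind => //; [exact: (sip_dom0 hB)|exact: (sip_domD hB)]. Qed.

Lemma sipDr u v w : X u -> X v -> X w -> B w (u + v) = B w u + B w v.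
Proof. by move=> Xu Xv Xw; rewrite (sipC hB) (sipD hB)// !(sipC hB w). Qed.

Lemma sipZr a u w : X u -> X w -> B w (a *: u) = a * B w u.
Proof. by move=> Xu Xw; rewrite (sipC hB) (sipZ hB)// (sipC hB w). Qed.

Lemma sipN u w : X u -> X w -> B (- u) w = - B u w.
Proof. by move=> Xu Xw; rewrite -scaleN1r (sipZ hB)// mulN1r. Qed.

Lemma sipNr u w : X u -> X w -> B w (- u) = - B w u.
Proof. by move=> Xu Xw; rewrite (sipC hB) sipN// (sipC hB w). Qed.

Lemma sipB u v w : X u -> X v -> X w -> B (u - v) w = B u w - B v w.
Proof. by move=> Xu Xv Xw; rewrite (sipD hB)// ?sipN//; exact: sip_domN. Qed.

Lemma sipBr u v w : X u -> X v -> X w -> B w (u - v) = B w u - B w v.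
Proof. by move=> Xu Xv Xw; rewrite sipDr// ?sipNr//; exact: sip_domN. Qed.

Lemma sip0 w : X w -> B 0 w = 0.
Proof. by move=> Xw; rewrite -(scale0r (0 : V)) (sipZ hB)// ?mul0r//; exact: (sip_dom0 hB). Qed.

Lemma sip_suml (I : Type) (r : seq I) (P : pred I) (F : I -> V) w :
  (forall i, P i -> X (F i)) -> X w ->
  B (\sum_(i <- r | P i) F i) w = \sum_(i <- r | P i) B (F i) w.
Proof.
move=> XF Xw; elim: r => [|i r IH]; first by rewrite !big_nil sip0.
rewrite !big_cons; case: ifPn => // Pi; rewrite (sipD hB)// ?IH//.
  exact: XF.
exact: sip_dom_sum.
Qed.

Lemma snorm_ge0 u : 0 <= N u. Proof. exact: sqrtr_ge0. Qed.

Lemma snorm_sqr u : N u ^+ 2 = B u u.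
Proof. by rewrite sqr_sqrtr// (sip_ge0 hB). Qed.

Lemma sip_quad a b u v : X u -> X v ->
  B (a *: u + b *: v) (a *: u + b *: v) =
  a ^+ 2 * B u u + 2 * a * b * B u v + b ^+ 2 * B v v.
Proof.
move=> Xu Xv; have Xau := sip_domZ hB a Xu; have Xbv := sip_domZ hB b Xv.
rewrite (sipD hB)//; last exact: (sip_domD hB).
rewrite !sipDr// !(sipZ hB)// !sipZr// (sipC hB v u); ring.
Qed.

Lemma sip_young (e : R) u v : 0 < e -> X u -> X v ->
  B u v <= (e * B u u + e^-1 * B v v) / 2.
Proof.
move=> e0 Xu Xv; have := sip_ge0 hB (Num.sqrt e *: u + (- (Num.sqrt e)^-1) *: v).
rewrite sip_quad// sqrrN exprVn (sqr_sqrtr (ltW e0)).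
have se0 : Num.sqrt e != 0 by rewrite gt_eqF// sqrtr_gt0.
have -> : 2 * Num.sqrt e * - (Num.sqrt e)^-1 * B u v = - 2 * B u v by field.
lra.
Qed.

Lemma sip_cauchy_schwarz u v : X u -> X v -> B u v <= N u * N v.
Proof.
move=> Xu Xv.
have [Bv0|Bv0] := leP (B v v) 0.
  have {}Bv0 : B v v = 0 by apply/eqP; rewrite eq_le Bv0 (sip_ge0 hB).
  have -> : N v = 0 by rewrite /snorm Bv0 sqrtr0.
  rewrite mulr0 leNgt; apply/negP => Buv0.
  have Buu0 : 0 < B u u + 1 by rewrite ltr_wpDl// (sip_ge0 hB).
  (* With this weight and [B v v = 0], Young's inequality reads [B u v <= B u v / 2], which
     contradicts positivity; the 1 protects against [B u u = 0]. *)
  have e0 : 0 < B u v / (B u u + 1) by rewrite divr_gt0.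
  have := sip_young e0 Xu Xv; rewrite Bv0 mulr0 addr0 => H.
  have : B u v / (B u u + 1) * B u u <= B u v.
    by rewrite mulrAC ler_pdivrMr// ler_pM2l// lerDl.
  by lra.
have [Bu0|Bu0] := leP (B u u) 0.
  have {}Bu0 : B u u = 0 by apply/eqP; rewrite eq_le Bu0 (sip_ge0 hB).
  have -> : N u = 0 by rewrite /snorm Bu0 sqrtr0.
  rewrite mul0r leNgt; apply/negP => Buv0.
  (* The same contradiction: now the term with [B v v] is exactly [B u v / 2]. *)
  have e0 : 0 < B v v / B u v by rewrite divr_gt0.
  have := sip_young e0 Xu Xv; rewrite Bu0 mulr0 add0r invf_div mulfVK ?gt_eqF//.
  lra.
have Nu0 : 0 < N u by rewrite sqrtr_gt0.
have Nv0 : 0 < N v by rewrite sqrtr_gt0.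
(* The weight that equalizes the two terms of Young's inequality. *)
have e0 : 0 < N v / N u by rewrite divr_gt0.
have := sip_young e0 Xu Xv; rewrite -!snorm_sqr invf_div.
have -> : (N v / N u * N u ^+ 2 + N u / N v * N v ^+ 2) / 2 = N u * N v.
  by field; rewrite !gt_eqF.
by [].
Qed.

Lemma snormN u : X u -> N (- u) = N u.
Proof. by move=> Xu; rewrite /snorm sipN// ?sipNr// ?opprK//; exact: sip_domN. Qed.

Lemma snormZ a u : X u -> N (a *: u) = `|a| * N u.
Proof.
move=> Xu; rewrite /snorm (sipZ hB)//; last exact: (sip_domZ hB).
by rewrite sipZr// mulrA -expr2 sqrtrM ?sqr_ge0// sqrtr_sqr.
Qed.

Lemma sip_cauchy_schwarz_norm u v : X u -> X v -> `|B u v| <= N u * N v.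
Proof.
move=> Xu Xv; rewrite ler_norml; apply/andP; split; last exact: sip_cauchy_schwarz.
by rewrite lerNl -sipN// -(snormN Xu); apply: sip_cauchy_schwarz => //; exact: sip_domN.
Qed.

Lemma snormD u v : X u -> X v -> N (u + v) <= N u + N v.
Proof.
move=> Xu Xv; rewrite -(@ler_pXn2r _ 2)// ?nnegrE ?addr_ge0 ?snorm_ge0//.
rewrite snorm_sqr sqrrD !snorm_sqr.
have := sip_quad 1 1 Xu Xv; rewrite !scale1r => ->.
have := sip_cauchy_schwarz Xu Xv; lra.
Qed.

Lemma snormB u v : X u -> X v -> N (u - v) <= N u + N v.
Proof. by move=> Xu Xv; rewrite -(snormN Xv); apply: snormD => //; exact: sip_domN. Qed.

Lemma snorm_distC u v : X u -> X v -> N (u - v) = N (v - u).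
Proof. by move=> Xu Xv; rewrite -snormN ?opprB//; exact: sip_domB. Qed.

Lemma sip_sqrD u v : X u -> X v ->
  B (u + v) (u + v) <= 2 * B u u + 2 * B v v.
Proof.
move=> Xu Xv; have := sip_quad 1 1 Xu Xv; rewrite !scale1r => ->.
have := sip_young ltr01 Xu Xv; rewrite invr1; lra.
Qed.

End semi_ip_theory.

Section step_theory.
Context (R : realType) (V : lmodType R) (X : set V) (B : V -> V -> R).
Hypothesis hB : semi_ip X B.
Local Notation N := (snorm B).
Local Notation mu := (@lebesgue_measure R).

(** Strong measurability at every point of [D] instead of almost every one; the exceptional null set
    is removed from the domain once and for all by [smeas_of_ae]. *)
Definition smeas (D : set R) (u : R -> V) : Prop :=
  (forall t, D t -> X (u t)) /\
  exists2 c : nat -> step_data V, (forall n, step_in X (c n)) &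
    forall t, D t -> N (u t - step_fun (c n) t) @[n --> \oo] --> 0.

Definition step_add (c c' : step_data V) : step_data V :=
  @StepData R V (step_size c + step_size c')
    (fun k => match fintype.split k with
              | inl i => step_dom i | inr j => step_dom j end)
    (fun k => match fintype.split k with
              | inl i => step_val i | inr j => step_val j end).

Definition step_scale (a : R) (c : step_data V) : step_data V :=
  @StepData R V (step_size c) (@step_dom R V c) (fun k => a *: step_val k).

Definition step_restr (A : set R) (c : step_data V) : step_data V :=
  @StepData R V (step_size c) (fun k => step_dom k `&` A) (@step_val R V c).

Lemma step_in_fun c t : step_in X c -> X (step_fun c t).
Proof.
move=> hc; apply: (sip_dom_sum hB) => k _; apply: (sip_domZ hB).
by have [] := hc k.
Qed.

Lemma step_fun_add c c' t : step_fun (step_add c c') t = step_fun c t + step_fun c' t.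
Proof.
rewrite /step_fun /step_add/= big_split_ord /=; congr (_ + _); apply: eq_bigr => k _.
  by rewrite (unsplitK (inl k : _ + _)).
by rewrite (unsplitK (inr k : _ + _)).
Qed.

Lemma step_in_add c c' : step_in X c -> step_in X c' -> step_in X (step_add c c').
Proof. by move=> hc hc' k /=; case: (fintype.split k) => i; [exact: hc|exact: hc']. Qed.

Lemma step_fun_scale a c t : step_fun (step_scale a c) t = a *: step_fun c t.
Proof. by rewrite /step_fun scaler_sumr; apply: eq_bigr => k _; rewrite !scalerA mulrC. Qed.

Lemma step_in_scale a c : step_in X c -> step_in X (step_scale a c).
Proof. by move=> hc k; have [mk Xk] := hc k; split => //; exact: (sip_domZ hB). Qed.

Lemma step_fun_restr A c t : step_fun (step_restr A c) t = \1_A t *: step_fun c t.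
Proof.
rewrite /step_fun scaler_sumr; apply: eq_bigr => k _.
by rewrite scalerA /= indicI/= mulrC.
Qed.

Lemma step_in_restr A c : measurable A -> step_in X c -> step_in X (step_restr A c).
Proof. by move=> mA hc k; have [mk Xk] := hc k; split => //=; exact: measurableI. Qed.

Lemma measurable_sip_step c w : step_in X c -> X w ->
  measurable_fun [set: R] (fun t => B (step_fun c t) w).
Proof.
move=> hc Xw; rewrite (_ : (fun _ => _) =
    fun t => \sum_(k < step_size c) \1_(step_dom k) t * B (step_val k) w).
  apply: measurable_sum => k; apply: measurable_funM => //.
  by apply: measurable_indic; have [] := hc k.
apply/funext => t; rewrite (sip_suml hB)//.
  by apply: eq_bigr => k _; rewrite (sipZ hB)//; have [] := hc k.
by move=> k _; apply: (sip_domZ hB); have [] := hc k.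
Qed.

Lemma measurable_sip_step2 c c' : step_in X c -> step_in X c' ->
  measurable_fun [set: R] (fun t => B (step_fun c t) (step_fun c' t)).
Proof.
move=> hc hc'; rewrite (_ : (fun _ => _) =
    fun t => \sum_(k < step_size c) \1_(step_dom k) t * B (step_fun c' t) (step_val k)).
  apply: measurable_sum => k; have [mk Xk] := hc k; apply: measurable_funM.
    exact: measurable_indic.
  exact: measurable_sip_step.
apply/funext => t; rewrite (sip_suml hB)//.
- apply: eq_bigr => k _; have [mk Xk] := hc k.
  by rewrite (sipZ hB)// ?(sipC hB _ (step_val k))//; exact: step_in_fun.
- by move=> k _; apply: (sip_domZ hB); have [] := hc k.
- exact: step_in_fun.
Qed.

Lemma sip_cvg (u v : V) (a b : nat -> V) : X u -> X v ->
  (forall n, X (a n)) -> (forall n, X (b n)) ->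
  N (u - a n) @[n --> \oo] --> 0 -> N (v - b n) @[n --> \oo] --> 0 ->
  B (a n) (b n) @[n --> \oo] --> B u v.
Proof.
move=> Xu Xv Xa Xb ua vb.
have uv n : `|B u v - B (a n) (b n)| <=
    N (u - a n) * N v + (N u * N (v - b n) + N (u - a n) * N (v - b n)).
  have Xua := sip_domB hB Xu (Xa n); have Xvb := sip_domB hB Xv (Xb n).
  have -> : B u v - B (a n) (b n) =
      B (u - a n) v + (B u (v - b n) - B (u - a n) (v - b n)).
    by rewrite !(sipB hB)// !(sipBr hB)//; ring.
  rewrite (le_trans (ler_normD _ _))// lerD ?(sip_cauchy_schwarz_norm hB)//.
  by rewrite (le_trans (ler_normB _ _))// lerD ?(sip_cauchy_schwarz_norm hB)//.
apply: squeeze_dist; first by apply: nearW; exact: uv.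
rewrite (_ : 0 = 0 * N v + (N u * 0 + 0 * 0) :> R); last by rewrite !(mul0r, mulr0, addr0).
apply: cvgD; first by apply: cvgMr_tmp; exact: ua.
apply: cvgD; first by apply: cvgMl_tmp; exact: vb.
by apply: cvgM; [exact: ua|exact: vb].
Qed.

Lemma measurable_sip D u v : measurable D -> smeas D u -> smeas D v ->
  measurable_fun D (fun t => B (u t) (v t)).
Proof.
move=> mD [Xu [c hc uc]] [Xv [c' hc' vc]].
apply: (@measurable_fun_cvg _ _ _ D (fun n t => B (step_fun (c n) t) (step_fun (c' n) t))).
  by move=> n; apply: measurable_funTS; exact: measurable_sip_step2.
move=> t Dt; apply: sip_cvg; [exact: Xu|exact: Xv| | |exact: uc|exact: vc].
- by move=> n; exact: step_in_fun.
- by move=> n; exact: step_in_fun.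
Qed.

Lemma smeasS D D' u : D `<=` D' -> smeas D' u -> smeas D u.
Proof.
move=> DD' [Xu [c hc uc]]; split=> [t /DD'|]; first exact: Xu.
by exists c => // t /DD'; exact: uc.
Qed.

Lemma eq_smeas D u v : (forall t, D t -> u t = v t) -> smeas D u -> smeas D v.
Proof.
move=> uv [Xu [c hc uc]]; split=> [t Dt|]; first by rewrite -uv//; exact: Xu.
by exists c => // t Dt; rewrite -uv//; exact: uc.
Qed.

Lemma smeas_cst D w : X w -> smeas D (fun=> w).
Proof.
move=> Xw; split => //; pose c := @StepData R V 1 (fun=> setT) (fun=> w).
exists (fun=> c); first by move=> n k; split => //=.
move=> t Dt; rewrite (_ : step_fun c t = w).
  rewrite subrr /snorm (sip0 hB) ?sqrtr0; last exact: (sip_dom0 hB).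
  exact: cvg_cst.
by rewrite /step_fun big_ord1 /= indicT scale1r.
Qed.

Lemma smeasD D u v : smeas D u -> smeas D v -> smeas D (fun t => u t + v t).
Proof.
move=> [Xu [c hc uc]] [Xv [c' hc' vc]]; split=> [t Dt|].
  by apply: (sip_domD hB); [exact: Xu|exact: Xv].
exists (fun n => step_add (c n) (c' n)) => [n|t Dt]; first exact: step_in_add.
apply: (@squeeze_dist _ _ _ _ _ (fun n => N (u t - step_fun (c n) t) +
    N (v t - step_fun (c' n) t))).
  apply: nearW => n; rewrite sub0r normrN ger0_norm ?snorm_ge0// step_fun_add.
  rewrite opprD addrACA; apply: (snormD hB); apply: (sip_domB hB).
  - exact: Xu.
  - exact: step_in_fun.
  - exact: Xv.
  - exact: step_in_fun.
by rewrite -[X in _ --> X](addr0 0); apply: cvgD; [exact: uc|exact: vc].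
Qed.

Lemma smeasZ D a u : smeas D u -> smeas D (fun t => a *: u t).
Proof.
move=> [Xu [c hc uc]]; split=> [t Dt|]; first by apply: (sip_domZ hB); exact: Xu.
exists (fun n => step_scale a (c n)) => [n|t Dt]; first exact: step_in_scale.
apply: (@squeeze_dist _ _ _ _ _ (fun n => `|a| * N (u t - step_fun (c n) t))).
  apply: nearW => n; rewrite sub0r normrN ger0_norm ?snorm_ge0// step_fun_scale.
  rewrite -scalerBr (snormZ hB)//; apply: (sip_domB hB); first exact: Xu.
  exact: step_in_fun.
by rewrite -[X in _ --> X](mulr0 `|a|); apply: cvgMl_tmp; exact: uc.
Qed.

Lemma smeasB D u v : smeas D u -> smeas D v -> smeas D (fun t => u t - v t).
Proof.
move=> Du Dv; apply: (@eq_smeas _ (fun t => u t + (-1) *: v t)).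
  by move=> t _; rewrite scaleN1r.
by apply: smeasD => //; exact: smeasZ.
Qed.

Lemma smeas_of_ae D u : strongly_measurable X N D u ->
  exists Z, [/\ measurable Z, mu Z = 0%E & smeas (D `\` Z) u].
Proof.
move=> [[Z1 [mZ1 Z10 hZ1]] [c hc [Z2 [mZ2 Z20 hZ2]]]].
exists (Z1 `|` Z2); split.
- exact: measurableU.
- by apply: (etrans _ Z10); exact: measureU0.
split=> [t [Dt /not_orP[Z1t _]]|].
  by apply: contrapT => Xt; apply: Z1t; apply: hZ1 => /= H; apply: Xt; exact: H.
exists c => // t [Dt /not_orP[_ Z2t]].
by apply: contrapT => Xt; apply: Z2t; apply: hZ2 => /= H; apply: Xt; exact: H.
Qed.

(* A Hoelder continuous function is the uniform limit of the step functions
   sampling it on a uniform grid. *)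
Lemma smeas_holder (T C : R) (v : R -> V) : 0 < T -> (forall t, X (v t)) ->
  (forall s t, B (v t - v s) (v t - v s) <= C * `|t - s|) ->
  smeas `]0, T[ v.
Proof.
move=> T0 Xv vC; split => //.
pose tau n : R := T / n.+1%:R.
pose c n := @StepData R V n.+1
  (fun k => `[k%:R * tau n, k.+1%:R * tau n[%classic : set R) (fun k => v (k%:R * tau n)).
have tau0 n : 0 < tau n by rewrite divr_gt0.
exists c => [n k|t]; first by split => //=; exact: measurable_itv.
rewrite /= in_itv/= => /andP[t0 tT].
have C0 : 0 <= C.
  have := vC 0 1; rewrite subr0 normr1 mulr1; apply: le_trans; exact: (sip_ge0 hB).
have cE n : exists2 s, step_fun (c n) t = v s & `|t - s| <= tau n.
  (* The grid cell that contains [t]; since [t < T], its index is below the number of cells. *)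
  have [j jE] : exists j : nat, (j%:R * tau n <= t < j.+1%:R * tau n).
    have td : 0 <= t / tau n by rewrite divr_ge0// ltW.
    have /andP[a b] := truncn_itv td.
    exists (Num.truncn (t / tau n)); rewrite -ler_pdivlMr// a/=.
    by rewrite -ltr_pdivrMr.
  move/andP : jE => [j1 j2].
  have jn : (j < n.+1)%N.
    rewrite -(ltr_nat R) -(ltr_pM2r (tau0 n)); apply: (le_lt_trans j1).
    by rewrite /tau mulrCA mulfV ?pnatr_eq0// mulr1.
  exists (j%:R * tau n); last first.
    rewrite ger0_norm ?subr_ge0// lerBlDr; apply: ltW; apply: (lt_le_trans j2).
    by rewrite -natr1 mulrDl mul1r addrC.
  rewrite /step_fun (bigD1 (Ordinal jn))//= indicE mem_set/= ?in_itv/= ?j1//.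
  rewrite scale1r big1 ?addr0// => k kj; rewrite indicE memNset ?scale0r//=.
  rewrite in_itv/= => /andP[k1 k2]; case/eqP: kj; apply: ord_inj => /=.
  have kj : (k <= j)%N.
    by rewrite -ltnS -(ltr_nat R) -(ltr_pM2r (tau0 n)) (le_lt_trans k1 j2).
  have jk : (j <= k)%N.
    by rewrite -ltnS -(ltr_nat R) -(ltr_pM2r (tau0 n)) (le_lt_trans j1 k2).
  by apply/eqP; rewrite eqn_leq kj jk.
have sq0 : Num.sqrt (C * tau n) @[n --> \oo] --> 0.
  rewrite -[X in _ --> X](@sqrtr0 R).
  apply: (@cvg_comp _ _ _ (fun n => C * tau n) Num.sqrt _ (nbhs (0 : R))); last exact: sqrt_continuous.
  rewrite -(mulr0 C); apply: cvgMl_tmp.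
  rewrite -(mulr0 T); apply: cvgMl_tmp.
  exact: cvg_harmonic.
apply: squeeze_dist sq0; apply: nearW => n.
rewrite sub0r normrN ger0_norm ?snorm_ge0//.
have [s -> ts] := cE n; rewrite /snorm ler_sqrt; last by rewrite mulr_ge0// ltW.
by apply: (le_trans (vC s t)); rewrite ler_wpM2l.
Qed.

End step_theory.

(** * Square-integrable functions and the Bochner integral *)

Section square_integrable.
Context (R : realType) (V : lmodType R) (X : set V) (B : V -> V -> R).
Hypothesis hB : semi_ip X B.
Local Notation N := (snorm B).
Local Notation mu := (@lebesgue_measure R).

Definition sqint (D : set R) (u : R -> V) : Prop :=
  smeas X B D u /\ (\int[mu]_(t in D) (B (u t) (u t))%:E < +oo)%E.

Lemma sqint_integrable2 D u : measurable D -> sqint D u ->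
  mu.-integrable D (EFin \o (fun t => B (u t) (u t))).
Proof.
move=> mD [su iu]; apply/integrableP; split.
  by apply/measurable_EFinP; exact: (measurable_sip hB).
apply: le_lt_trans iu; apply: ge0_le_integral_all => t _ //=.
by rewrite ger0_norm// (sip_ge0 hB).
Qed.

Lemma sqint_integrable D u v : measurable D -> sqint D u -> sqint D v ->
  mu.-integrable D (EFin \o (fun t => B (u t) (v t))).
Proof.
move=> mD hu hv.
have [[Xu _] _] := hu; have [[Xv _] _] := hv.
apply: (le_integ mu mD (fun t => B (u t) (u t) + B (v t) (v t))).
- by apply: (measurable_sip hB) => //; [case: hu|case: hv].
- move=> t Dt; have Xut := Xu t Dt; have Xvt := Xv t Dt.
  have := sip_young hB ltr01 Xut Xvt.
  have := sip_young hB ltr01 (sip_domN hB Xut) Xvt.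
  rewrite !(sipN hB)//; last exact: (sip_domN hB).
  rewrite (sipNr hB)// invr1 opprK !mul1r.
  have := sip_ge0 hB (u t); have := sip_ge0 hB (v t).
  by rewrite ler_norml => *; apply/andP; split; lra.
- by apply: (integD mu mD); exact: sqint_integrable2.
Qed.

Lemma sqintD D u v : measurable D -> sqint D u -> sqint D v ->
  sqint D (fun t => u t + v t).
Proof.
move=> mD hu hv; split; first by apply: (smeasD hB); [case: hu|case: hv].
have [/= su iu] := hu; have [/= sv iv] := hv.
have H : mu.-integrable D (EFin \o (fun t => 2 * B (u t) (u t) + 2 * B (v t) (v t))).
  by apply: (integD mu mD); apply: (integZ mu mD); exact: sqint_integrable2.
apply: le_lt_trans (integ_lty mu mD H).
apply: ge0_le_integral_all => t Dt; rewrite lee_fin ?(sip_ge0 hB)//.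
by apply: (sip_sqrD hB); [case: su => + _; exact|case: sv => + _; exact].
Qed.

Lemma sqintZ D a u : measurable D -> sqint D u -> sqint D (fun t => a *: u t).
Proof.
move=> mD [su iu]; split; first exact: (smeasZ hB).
rewrite [ltLHS](_ : _ = (\int[mu]_(t in D) ((a ^+ 2)%:E * (B (u t) (u t))%:E))%E).
  rewrite ge0_integralZl_EFin// ?lte_mul_pinfty ?lee_fin ?sqr_ge0//.
  - by move=> t _; rewrite lee_fin (sip_ge0 hB).
  - by apply/measurable_EFinP; exact: (measurable_sip hB).
apply: eq_integral => t; rewrite inE => Dt; rewrite -EFinM; congr EFin.
have Xu : X (u t) by case: su => + _; exact.
have Xau := sip_domZ hB a Xu.
by rewrite (sipZ hB)// (sipZr hB)// mulrA expr2.
Qed.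

Lemma eq_sqint D u v : (forall t, D t -> u t = v t) -> sqint D u -> sqint D v.
Proof.
move=> uv [su iu]; split; first exact: eq_smeas su.
rewrite [ltLHS](_ : _ = (\int[mu]_(t in D) (B (u t) (u t))%:E)%E)//.
by apply: eq_integral => t; rewrite inE => Dt; rewrite uv.
Qed.

Lemma sqintB D u v : measurable D -> sqint D u -> sqint D v ->
  sqint D (fun t => u t - v t).
Proof.
move=> mD hu hv; apply: (@eq_sqint _ (fun t => u t + (-1) *: v t)).
  by move=> t _; rewrite scaleN1r.
by apply: sqintD => //; exact: sqintZ.
Qed.

Lemma sqintS D D' u : D `<=` D' -> sqint D' u -> sqint D u.
Proof.
move=> DD' [su iu]; split; first exact: smeasS su.
apply: le_lt_trans iu; apply: ge0_le_integral_set => // t _.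
by rewrite lee_fin (sip_ge0 hB).
Qed.

Lemma sqint_bounded D u (C : R) : measurable D -> (mu D < +oo)%E ->
  smeas X B D u -> (forall t, D t -> B (u t) (u t) <= C) -> sqint D u.
Proof.
move=> mD fD su uC; split => //.
apply: (@le_lt_trans _ _ (\int[mu]_(t in D) `|C|%:E)%E).
  apply: ge0_le_integral_all => t Dt; rewrite lee_fin ?(sip_ge0 hB)//.
  exact: (le_trans (uC t Dt) (ler_norm _)).
rewrite [ltLHS](_ : _ = (`|C|%:E * mu D)%E); last exact: integral_cst.
exact: lte_mul_pinfty.
Qed.

Lemma smeas_step D c : step_in X c -> smeas X B D (step_fun c).
Proof.
move=> hc; split=> [t _|]; first exact: (step_in_fun hB).
exists (fun=> c) => // t _; rewrite subrr /snorm (sip0 hB) ?sqrtr0; last exact: (sip_dom0 hB).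
exact: cvg_cst.
Qed.

Lemma measurable_snorm D u : measurable D -> smeas X B D u ->
  measurable_fun D (fun t => N (u t)).
Proof.
move=> mD su; apply: (measurableT_comp (f := (Num.sqrt : R -> R))).
  exact: (continuous_measurable_fun (@sqrt_continuous R)).
exact: (measurable_sip hB).
Qed.

Lemma Rintegral_sip_step (D : set R) c w : measurable D -> (mu D < +oo)%E ->
  step_in X c -> X w ->
  mu.-integrable D (EFin \o (fun t => B (step_fun c t) w)) /\
  \int[mu]_(t in D) B (step_fun c t) w = B (step_int D c) w.
Proof.
move=> mD fD hc Xw.
have fE : (fun t => B (step_fun c t) w) =
    (fun t => \sum_(k < step_size c) B (step_val k) w * \1_(step_dom k) t).
  apply/funext => t; rewrite (sip_suml hB)//.
    by apply: eq_bigr => k _; rewrite (sipZ hB) 1?mulrC//; have [] := hc k.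
  by move=> k _; apply: (sip_domZ hB); have [] := hc k.
have i1 k : mu.-integrable D (EFin \o (\1_(@step_dom _ _ c k) : R -> R)).
  have [mk _] := hc k; apply: (integ_bounded mu mD 1) => //.
  by move=> t _; rewrite indicE; case: (_ \in _); rewrite ?normr1 ?normr0.
have ik k := integZ mu mD (B (step_val k) w) (i1 k).
rewrite fE; split; first exact: (integ_sum mu mD).
rewrite (Rintegral_sum mu mD)//.
rewrite /step_int (sip_suml hB)//; last first.
  by move=> k _; apply: (sip_domZ hB); have [] := hc k.
apply: eq_bigr => k _; have [mk Xk] := hc k.
rewrite (sipZ hB)// RintegralZl// mulrC; congr (_ * _).
by rewrite /Rintegral integral_indic// setIC.
Qed.

(** Both sides are limits of [B (step_int D (c n)) w] along the step functions that define the
    Bochner integral; the error on the right is at most [N w] times their L1 distance to [v]. This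
    turns the vector-valued weak derivative into scalar identities. *)
Lemma bochner_sip (D : set R) v I w : measurable D -> (mu D < +oo)%E ->
  bochner_integral X N D v I -> X w ->
  B I w = \int[mu]_(t in D) B (v t) w.
Proof.
move=> mD fD [XI smv [c [hc ic Ic]]] Xw.
have [Z [mZ Z0 sv]] := smeas_of_ae smv.
set D' := D `\` Z in sv *.
have mD' : measurable D' by exact: measurableD.
have fD' : (mu D' < +oo)%E.
  by apply: le_lt_trans fD; apply: le_measure; rewrite ?inE//; exact: subIsetl.
have -> : \int[mu]_(t in D) B (v t) w = \int[mu]_(t in D') B (v t) w.
  by rewrite /Rintegral (integral_null_setD _ _ mZ Z0).
pose a n := (\int[mu]_(t in D') (N (v t - step_fun (c n) t))%:E)%E.
have a_cvg : a n @[n --> \oo] --> 0%E.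
  move: ic; apply: cvg_trans; rewrite (_ : a = fun n => \int[mu]_(t in D) (N (v t - step_fun (c n) t))%:E)%E//.
  by apply/funext => n; rewrite /a -(integral_null_setD _ _ mZ Z0).
have Xv t : D' t -> X (v t) by case: sv => + _; exact.
have Xd n t : D' t -> X (v t - step_fun (c n) t).
  by move=> Dt; apply: (sip_domB hB); [exact: Xv|exact: (step_in_fun hB)].
have mN n : measurable_fun D' (fun t => N (v t - step_fun (c n) t)).
  by apply: measurable_snorm => //; apply: (smeasB hB); [exact: sv|exact: smeas_step].
(* The distances to the step functions are known to be finite only from some index on. *)
have /fine_cvgP[[n0 _ afin] fa] := a_cvg.
have iN n : (n0 <= n)%N -> mu.-integrable D' (EFin \o (fun t => N (v t - step_fun (c n) t))).
  move=> nn; apply/integrableP; split; first by apply/measurable_EFinP; exact: mN.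
  rewrite (_ : (\int[mu]_(t in D') _)%E = a n).
    have := afin n nn; rewrite ge0_fin_numE//.
    by apply: integral_ge0 => t _; rewrite lee_fin snorm_ge0.
  by apply: eq_integral => t _ /=; rewrite ger0_norm ?snorm_ge0.
have idn n : (n0 <= n)%N ->
    mu.-integrable D' (EFin \o (fun t => B (v t - step_fun (c n) t) w)).
  move=> nn; apply: (le_integ mu mD' (fun t => N w * N (v t - step_fun (c n) t))).
  - apply: (measurable_sip hB) => //.
      by apply: (smeasB hB); [exact: sv|exact: smeas_step].
    exact: (smeas_cst hB).
  - by move=> t Dt; rewrite mulrC; apply: (sip_cauchy_schwarz_norm hB) => //; exact: Xd.
  - by apply: (integZ mu mD'); exact: iN.
(* Integrability is inherited from a single step function at finite distance. *)
have ivw : mu.-integrable D' (EFin \o (fun t => B (v t) w)).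
  have [is_ _] := Rintegral_sip_step mD' fD' (hc n0) Xw.
  apply: (eq_integ mu mD' _ _ (integD mu mD' (idn n0 (leqnn n0)) is_)) => t Dt.
  by rewrite (sipB hB)// ?subrK//; [exact: Xv|exact: (step_in_fun hB)].
have step_intE n : step_int D (c n) = step_int D' (c n).
  apply: eq_bigr => k _; congr (fine _ *: _).
  have [mk _] := hc n k.
  rewrite -(setDUK (A := Z `&` D `&` step_dom k) (B := D `&` step_dom k)); last by move=> t [[_ ?] ?].
  rewrite (_ : (D `&` step_dom k) `\` _ = D' `&` step_dom k); last first.
    apply/seteqP; split=> t /=; rewrite /D'/=; tauto.
  have mZDk : measurable (Z `&` D `&` step_dom k) by do 2 apply: measurableI => //.
  rewrite setUC; apply: measureU0 => //; first exact: measurableI.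
  apply: (subset_measure0 _ mZ) => //.
  by move=> t [[]].
have lim1 : B (step_int D (c n)) w @[n --> \oo] --> B I w.
  apply: (sip_cvg hB) => //.
  - by move=> n; apply: (sip_dom_sum hB) => k _; apply: (sip_domZ hB); have [] := hc n k.
  - by rewrite subrr /snorm (sip0 hB) ?sqrtr0 //; [exact: cvg_cst|exact: (sip_dom0 hB)].
have lim2 : B (step_int D (c n)) w @[n --> \oo] --> \int[mu]_(t in D') B (v t) w.
  apply: (@squeeze_dist _ _ _ _ _ (fun n => N w * fine (a n))).
    exists n0 => // n /= nn; rewrite step_intE.
    have [is_ <-] := Rintegral_sip_step mD' fD' (hc n) Xw.
    have -> : \int[mu]_(t in D') B (v t) w - \int[mu]_(t in D') B (step_fun (c n) t) w =
        \int[mu]_(t in D') B (v t - step_fun (c n) t) w.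
      rewrite -RintegralB//; apply: eq_Rintegral => t; rewrite inE => Dt.
      by rewrite (sipB hB)//; [exact: Xv|exact: (step_in_fun hB)].
    apply: (le_trans (@le_normr_Rintegral _ _ _ mu _ _ mD' (idn n nn))).
    rewrite -[fine (a n)]/(\int[mu]_(t in D') N (v t - step_fun (c n) t)).
    rewrite -RintegralZl//; last exact: iN.
    apply: le_Rintegral => //.
    + exact: (integrable_norm (idn n nn)).
    + by apply: (integZ mu mD'); exact: iN.
    + by move=> t Dt; rewrite mulrC; apply: (sip_cauchy_schwarz_norm hB) => //; exact: Xd.
  by rewrite -(mulr0 (N w)); apply: cvgMl_tmp; exact: fa.
exact: (cvg_unique _ lim1 lim2).
Qed.

End square_integrable.

(** * Weak time derivatives *)

Section smoothstep.
Context (R : realType).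
Implicit Types (a e x : R).
Local Notation mu := (@lebesgue_measure R).

(** The positive part, whose square is of class C^1: the brick of the C^1 cutoffs in time. *)
Definition ramp x : R := (x + `|x|) / 2.

Lemma ramp_pos x : 0 <= x -> ramp x = x.
Proof. by move=> x0; rewrite /ramp ger0_norm//; lra. Qed.

Lemma ramp_neg x : x <= 0 -> ramp x = 0.
Proof. by move=> x0; rewrite /ramp ler0_norm//; lra. Qed.

Lemma continuous_ramp : continuous ramp.
Proof.
move=> x; apply: cvgMr_tmp; apply: cvgD; first exact: cvg_id.
exact: norm_continuous.
Qed.

Lemma ramp_sqr_taylor x h :
  `|ramp (h + x) ^+ 2 - ramp x ^+ 2 - 2 * ramp x * h| <= h ^+ 2.
Proof.
rewrite ler_norml.
case: (leP 0 x) => x0; case: (leP 0 (h + x)) => hx0;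
  rewrite ?(ramp_pos x0) ?(ramp_neg (ltW x0)) ?(ramp_pos hx0) ?(ramp_neg (ltW hx0));
  by apply/andP; split; nra.
Qed.

Lemma is_derive_ramp_sqr x : is_derive x 1 (fun y => ramp y ^+ 2) (2 * ramp x).
Proof.
have H : h^-1 *: ((fun y => ramp y ^+ 2) (h *: (1 : R) + x) - ramp x ^+ 2)
    @[h --> (0 : R)^'] --> 2 * ramp x.
  apply: (@squeeze_dist _ _ _ _ _ (fun h : R => `|h|)).
    near=> h; have h0 : h != 0 by near: h; exact: nbhs_dnbhs_neq.
    rewrite -[h *: 1]/(h * 1) mulr1 -[_ *: _]/(_ * _).
    rewrite -(ler_pM2l (_ : 0 < `|h|)) ?normr_gt0// -normrM mulrBr (mulrA h h^-1) mulfV// mul1r.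
    rewrite distrC -normrM -expr2 ger0_norm ?sqr_ge0//.
    by rewrite mulrC; exact: ramp_sqr_taylor.
  by apply/(norm_cvg0P (fun h : R => h)); exact: cvg_within.
by apply: DeriveDef; [apply/cvg_ex; exists (2 * ramp x)|apply/cvg_lim].
Unshelve. all: by end_near. Qed.

(* A C^1 step from 0 for [x <= a] to 1 for [a + 2 * e <= x]. *)
Definition smoothstep a e x : R :=
  (ramp (x - a) ^+ 2 - 2 * ramp (x - (a + e)) ^+ 2 + ramp (x - (a + 2 * e)) ^+ 2)
  / (2 * e ^+ 2).

(** The derivative of [smoothstep a e]: a hat supported in [a, a + 2e], of height 1 / e and mass
    one, hence an approximate unit as [e] tends to 0. *)
Definition tent a e x : R :=
  (ramp (x - a) - 2 * ramp (x - (a + e)) + ramp (x - (a + 2 * e))) / e ^+ 2.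

Lemma continuous_tent a e : continuous (tent a e).
Proof.
have cr b x : {for x, continuous (fun y => ramp (y - b))}.
  apply: (continuous_comp (f := fun y => y - b)); last exact: continuous_ramp.
  by apply: cvgB; [exact: cvg_id|exact: cvg_cst].
move=> x; apply: cvgMr_tmp; apply: cvgD; last exact: cr.
apply: cvgB; first exact: cr.
by apply: cvgMl_tmp; exact: cr.
Qed.

Lemma is_derive_smoothstep a e x : e != 0 ->
  is_derive x 1 (smoothstep a e) (tent a e x).
Proof.
move=> e0.
pose q b : R -> R := fun y => ramp (y - b) ^+ 2.
have dr b : is_derive x 1 (q b) (2 * ramp (x - b)).
  have := @is_derive1_comp _ (fun y => ramp y ^+ 2) (fun y => y - b) x _ _
    (is_derive_ramp_sqr (x - b)) (is_deriveB (is_derive_id x 1) (is_derive_cst b x 1)).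
  by rewrite subr0 mulr1.
have -> : smoothstep a e =
    (2 * e ^+ 2)^-1 *: (q a - (2 : R) *: q (a + e) + q (a + 2 * e)).
  by apply/funext => y; rewrite /smoothstep mulrC.
have := is_deriveZ (2 * e ^+ 2)^-1 (is_deriveD
  (is_deriveB (dr a) (is_deriveZ (2 : R) (dr (a + e)))) (dr (a + 2 * e))).
move=> H; apply: (is_derive_eq H).
by rewrite -[_ *: _]/(_ * _) -[2 *: _]/(_ * _) /tent; field.
Qed.

Lemma smoothstep_le a e x : x <= a -> 0 < e -> smoothstep a e x = 0.
Proof. by move=> xa e0; rewrite /smoothstep !ramp_neg; [rewrite expr0n/= mulr0 subr0 addr0 mul0r|lra..]. Qed.

Lemma smoothstep_ge a e x : a + 2 * e <= x -> 0 < e -> smoothstep a e x = 1.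
Proof.
move=> xa e0; rewrite /smoothstep !ramp_pos; [|lra..].
by field; rewrite gt_eqF.
Qed.

Lemma smoothstep_itv a e x : 0 < e -> 0 <= smoothstep a e x <= 1.
Proof.
move=> e0; have ee : 0 < 2 * e ^+ 2 by rewrite mulr_gt0// exprn_gt0.
rewrite /smoothstep ler_pdivlMr// ler_pdivrMr// mul0r mul1r.
have [xa|xa] := leP x a.
  by rewrite !ramp_neg; [rewrite expr0n/= mulr0 subr0 addr0 lexx ltW|lra..].
rewrite (ramp_pos (x := x - a)); last lra.
have [x1|x1] := leP x (a + e).
  rewrite !ramp_neg; [|lra..].
  by apply/andP; split; nra.
rewrite (ramp_pos (x := x - (a + e))); last lra.
have [x2|x2] := leP x (a + 2 * e).
  rewrite ramp_neg; last lra.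
  by apply/andP; split; nra.
rewrite ramp_pos; last lra.
by apply/andP; split; nra.
Qed.

Lemma tent_ge0 a e x : 0 < e -> 0 <= tent a e x.
Proof.
move=> e0; rewrite /tent divr_ge0 ?sqr_ge0//.
have [xa|xa] := leP x a; first by rewrite !ramp_neg; lra.
rewrite (ramp_pos (x := x - a)); last lra.
have [x1|x1] := leP x (a + e); first by rewrite !ramp_neg; lra.
rewrite (ramp_pos (x := x - (a + e))); last lra.
have [x2|x2] := leP x (a + 2 * e); first by rewrite ramp_neg; lra.
rewrite ramp_pos; lra.
Qed.

Lemma tent_support a e x : 0 < e -> x <= a \/ a + 2 * e <= x -> tent a e x = 0.
Proof.
move=> e0 [xa|xa]; rewrite /tent.
  by rewrite !ramp_neg; [rewrite mulr0 subr0 addr0 mul0r|lra..].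
rewrite !ramp_pos; [|lra..].
by rewrite (_ : _ - _ + _ = 0) ?mul0r//; ring.
Qed.

Lemma tent_le a e x : 0 < e -> tent a e x <= e^-1.
Proof.
move=> e0; have ee : 0 < e ^+ 2 by rewrite exprn_gt0.
have eE : e^-1 * e ^+ 2 = e by field; rewrite gt_eqF.
rewrite /tent ler_pdivrMr// eE.
have [xa|xa] := leP x a; first by rewrite !ramp_neg; lra.
rewrite (ramp_pos (x := x - a)); last lra.
have [x1|x1] := leP x (a + e); first by rewrite !ramp_neg; lra.
rewrite (ramp_pos (x := x - (a + e))); last lra.
have [x2|x2] := leP x (a + 2 * e); first by rewrite ramp_neg; lra.
rewrite ramp_pos; lra.
Qed.

Lemma integral_tent a e (T : R) : 0 <= a -> 0 < e -> a + 2 * e <= T ->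
  (\int[mu]_(x in `]0%R, T[) (tent a e x)%:E)%E = 1%E.
Proof.
move=> a0 e0 aeT; have T0 : 0 < T by lra.
rewrite -(@integral_itv_bndoo _ _ _ _ true false); last first.
  apply/measurable_EFinP; apply: measurable_funTS.
  exact: (continuous_measurable_fun (@continuous_tent a e)).
have d x : is_derive x 1 (smoothstep a e) (tent a e x).
  by apply: is_derive_smoothstep; rewrite gt_eqF.
have cs : continuous (smoothstep a e).
  by move=> x; apply: differentiable_continuous; apply/derivable1_diffP; exact: ex_derive.
rewrite (@continuous_FTC2 _ _ (smoothstep a e) _ _ T0).
- by rewrite smoothstep_ge// (smoothstep_le a0)// sube0.
- by apply: continuous_subspaceT; exact: continuous_tent.
- split.
  + by move=> x _; exact: ex_derive.
  + exact: cvg_at_right_filter (cs _).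
  + exact: cvg_at_left_filter (cs _).
- by move=> x _; rewrite derive1E derive_val.
Qed.

End smoothstep.

Lemma Rdominated_cvg d (X : measurableType d) (R : realType)
    (m : {measure set X -> \bar R}) (D : set X) (f_ : nat -> X -> R) (f g : X -> R) :
  measurable D -> (forall n, measurable_fun D (f_ n)) ->
  (forall x, D x -> f_ n x @[n --> \oo] --> f x) ->
  m.-integrable D (EFin \o g) -> (forall n x, D x -> `|f_ n x| <= g x) ->
  \int[m]_(x in D) f_ n x @[n --> \oo] --> \int[m]_(x in D) f x.
Proof.
move=> mD mf_ f_f ig f_g.
have mf : measurable_fun D f by exact: measurable_fun_cvg f_f.
have c_ae : {ae m, forall x, D x -> (fun n => (f_ n x)%:E) @ \oo --> (f x)%:E}.
  by apply: aeW => x Dx; apply/fine_cvgP; split; [exact: nearW|exact: f_f].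
have d_ae : {ae m, forall x n, D x -> (`|(f_ n x)%:E| <= (g x)%:E)%E}.
  by apply: aeW => x n Dx; rewrite lee_fin; exact: f_g.
have [i_f _ H] := @dominated_convergence _ _ R m D mD (fun n x => (f_ n x)%:E)
  (EFin \o f) (EFin \o g) (fun n => iffRL (measurable_EFinP _ _) (mf_ n))
  (iffRL (measurable_EFinP _ _) mf) c_ae ig d_ae.
by move: H; rewrite [X in _ --> X](EFin_Rintegral m mD i_f) => /fine_cvg.
Qed.

(** * Increments as integrals of the weak derivative *)

Section weakly_regular.
Context (R : realType) (V : lmodType R) (X : set V) (B : V -> V -> R).
Hypothesis hB : semi_ip X B.
Context (T : R).
Hypothesis T0 : 0 < T.
Local Notation N := (snorm B).
Local Notation mu := (@lebesgue_measure R).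
Local Notation E := (`]0, T[%classic : set R).

(** The hats have mass one and concentrate at [c], where [u] is continuous for the seminorm. As [c]
    may be an end point of [0, T], they are only asked to lie within [8 * e n] of it, not to be
    centred there. *)
Lemma tent_sip_cvg (Z : set R) (u : R -> V) (w : V) (c : R) (a e : nat -> R) :
  measurable Z -> mu Z = 0%E ->
  (forall t, t \in `[0, T] -> X (u t)) -> X w -> c \in `[0, T] ->
  N (u s - u c) @[s --> within `[0, T] (nbhs c)] --> 0 ->
  mu.-integrable (E `\` Z) (EFin \o (fun t => B (u t) w)) ->
  (forall n, [/\ 0 < e n, 0 <= a n & a n + 2 * e n <= T]) ->
  (forall n x, a n <= x <= a n + 2 * e n -> `|x - c| <= 8 * e n) ->
  e n @[n --> \oo] --> 0 ->
  \int[mu]_(t in E `\` Z) (tent (a n) (e n) t * B (u t) w) @[n --> \oo] --> B (u c) w.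
Proof.
move=> mZ Z0 Xu Xw cT uc iu ae ac e0.
set D := E `\` Z.
have mE : measurable E by exact: measurable_itv.
have mD : measurable D by exact: measurableD.
have Xuc := Xu c cT.
have Nw0 : 0 < N w + 1 by rewrite ltr_wpDl ?snorm_ge0.
have mtent n : measurable_fun D (tent (a n) (e n)).
  by apply: measurable_funTS; exact: (continuous_measurable_fun (@continuous_tent _ _ _)).
have fD : (mu D < +oo)%E.
  apply: (@le_lt_trans _ _ (mu E)); last by rewrite lebesgue_measure_itv/= lte_fin T0 ltry.
  by apply: le_measure; rewrite ?inE//; exact: subIsetl.
have tentb n x : `|tent (a n) (e n) x| <= (e n)^-1.
  by case: (ae n) => en0 an0 anT; rewrite ger0_norm ?tent_ge0 ?tent_le.
have itent n : mu.-integrable D (EFin \o tent (a n) (e n)).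
  apply: (integ_bounded mu mD (e n)^-1); [exact: fD|exact: mtent|].
  by move=> x _; exact: tentb.
have int1 n : \int[mu]_(t in D) tent (a n) (e n) t = 1.
  have [en0 an0 anT] := ae n.
  rewrite /Rintegral -(@integral_null_setD _ _ _ mu _ _ _ mZ Z0) integral_tent//.
have iprod n : mu.-integrable D (EFin \o (fun t => tent (a n) (e n) t * B (u t) w)).
  apply: (le_integ mu mD (fun t => (e n)^-1 * `|B (u t) w|)).
  - by apply: measurable_funM; [exact: mtent|exact: integ_measurable iu].
  - by move=> t Dt; rewrite normrM ler_wpM2r// tentb.
  - by apply: (integZ mu mD); exact: integrable_norm iu.
apply/cvgrPdist_le => eps eps0.
(* The 1 allows for a test element with [N w = 0]. *)
have eps1 : 0 < eps / (N w + 1) by rewrite divr_gt0.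
move/cvgrPdist_le : uc => /(_ _ eps1).
rewrite /within/= => /nbhs_ballP[del /= del0 Hdel].
have del8 : 0 < del / 8 by rewrite divr_gt0.
move/cvgrPdist_lt : e0 => /(_ _ del8); apply: filterS => n.
rewrite sub0r normrN => en; have [en0 an0 anT] := ae n.
rewrite gtr0_norm// in en.
have -> : B (u c) w - \int[mu]_(t in D) (tent (a n) (e n) t * B (u t) w) =
    \int[mu]_(t in D) (tent (a n) (e n) t * (B (u c) w - B (u t) w)).
  transitivity (\int[mu]_(t in D) (B (u c) w * tent (a n) (e n) t - tent (a n) (e n) t * B (u t) w)).
    rewrite RintegralB//; last exact: (integZ mu mD).
    by rewrite RintegralZl// int1 mulr1.
  by apply: eq_Rintegral => t _; ring.
have id : mu.-integrable D (EFin \o (fun t => tent (a n) (e n) t * (B (u c) w - B (u t) w))).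
  apply: (eq_integ mu mD (fun t => B (u c) w * tent (a n) (e n) t - tent (a n) (e n) t * B (u t) w)).
    by move=> t _; ring.
  by apply: (integB mu mD) => //; exact: (integZ mu mD).
apply: (le_trans (@le_normr_Rintegral _ _ _ mu _ _ mD id)).
rewrite -[leRHS]mulr1 -(int1 n) -RintegralZl//.
apply: le_Rintegral => //.
- exact: (integrable_norm id).
- exact: (integZ mu mD).
move=> t [Et Zt]; rewrite normrM ger0_norm ?tent_ge0// mulrC.
have [tn|tn] := boolP (a n <= t <= a n + 2 * e n); last first.
  rewrite tent_support ?mulr0//.
  by move: tn; rewrite negb_and -!ltNge => /orP[?|?]; [left|right]; exact: ltW.
apply: ler_wpM2r; first exact: tent_ge0.
have tT : t \in `[0, T] by move: Et; rewrite /= !in_itv/= => /andP[? ?]; rewrite !ltW.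
have := Hdel t; rewrite /ball/= distrC => /(_ _ tT).
have -> : `|t - c| < del.
  apply: (le_lt_trans (ac n t tn)); lra.
move=> /(_ isT); rewrite sub0r normrN ger0_norm ?snorm_ge0// => ut.
have Xut := Xu t tT.
rewrite -(sipB hB)//.
apply: (le_trans (sip_cauchy_schwarz_norm hB (sip_domB hB Xuc Xut) Xw)).
rewrite (snorm_distC hB)//.
apply: (@le_trans _ _ (eps / (N w + 1) * N w)); first by rewrite ler_wpM2r ?snorm_ge0.
by rewrite mulrAC ler_pdivrMr// ler_pM2l// lerDl.
Qed.

End weakly_regular.

Section time_H1_regularity.
Context (R : realType) (V : lmodType R) (X : set V) (B : V -> V -> R).
Hypothesis hB : semi_ip X B.
Context (T : R).
Hypothesis T0 : 0 < T.
Local Notation N := (snorm B).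
Local Notation mu := (@lebesgue_measure R).
Local Notation E := (`]0, T[%classic : set R).

(* Z collects the times discarded by the almost everywhere statements; integrals
   of functions, measurable or not, do not see it. *)
Definition wreg (Z : set R) (u du : R -> V) : Prop :=
  [/\ measurable Z, mu Z = 0%E, sqint X B (E `\` Z) du,
      forall t, t \in `[0, T] -> X (u t) &
      forall s t w, 0 <= s -> s <= t -> t <= T -> X w ->
        B (u t - u s) w = \int[mu]_(r in `]s, t[ `\` Z) B (du r) w].

Lemma measurable_domD (Z : set R) : measurable Z -> measurable (E `\` Z).
Proof. by move=> mZ; apply: measurableD => //; exact: measurable_itv. Qed.

Lemma finite_domD (Z : set R) : measurable Z -> (mu (E `\` Z) < +oo)%E.
Proof.
move=> mZ; apply: (@le_lt_trans _ _ (mu E)); last first.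
  by rewrite lebesgue_measure_itv/= lte_fin T0 ltry.
apply: le_measure; [| |exact: subIsetl].
  by rewrite inE; exact: measurable_domD.
by rewrite inE; exact: measurable_itv.
Qed.

Lemma sub_domD (Z : set R) (s t : R) : 0 <= s -> t <= T ->
  `]s, t[%classic `\` Z `<=` E `\` Z.
Proof.
move=> s0 tT r [str Zr]; split => //=.
move: str; rewrite /= !in_itv/= => /andP[sr rt].
by rewrite (le_lt_trans s0 sr) (lt_le_trans rt tT).
Qed.

Lemma wreg_integ Z u du w s t : wreg Z u du -> X w -> 0 <= s -> t <= T ->
  mu.-integrable (`]s, t[ `\` Z) (EFin \o (fun r => B (du r) w)).
Proof.
move=> [mZ Z0 sdu _ _] Xw s0 tT.
have mst : measurable (`]s, t[%classic `\` Z) by apply: measurableD.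
have sub := @sub_domD Z _ _ s0 tT.
apply: (sqint_integrable hB mst).
  exact: (sqintS hB sub sdu).
apply: (sqint_bounded hB (C := B w w)) => //.
- apply: le_lt_trans (finite_domD mZ); apply: le_measure; [| |exact: sub].
    by rewrite inE; exact: mst.
  by rewrite inE; exact: measurable_domD.
- exact: (smeas_cst hB).
Qed.

Lemma wreg_null Z Z' u du : wreg Z u du -> measurable Z' -> mu Z' = 0%E ->
  wreg (Z `|` Z') u du.
Proof.
move=> [mZ Z0 sdu Xu du_int] mZ' Z'0.
have sub (A : set R) : A `\` (Z `|` Z') `<=` A `\` Z.
  by move=> r [Ar /not_orP[]].
split => //.
- exact: measurableU.
- by apply: (etrans _ Z0); exact: measureU0.
- exact: (sqintS hB (@sub E) sdu).
move=> s t w s0 st tT Xw; rewrite du_int// /Rintegral.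
by rewrite (@integral_null_setD _ _ _ mu _ _ _ mZ' Z'0) setDDl.
Qed.

Lemma wregD Z Z' u du v dv : wreg Z u du -> wreg Z' v dv ->
  wreg (Z `|` Z') (fun t => u t + v t) (fun t => du t + dv t).
Proof.
move=> hu hv.
have [mZ Z0 _ _ _] := hu; have [mZ' Z'0 _ _ _] := hv.
have hu' := wreg_null hu mZ' Z'0.
have hv' : wreg (Z `|` Z') v dv by rewrite setUC; exact: wreg_null hv mZ Z0.
move: (Z `|` Z') hu' hv' => W hu' hv'.
have [mW W0 sdu Xu u_int] := hu'; have [_ _ sdv Xv v_int] := hv'.
split => //.
- by apply: (sqintD hB) => //; exact: measurable_domD.
- by move=> t tT; apply: (sip_domD hB); [exact: Xu|exact: Xv].
move=> s t w s0 st tT Xw.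
have tT' : t \in `[0, T] by rewrite in_itv/= (le_trans s0 st).
have sT' : s \in `[0, T] by rewrite in_itv/= s0 (le_trans st).
have mst : measurable (`]s, t[%classic `\` W) by apply: measurableD.
have Xus := Xu s sT'; have Xut := Xu t tT'; have Xvs := Xv s sT'; have Xvt := Xv t tT'.
rewrite opprD addrACA (sipD hB)//; [|exact: (sip_domB hB)..].
rewrite u_int// v_int// -RintegralD//; last 2 first.
- exact: (wreg_integ hu').
- exact: (wreg_integ hv').
apply: eq_Rintegral => r; rewrite inE => /(sub_domD s0 tT) Dr.
by rewrite (sipD hB)//; [case: sdu => -[+ _] _; exact|case: sdv => -[+ _] _; exact].
Qed.

Lemma wregZ Z a u du : wreg Z u du -> wreg Z (fun t => a *: u t) (fun t => a *: du t).
Proof.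
move=> hu; have [mZ Z0 sdu Xu u_int] := hu; split => //.
- by apply: (sqintZ hB) => //; exact: measurable_domD.
- by move=> t tT; apply: (sip_domZ hB); exact: Xu.
move=> s t w s0 st tT Xw.
have tT' : t \in `[0, T] by rewrite in_itv/= (le_trans s0 st).
have sT' : s \in `[0, T] by rewrite in_itv/= s0 (le_trans st).
have mst : measurable (`]s, t[%classic `\` Z) by apply: measurableD.
have Xus := Xu s sT'; have Xut := Xu t tT'.
rewrite -scalerBr (sipZ hB)//; last exact: (sip_domB hB).
rewrite u_int// -RintegralZl//; last exact: (wreg_integ hu).
apply: eq_Rintegral => r; rewrite inE => /(sub_domD s0 tT) Dr.
by rewrite (sipZ hB)//; case: sdu => -[+ _] _; exact.
Qed.

Lemma wregB Z Z' u du v dv : wreg Z u du -> wreg Z' v dv ->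
  wreg (Z `|` Z') (fun t => u t - v t) (fun t => du t - dv t).
Proof.
move=> hu hv; have := wregD hu (wregZ (-1) hv).
rewrite (_ : (fun t => u t + _) = (fun t => u t - v t)); last first.
  by apply/funext => t; rewrite scaleN1r.
rewrite (_ : (fun t => du t + _) = (fun t => du t - dv t))//.
by apply/funext => t; rewrite scaleN1r.
Qed.

Lemma sqint_time_L2 u : time_L2 X N T u ->
  exists Z, [/\ measurable Z, mu Z = 0%E & sqint X B (E `\` Z) u].
Proof.
move=> [su iu]; have [Z [mZ Z0 sZ]] := smeas_of_ae su; exists Z; split => //.
split => //; rewrite -(@integral_null_setD _ _ _ mu _ _ _ mZ Z0).
rewrite [ltLHS](_ : _ = (\int[mu]_(t in E) ((N (u t)) ^+ 2)%:E)%E)//.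
by apply: eq_integral => t _; rewrite (snorm_sqr hB).
Qed.

(** A C^1 plateau, equal to one on [a + 2e, b] and supported in [a, b + 2e]. Its derivative is a
    difference of two hats, so testing a weak derivative with it compares two local means of the
    function. *)
Lemma time_test_smoothstep (a b e : R) : 0 < a -> 0 < e -> a + 2 * e <= b ->
  b + 2 * e < T ->
  time_test T (fun x => smoothstep a e x - smoothstep b e x) /\
  derive1 (fun x => smoothstep a e x - smoothstep b e x) =
    (fun x => tent a e x - tent b e x).
Proof.
move=> a0 e0 ab bT; have e1 : e != 0 by rewrite gt_eqF.
have d (x : R) : is_derive x 1 (smoothstep a e - smoothstep b e) (tent a e x - tent b e x).
  by apply: is_deriveB; exact: is_derive_smoothstep.
have dE : derive1 (fun x => smoothstep a e x - smoothstep b e x) =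
    (fun x => tent a e x - tent b e x).
  by apply/funext => x; rewrite derive1E; exact: derive_val.
split => //; split.
- by move=> t; exact: ex_derive.
- by rewrite dE => x; apply: cvgB; exact: continuous_tent.
exists `[a, b + 2 * e]%classic.
  split; first exact: segment_compact.
  move=> x /=; rewrite !in_itv/= => /andP[ax xb].
  by rewrite (lt_le_trans a0 ax) (le_lt_trans xb bT).
move=> x /=; rewrite in_itv/= => /negP; rewrite negb_and -!ltNge => /orP[xa|bx].
  by rewrite !smoothstep_le ?subrr//; lra.
by rewrite !smoothstep_ge ?subrr//; lra.
Qed.

(** The weak derivative is tested with plateaus that approximate the indicator of ]s, t[: the hats
    of their derivatives concentrate at [s] and [t], where [u] is continuous, while the plateaus
    converge boundedly to the indicator. *)
Lemma wreg_of_time_H1 u du : time_H1 X N T u du -> exists Z, wreg Z u du.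
Proof.
move=> [Lu Ldu wd cu].
have [Z1 [mZ1 Z10 su]] := sqint_time_L2 Lu.
have [Z2 [mZ2 Z20 sdu]] := sqint_time_L2 Ldu.
exists (Z1 `|` Z2); set Z := Z1 `|` Z2.
have mZ : measurable Z by exact: measurableU.
have Z0 : mu Z = 0%E by apply: (etrans _ Z10); exact: measureU0.
set D := E `\` Z.
have mD : measurable D by exact: measurable_domD.
have mE : measurable E by exact: measurable_itv.
have fE : (mu E < +oo)%E by rewrite lebesgue_measure_itv/= lte_fin T0 ltry.
have fD : (mu D < +oo)%E by exact: finite_domD.
have {}su : sqint X B D u by apply: (sqintS hB _ su) => r [Er /not_orP[]].
have {}sdu : sqint X B D du by apply: (sqintS hB _ sdu) => r [Er /not_orP[]].
have Xu t : t \in `[0, T] -> X (u t) by move=> /cu[].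
have XuD t : D t -> X (u t) by case: su => -[+ _] _; exact.
have XduD t : D t -> X (du t) by case: sdu => -[+ _] _; exact.
split => // s t w s0 st tT Xw.
have tT' : t \in `[0, T] by rewrite in_itv/= (le_trans s0 st).
have sT' : s \in `[0, T] by rewrite in_itv/= s0 (le_trans st).
have [ts|{}st] := leP t s.
  have {ts st}-> : t = s by apply/eqP; rewrite eq_le st ts.
  rewrite subrr (sip0 hB)// set_itv_ge ?bnd_simp ?ltxx// set0D.
  by rewrite Rintegral_set0.
have scst : sqint X B D (fun=> w).
  by apply: (sqint_bounded hB (C := B w w)) => //; exact: (smeas_cst hB).
have iu : mu.-integrable D (EFin \o (fun r => B (u r) w)) by exact: (sqint_integrable hB).
have idu : mu.-integrable D (EFin \o (fun r => B (du r) w)) by exact: (sqint_integrable hB).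
(* Small enough for the two hats, each of width [2 * e n], to fit side by side inside ]s, t[. *)
pose e n : R := (t - s) / 8 * n.+1%:R^-1.
have e0 n : 0 < e n by rewrite mulr_gt0 ?invr_gt0 ?ltr0n// divr_gt0 ?subr_gt0.
have e8 n : 8 * e n <= t - s.
  rewrite /e mulrA (mulrC 8) divfK//.
  apply: ler_piMr; first by rewrite subr_ge0 ltW.
  by rewrite invf_le1 ?ltr0n// ler1n.
have e_cvg : e n @[n --> \oo] --> 0.
  rewrite -(mulr0 ((t - s) / 8)); apply: cvgMl_tmp; exact: cvg_harmonic.
(* The plateau is supported in [s + e, t - e], a compact subset of ]0, T[ even when s = 0 or t =
   T. *)
pose a n := s + e n; pose b n := t - 3 * e n.
have test n := @time_test_smoothstep (a n) (b n) (e n).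
(* The definition of the weak derivative, paired with [w]. *)
have key n : \int[mu]_(r in D) (tent (a n) (e n) r * B (u r) w) -
    \int[mu]_(r in D) (tent (b n) (e n) r * B (u r) w) =
    - \int[mu]_(r in D) ((smoothstep (a n) (e n) r - smoothstep (b n) (e n) r) * B (du r) w).
  have en := e0 n; have en8 := e8 n.
  have [||||tt td] := test n; rewrite /a /b; [lra|lra|lra|lra|].
  have [I bI bNI] := wd _ tt.
  have [XI _ _] := bI.
  have itent c : mu.-integrable D (EFin \o (fun r => tent c (e n) r * B (u r) w)).
    apply: (le_integ mu mD (fun r => (e n)^-1 * `|B (u r) w|)).
    - apply: measurable_funM; last exact: integ_measurable iu.
      by apply: measurable_funTS; exact: (continuous_measurable_fun (@continuous_tent _ _ _)).
    - move=> r _; rewrite normrM ler_wpM2r// ger0_norm ?tent_ge0//.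
      exact: tent_le.
    - by apply: (integZ mu mD); exact: integrable_norm iu.
  have := bochner_sip hB mE fE bI Xw.
  have := bochner_sip hB mE fE bNI Xw.
  rewrite (sipN hB)// => /eqP; rewrite eqr_oppLR => /eqP ->.
  rewrite /Rintegral !(@integral_null_setD _ _ _ mu _ E _ mZ Z0) -/D => H.
  have : \int[mu]_(r in D) B (derive1 (fun x => smoothstep (a n) (e n) x - smoothstep (b n) (e n) x) r *: u r) w =
     \int[mu]_(r in D) (tent (a n) (e n) r * B (u r) w - tent (b n) (e n) r * B (u r) w).
    apply: eq_Rintegral => r; rewrite inE => Dr.
    by rewrite td (sipZ hB)// ?mulrBl//; exact: XuD.
  rewrite RintegralB// => <-; rewrite /Rintegral -H; congr (- fine _).
  apply: eq_integral => r; rewrite inE => Dr.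
  by rewrite (sipZ hB)//; exact: XduD.
have limA : \int[mu]_(r in D) (tent (a n) (e n) r * B (u r) w) @[n --> \oo] --> B (u s) w.
  apply: (tent_sip_cvg hB) => //; first by case: (cu s sT').
    move=> n; have en := e0 n; have en8 := e8 n; split => //; rewrite /a; lra.
  move=> n x; have en := e0 n; rewrite /a => /andP[x1 x2].
  by rewrite ler_norml; apply/andP; split; lra.
have limB : \int[mu]_(r in D) (tent (b n) (e n) r * B (u r) w) @[n --> \oo] --> B (u t) w.
  apply: (tent_sip_cvg hB) => //; first by case: (cu t tT').
    move=> n; have en := e0 n; have en8 := e8 n; split => //; rewrite /b; lra.
  move=> n x; have en := e0 n; rewrite /b => /andP[x1 x2].
  by rewrite ler_norml; apply/andP; split; lra.
have mstep c n : measurable_fun D (smoothstep c (e n)).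
  apply: measurable_funTS; apply: continuous_measurable_fun => x.
  apply: differentiable_continuous; apply/derivable1_diffP.
  have e1 : e n != 0 by rewrite gt_eqF.
  have H := is_derive_smoothstep c x e1.
  exact: ex_derive.
pose chi (r : R) : R := \1_(`]s, t[%classic : set R) r.
have limC : \int[mu]_(r in D) ((smoothstep (a n) (e n) r - smoothstep (b n) (e n) r) * B (du r) w)
    @[n --> \oo] --> \int[mu]_(r in D) (chi r * B (du r) w).
  apply: (@Rdominated_cvg _ _ _ mu D _ _ (fun r => `|B (du r) w|)) => //.
  - move=> n; apply: measurable_funM; last exact: integ_measurable idu.
    by apply: measurable_funB; exact: mstep.
  - move=> r _; apply: cvgMr_tmp; apply: cvg_near_cst.
    rewrite /chi indicE.
    have [rs|rs] := leP r s.
      apply: nearW => n; rewrite !smoothstep_le// ?subrr ?memNset//=.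
      + by rewrite in_itv/= ltNge rs.
      + by have := e8 n; rewrite /b; have := e0 n; lra.
      + by rewrite /a; have := e0 n; lra.
    have [tr|tr] := leP t r.
      apply: nearW => n; rewrite !smoothstep_ge// ?subrr ?memNset//=.
      + by rewrite in_itv/= (ltNge r) tr andbF.
      + by rewrite /b; have := e0 n; lra.
      + by have := e8 n; rewrite /a; have := e0 n; lra.
    (* Once [e n] is below this bound, [r] lies in [s + 3e, t - 3e], where the plateau equals
       one. *)
    have m0 : 0 < Num.min (r - s) (t - r) / 3.
      by rewrite divr_gt0// lt_min !subr_gt0 rs tr.
    move/cvgrPdist_lt : e_cvg => /(_ _ m0); apply: filterS => n.
    rewrite sub0r normrN gtr0_norm// ltr_pdivlMr// lt_min => /andP[r1 r2].
    rewrite smoothstep_ge// ?smoothstep_le// ?subr0 ?mem_set//= ?in_itv/= ?rs//.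
    + by rewrite /b; lra.
    + by rewrite /a; lra.
  - exact: integrable_norm idu.
  - move=> n r _; rewrite normrM ler_piMl//.
    have /andP[? ?] := smoothstep_itv (a n) r (e0 n).
    have /andP[? ?] := smoothstep_itv (b n) r (e0 n).
    by rewrite ler_norml; apply/andP; split; lra.
have limAB : (- \int[mu]_(r in D) ((smoothstep (a n) (e n) r - smoothstep (b n) (e n) r) * B (du r) w))
    @[n --> \oo] --> B (u s) w - B (u t) w.
  rewrite (_ : (fun n => _) = (fun n => \int[mu]_(r in D) (tent (a n) (e n) r * B (u r) w) -
      \int[mu]_(r in D) (tent (b n) (e n) r * B (u r) w))); first exact: cvgB.
  by apply/funext => n; rewrite key.
have limC' : (- \int[mu]_(r in D) ((smoothstep (a n) (e n) r - smoothstep (b n) (e n) r) * B (du r) w))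
    @[n --> \oo] --> - \int[mu]_(r in D) (chi r * B (du r) w).
  exact: cvgN.
have H := cvg_unique _ limAB limC'.
have Xus := Xu s sT'; have Xut := Xu t tT'.
rewrite (sipB hB)//.
have -> : B (u t) w - B (u s) w = \int[mu]_(r in D) (chi r * B (du r) w).
  by apply: oppr_inj; rewrite opprB H.
rewrite (_ : `]s, t[ `\` Z = D `&` `]s, t[%classic); last first.
  apply/seteqP; split => r.
    by move=> [str Zr]; split => //; exact: (sub_domD s0 tT).
  by move=> [[_ Zr] str].
rewrite [RHS]Rintegral_mkcondr; apply: (@eq_Rintegral _ _ _ mu) => r _.
rewrite /chi patchE indicE.
by case: (r \in _); rewrite ?mul1r ?mul0r.
Qed.

End time_H1_regularity.

(** * Difference quotients in time *)

Section window_average.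
Context (R : realType).
Local Open Scope ereal_scope.
Local Notation mu := (@lebesgue_measure R).

Lemma avgZ n (a : R) (k : R -> \bar R) t : (0 <= a)%R ->
  (forall r, 0 <= k r) -> measurable_fun [set: R] k ->
  avg n (fun r => a%:E * k r) t = a%:E * avg n k t.
Proof.
move=> a0 k0 mk; rewrite /avg ge0_integralZl_EFin//; first by rewrite muleCA.
- exact: measurable_window.
- exact: measurable_funTS.
Qed.

Lemma avg_sum n (I : Type) (s : seq I) (k : I -> R -> \bar R) t :
  (forall i r, 0 <= k i r) -> (forall i, measurable_fun [set: R] (k i)) ->
  avg n (fun r => \sum_(i <- s) k i r) t = \sum_(i <- s) avg n (k i) t.
Proof.
move=> k0 mk; elim: s => [|i s IH].
  rewrite big_nil; transitivity (avg n (fun=> 0%:E) t); last exact: avg_cst.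
  congr (_ * _).
  by apply: eq_integral => r _; rewrite big_nil.
rewrite big_cons -IH -avgD//.
- by congr (_ * _); apply: eq_integral => r _; rewrite big_cons.
- by move=> r; apply: sume_ge0.
- exact: emeasurable_sum.
Qed.

End window_average.

Section difference_quotient.
Context (R : realType) (V : lmodType R) (X : set V) (B : V -> V -> R).
Hypothesis hB : semi_ip X B.
Context (T : R).
Hypothesis T0 : 0 < T.
Local Notation N := (snorm B).
Local Notation mu := (@lebesgue_measure R).
Local Notation E := (`]0, T[%classic : set R).

(** The increment is paired with itself, which turns its square into an integral over ]s, t[;
    Young's inequality then plays the role of Cauchy-Schwarz in time. The function is therefore
    Hoelder continuous of exponent 1/2. *)
Lemma wreg_holder Z u du s t : wreg X B T Z u du -> 0 <= s -> s <= t -> t <= T ->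
  B (u t - u s) (u t - u s) <=
  (t - s) * \int[mu]_(r in E `\` Z) B (du r) (du r).
Proof.
move=> hu s0 st tT; have [mZ Z0 sdu Xu u_int] := hu.
have tT' : t \in `[0, T] by rewrite in_itv/= (le_trans s0 st).
have sT' : s \in `[0, T] by rewrite in_itv/= s0 (le_trans st).
have Xw := sip_domB hB (Xu t tT') (Xu s sT').
set w := u t - u s in Xw *.
set C := \int[mu]_(r in _) _.
have C0 : 0 <= C by apply: Rintegral_ge0 => r _; exact: (sip_ge0 hB).
have [ts|{}st] := leP t s.
  have {}ts : t = s by apply/eqP; rewrite eq_le st ts.
  by rewrite /w ts !subrr mul0r (sip0 hB)//; exact: (sip_dom0 hB).
set Y := `]s, t[%classic `\` Z.
have mY : measurable Y by apply: measurableD.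
have mD : measurable (E `\` Z) := measurable_domD T mZ.
have sub : Y `<=` E `\` Z := sub_domD s0 tT.
have ts0 : 0 < t - s by rewrite subr_gt0.
have muY : (mu Y <= (t - s)%:E)%E.
  have -> : ((t - s)%:E = mu `]s, t[%classic)%E.
    by rewrite lebesgue_measure_itv/= lte_fin st.
  apply: le_measure; [by rewrite inE|rewrite inE; exact: measurable_itv|exact: subDsetl].
have fY : (mu Y < +oo)%E by rewrite (le_lt_trans muY)// ltry.
have idu : mu.-integrable (E `\` Z) (EFin \o (fun r => B (du r) (du r))).
  exact: (sqint_integrable2 hB).
have iduY : mu.-integrable Y (EFin \o (fun r => B (du r) (du r))).
  exact: (@integrableS _ _ _ mu _ _ _ mD mY sub idu).
(* With weight [t - s] the second term integrates to at most half of the left side and is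
   absorbed. *)
have : B w w <= \int[mu]_(r in Y) ((t - s) / 2 * B (du r) (du r) + (t - s)^-1 * B w w / 2).
  rewrite [leLHS](u_int s t w)//; last exact: ltW.
  apply: le_Rintegral => //.
  - exact: (wreg_integ hB T0 hu).
  - by apply: (integD mu mY); [exact: (integZ mu mY)|exact: (integ_cst mu mY)].
  - move=> r /sub Dr; have Xdur : X (du r) by case: sdu => -[+ _] _; exact.
    have := sip_young hB ts0 Xdur Xw; lra.
rewrite RintegralD//; last 2 first.
- exact: (integZ mu mY).
- exact: (integ_cst mu mY).
rewrite RintegralZl// Rintegral_cst//.
have : \int[mu]_(r in Y) B (du r) (du r) <= C.
  rewrite -lee_fin -(EFin_Rintegral mu mY iduY) -(EFin_Rintegral mu mD idu).
  by apply: ge0_le_integral_set => // r _; rewrite lee_fin (sip_ge0 hB).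
have : fine (mu Y) <= t - s.
  by rewrite -lee_fin fineK// ge0_fin_numE.
have Bw0 := sip_ge0 hB w.
move: (\int[mu]_(r in Y) _) => I; move: (fine (mu Y)) => m H1 H2 H3.
have H4 : (t - s)^-1 * B w w / 2 * m <= B w w / 2.
  apply: (@le_trans _ _ ((t - s)^-1 * B w w / 2 * (t - s))).
    by rewrite ler_wpM2l// divr_ge0// mulr_ge0// invr_ge0 ltW.
  by rewrite (_ : _ * _ = B w w / 2)//; field; rewrite gt_eqF.
have H5 : (t - s) / 2 * I <= (t - s) / 2 * C by rewrite ler_pM2l// divr_gt0.
lra.
Qed.

(** The projection onto [0, T]. It lets backward quotients reach before time 0, where they see the
    initial value. *)
Definition clamp (t : R) : R := Num.min T (Num.max 0 t).

Lemma clamp_itv t : clamp t \in `[0, T].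
Proof.
rewrite in_itv/= /clamp ge_min lexx/= andbT le_min ltW//= le_max lexx//.
Qed.

Lemma clamp_id t : t \in `[0, T] -> clamp t = t.
Proof. by rewrite in_itv/= => /andP[t0 tT]; rewrite /clamp max_r// min_r. Qed.

Lemma clamp_le s t : s <= t -> clamp s <= clamp t.
Proof. by move=> st; rewrite /clamp le_min2// le_max2. Qed.

Lemma clamp_lip s t : s <= t -> clamp t - clamp s <= t - s.
Proof.
move=> st; rewrite /clamp.
have : Num.max 0 t - Num.max 0 s <= t - s.
  by case: (leP 0 s) => s0; case: (leP 0 t) => t0; lra.
have : Num.max 0 s <= Num.max 0 t by rewrite le_max2.
move: (Num.max 0 s) (Num.max 0 t) => a b ab H.
by case: (leP T a) => Ta; case: (leP T b) => Tb; lra.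
Qed.

(** [wreg] asserts the measurability of the derivative only. That of the function follows from its
    Hoelder continuity, which shifting and clamping preserve. *)
Lemma smeas_wreg Z u du (h : R) : wreg X B T Z u du ->
  smeas X B E (fun t => u (clamp (t - h))).
Proof.
move=> hu; have [_ _ _ Xu _] := hu.
apply: (smeas_holder hB (C := \int[mu]_(r in E `\` Z) B (du r) (du r))) => //.
  by move=> t; apply: Xu; exact: clamp_itv.
have C0 : 0 <= \int[mu]_(r in E `\` Z) B (du r) (du r).
  by apply: Rintegral_ge0 => r _; exact: (sip_ge0 hB).
have H s t : s <= t -> B (u (clamp (t - h)) - u (clamp (s - h)))
   (u (clamp (t - h)) - u (clamp (s - h))) <=
   (\int[mu]_(r in E `\` Z) B (du r) (du r)) * (t - s).
  move=> st; have sth : s - h <= t - h by rewrite lerD2r.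
  have /andP[s0 _] := clamp_itv (s - h); have /andP[_ tT] := clamp_itv (t - h).
  rewrite !bnd_simp in s0 tT.
  apply: (le_trans (wreg_holder hu s0 (clamp_le sth) tT)).
  rewrite mulrC ler_wpM2l//; apply: (le_trans (clamp_lip sth)); lra.
move=> s t; have [st|ts] := leP s t.
  by rewrite ger0_norm ?subr_ge0//; exact: H.
rewrite ltr0_norm ?subr_lt0// opprB.
have := H _ _ (ltW ts); rewrite -(snorm_sqr hB) (snorm_distC hB); last 2 first.
- by apply: Xu; exact: clamp_itv.
- by apply: Xu; exact: clamp_itv.
by rewrite (snorm_sqr hB).
Qed.

Lemma smeas_wreg0 Z u du : wreg X B T Z u du -> smeas X B E u.
Proof.
move=> hu; apply: eq_smeas (smeas_wreg 0 hu) => t /= tE; rewrite subr0 clamp_id//.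
by move: tE; rewrite !in_itv/= => /andP[? ?]; rewrite !ltW.
Qed.

Definition dq n (u : R -> V) (t : R) : V :=
  n.+1%:R *: (u t - u (clamp (t - n.+1%:R^-1))).

Lemma smeas_dq n Z u du : wreg X B T Z u du -> smeas X B E (dq n u).
Proof.
move=> hu; apply: (smeasZ hB); apply: (smeasB hB).
  exact: smeas_wreg0 hu.
exact: smeas_wreg hu.
Qed.

Lemma wreg_bounded Z u du : wreg X B T Z u du ->
  exists C, forall t, t \in `[0, T] -> B (u t) (u t) <= C.
Proof.
move=> hu; have [_ _ _ Xu _] := hu.
exists (2 * (T * \int[mu]_(r in E `\` Z) B (du r) (du r)) + 2 * B (u 0) (u 0)).
move=> t tT; have := tT; rewrite in_itv/= => /andP[t0 tT'].
have T00 : 0 \in `[0, T] by rewrite in_itv/= lexx ltW.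
have := sip_sqrD hB (sip_domB hB (Xu t tT) (Xu 0 T00)) (Xu 0 T00).
rewrite subrK => /le_trans; apply; rewrite lerD2r ler_pM2l//.
apply: (le_trans (wreg_holder hu (lexx 0) t0 tT')).
rewrite subr0 ler_wpM2r//.
by apply: Rintegral_ge0 => r _; exact: (sip_ge0 hB).
Qed.

Lemma sqint_wreg Z u du : wreg X B T Z u du -> sqint X B E u.
Proof.
move=> hu; have [C uC] := wreg_bounded hu.
apply: (sqint_bounded hB (C := C)).
- exact: measurable_itv.
- by rewrite lebesgue_measure_itv/= lte_fin T0 ltry.
- exact: smeas_wreg0 hu.
- by move=> t /= tE; apply: uC; move: tE; rewrite !in_itv/= => /andP[? ?]; rewrite !ltW.
Qed.

Lemma sqint_dq n Z u du : wreg X B T Z u du -> sqint X B E (dq n u).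
Proof.
move=> hu; have [C uC] := wreg_bounded hu.
have mE : measurable E by exact: measurable_itv.
apply: (sqintZ hB) => //; apply: (sqintB hB) => //; first exact: sqint_wreg hu.
apply: (sqint_bounded hB (C := C)) => //.
- by rewrite lebesgue_measure_itv/= lte_fin T0 ltry.
- exact: smeas_wreg hu.
- by move=> t _; apply: uC; exact: clamp_itv.
Qed.

End difference_quotient.

Section difference_quotient_cvg.
Context (R : realType) (V : lmodType R) (X : set V) (B : V -> V -> R).
Hypothesis hB : semi_ip X B.
Context (T : R).
Hypothesis T0 : 0 < T.
Local Notation N := (snorm B).
Local Notation mu := (@lebesgue_measure R).
Local Notation E := (`]0, T[%classic : set R).

Definition ext (D : set R) (u : R -> V) (r : R) : V := \1_D r *: u r.

Lemma ext_in D u r : D r -> ext D u r = u r.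
Proof. by move=> Dr; rewrite /ext indicE mem_set// scale1r. Qed.

Lemma ext_out D u r : ~ D r -> ext D u r = 0.
Proof. by move=> Dr; rewrite /ext indicE memNset// scale0r. Qed.

Lemma sip00 : B 0 0 = 0.
Proof. by rewrite (sip0 hB)//; exact: (sip_dom0 hB). Qed.

Lemma smeas_ext D u : measurable D -> smeas X B D u -> smeas X B setT (ext D u).
Proof.
move=> mD [Xu [c hc uc]]; split=> [r _|].
  have [Dr|Dr] := pselect (D r); first by rewrite ext_in//; exact: Xu.
  by rewrite ext_out//; exact: (sip_dom0 hB).
exists (fun n => step_restr D (c n)) => [n|r _]; first exact: step_in_restr.
have [Dr|Dr] := pselect (D r).
  rewrite (_ : (fun n => _) = (fun n => N (u r - step_fun (c n) r))); first exact: uc.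
  apply/funext => n; by rewrite ext_in// step_fun_restr indicE mem_set// scale1r.
rewrite (_ : (fun n => _) = cst 0); first exact: cvg_cst.
apply/funext => n; rewrite ext_out// step_fun_restr indicE memNset// scale0r subrr.
by rewrite /snorm sip00 sqrtr0.
Qed.

Lemma sip_ext D u r : B (ext D u r) (ext D u r) = ((fun r => B (u r) (u r)) \_ D) r.
Proof.
rewrite patchE; case: ifPn => [|Dr]; first by rewrite inE => Dr; rewrite ext_in.
by rewrite ext_out ?sip00// => /mem_set; exact/negP.
Qed.

Lemma sqint_ext D u : measurable D -> sqint X B D u -> sqint X B setT (ext D u).
Proof.
move=> mD [su iu]; split; first exact: smeas_ext.
rewrite [ltLHS](_ : _ = (\int[mu]_(r in D) (B (u r) (u r))%:E)%E)//.
rewrite [RHS]integral_mkcond; apply: eq_integral => r _.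
by rewrite sip_ext !patchE; case: ifP.
Qed.

(** Pointwise approximations become dominated after they are set to zero wherever they are farther
    from [u] than zero is. The steps are also cut to [D], so that their indicators vanish outside
    the interval, as [osc_cvg] demands. *)
Lemma step_approx D u (e : R) : measurable D -> sqint X B D u -> 0 < e ->
  exists c, [/\ step_in X c, forall k : 'I_(step_size c), step_dom k `<=` D &
    (\int[mu]_r (B (ext D u r - step_fun c r) (ext D u r - step_fun c r))%:E <= e%:E)%E].
Proof.
move=> mD hu e0.
have [sv iv] := sqint_ext mD hu; set v := ext D u in sv iv *.
have [Xv [c hc vc]] := sv.
have mT : measurable [set: R] by exact: measurableT.
pose b n := [set r | N (v r - step_fun (c n) r) <= N (v r)] `&` D.
have sd n : smeas X B setT (fun r => v r - step_fun (c n) r).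
  by apply: (smeasB hB) => //; exact: (smeas_step hB).
have mb n : measurable (b n).
  apply: measurableI => //.
  have m1 := measurable_snorm hB mT (sd n).
  have m2 := measurable_snorm hB mT sv.
  rewrite (_ : [set r | _] = setT `&`
    (fun r => N (v r - step_fun (c n) r) <= N (v r)) @^-1` [set true]).
    exact: (measurable_fun_ler m1 m2 mT).
  by rewrite setTI; apply/seteqP; split => r.
pose c' n := step_restr (b n) (c n).
have hc' n : step_in X (c' n) by exact: (step_in_restr (mb n) (hc n)).
have Xd n r : X (v r - step_fun (c' n) r).
  by apply: (sip_domB hB); [exact: Xv|exact: (step_in_fun hB)].
have dle n r : N (v r - step_fun (c' n) r) <= N (v r) /\
    N (v r - step_fun (c' n) r) <= N (v r - step_fun (c n) r).
  rewrite step_fun_restr indicE; have [br|br] := pselect (b n r).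
    by rewrite mem_set// scale1r; split => //; case: br.
  rewrite memNset// scale0r subr0; split => //.
  have [Dr|Dr] := pselect (D r).
    by rewrite leNgt; apply/negP => /ltW H; apply: br; split.
  by rewrite /v ext_out// /snorm sip00 sqrtr0 sqrtr_ge0.
have lim : \int[mu]_(r in setT) B (v r - step_fun (c' n) r) (v r - step_fun (c' n) r)
    @[n --> \oo] --> \int[mu]_(r in [set: R]) (cst 0 : R -> R) r.
  apply: (@Rdominated_cvg _ _ _ mu setT _ _ (fun r => B (v r) (v r))) => //.
  - move=> n; apply: (measurable_sip hB) => //; apply: (smeasB hB) => //; exact: (smeas_step hB).
  - move=> r _; apply: (@squeeze_dist _ _ _ _ _ (fun n => N (v r - step_fun (c n) r) * N (v r - step_fun (c n) r))).
      apply: nearW => n; rewrite sub0r normrN ger0_norm ?(sip_ge0 hB)// -(snorm_sqr hB) expr2.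
      by have [_ H] := dle n r; apply: ler_pM => //; exact: snorm_ge0.
    by rewrite -(mulr0 0); apply: cvgM; exact: vc.
  - exact: (sqint_integrable2 hB).
  - move=> n r _; rewrite ger0_norm ?(sip_ge0 hB)// -!(snorm_sqr hB) !expr2.
    by have [H _] := dle n r; apply: ler_pM => //; exact: snorm_ge0.
have id n : mu.-integrable setT (EFin \o (fun r => B (v r - step_fun (c' n) r) (v r - step_fun (c' n) r))).
  apply: (sqint_integrable2 hB) => //; split.
    by apply: (smeasB hB) => //; exact: (smeas_step hB).
  apply: le_lt_trans iv; apply: ge0_le_integral_all => r _; rewrite lee_fin ?(sip_ge0 hB)//.
  rewrite -!(snorm_sqr hB) !expr2.
  by have [H _] := dle n r; apply: ler_pM => //; exact: snorm_ge0.
have int0 : \int[mu]_(r in [set: R]) (cst 0 : R -> R) r = 0.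
  by rewrite /Rintegral integral0.
rewrite int0 in lim; move/cvgrPdist_le : lim => /(_ e e0) [n _ /(_ n (leqnn n))] /=.
rewrite sub0r normrN ger0_norm; last by apply: Rintegral_ge0 => r _; exact: (sip_ge0 hB).
move=> He; exists (c' n); split => //.
  by move=> k r [_ []].
by rewrite (EFin_Rintegral mu mT (id n)) lee_fin.
Qed.

End difference_quotient_cvg.

Section difference_quotient_limit.
Context (R : realType) (V : lmodType R) (X : set V) (B : V -> V -> R).
Hypothesis hB : semi_ip X B.
Context (T : R).
Hypothesis T0 : 0 < T.
Local Notation N := (snorm B).
Local Notation mu := (@lebesgue_measure R).
Local Notation E := (`]0, T[%classic : set R).

(** After pairing with [w], the quotient is the backward window mean of the derivative. The clamp at
    0 on the left matches the extension by zero on the right. *)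
Lemma dq_integral n Z u du t w : wreg X B T Z u du -> E t -> X w ->
  B (dq T n u t) w = n.+1%:R * \int[mu]_(r in window n t) B (ext (E `\` Z) du r) w.
Proof.
move=> hu Et Xw; have [mZ Z0 sdu Xu u_int] := hu.
set h : R := n.+1%:R^-1; have h0 : 0 < h by rewrite invr_gt0.
have /andP[t0 tT] : 0 < t < T by move: Et; rewrite /= in_itv.
set s := clamp T (t - h).
have sT' : s \in `[0, T] := clamp_itv T0 (t - h).
have tT' : t \in `[0, T] by rewrite in_itv/= !ltW.
have s0 : 0 <= s by move: sT'; rewrite in_itv/= => /andP[].
have sE : s = Num.max 0 (t - h).
  by rewrite /s /clamp min_r// ge_max ltW//=; lra.
have st : s <= t by rewrite sE ge_max ltW//=; lra.
rewrite /dq -/h -/s (sipZ hB)//; last by apply: (sip_domB hB); exact: Xu.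
congr (_ * _); rewrite u_int//; last exact: ltW.
rewrite /Rintegral; congr fine; rewrite [LHS]integral_mkcond [RHS]integral_mkcond.
have m1 (x : R) : measurable [set x] by exact: measurable_set1.
have n1 (x : R) : mu [set x] = 0%E by exact: lebesgue_measure_set1.
(* The window is closed and the interval of [wreg] is open: their end points are discarded. *)
apply: (@eq_integral_null _ _ _ mu ([set t] `|` [set (t - h)])).
- exact: measurableU.
- exact: (etrans (@measureU0 _ _ _ mu _ _ (m1 t) (m1 (t - h)) (n1 (t - h))) (n1 t)).
move=> r _ /not_orP[/= rt rh]; rewrite !patchE.
have [rst|rst] := pselect ((`]s, t[ `\` Z) r).
  have := rst; rewrite /= in_itv/= => -[/andP[sr rt'] Zr].
  have Dr : (E `\` Z) r by split => //=; rewrite in_itv/=; apply/andP; split; lra.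
  have Wr : window n t r.
    rewrite /window/= in_itv/= (ltW rt') andbT.
    by move: sr; rewrite sE gt_max => /andP[_ /ltW].
  by rewrite (mem_set rst) (mem_set Wr) ext_in.
rewrite memNset//; case: ifPn => // /[1!inE]; rewrite /window/= in_itv/= -/h => /andP[r1 r2].
rewrite ext_out ?(sip0 hB)// => -[/=]; rewrite in_itv/= => /andP[r0 rT] Zr.
apply: rst; split => //=; rewrite in_itv/= sE gt_max r0/=.
rewrite !lt_neqAle r1 r2 !andbT; apply/andP; split; apply/eqP => // H.
by apply: rh; rewrite H.
Qed.

(** Jensen's inequality for the mean of [v r - v t]. That mean is accessible through pairings only,
    so the difference is paired with itself and Young's inequality absorbs half of its square. *)
Lemma dq_bound n Z u du t (D := E `\` Z) (v := ext D du) : wreg X B T Z u du -> D t ->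
  ((B (dq T n u t - du t) (dq T n u t - du t))%:E <=
   avg n (fun r => (B (v r - v t) (v r - v t))%:E) t)%E.
Proof.
move=> hu Dt; have [mZ Z0 sdu Xu u_int] := hu.
have mD : measurable D := measurable_domD T mZ.
have Et : E t by case: Dt.
have sv := sqint_ext hB mD sdu.
have Xv r : X (v r) by case: sv => -[+ _] _; exact.
have vt : v t = du t by rewrite /v ext_in.
have Xdq : X (dq T n u t) by case: (smeas_dq hB T0 n hu) => + _; exact.
set w := dq T n u t - du t.
have Xw : X w by apply: (sip_domB hB) => //; rewrite -vt.
set Y := window n t.
have mY : measurable Y := measurable_window n t.
have fY : (mu Y < +oo)%E.
  by rewrite [ltLHS](measure_window n t) ltry.
have svY : sqint X B Y v by apply: (sqintS hB _ sv).
have sc (x : V) : X x -> sqint X B Y (fun=> x).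
  by move=> Xx; apply: (sqint_bounded hB (C := B x x)) => //; exact: (smeas_cst hB).
have sd : sqint X B Y (fun r => v r - v t) by apply: (sqintB hB) => //; exact: sc.
pose A r := B (v r - v t) (v r - v t).
have iA : mu.-integrable Y (EFin \o A) by exact: (sqint_integrable2 hB).
have ivw : mu.-integrable Y (EFin \o (fun r => B (v r) w)).
  by apply: (sqint_integrable hB) => //; exact: sc.
have idw : mu.-integrable Y (EFin \o (fun r => B (v r - v t) w)).
  by apply: (sqint_integrable hB) => //; exact: sc.
have muY : fine (mu Y) = n.+1%:R^-1 by rewrite [X in fine X](measure_window n t).
have n0 : (n.+1%:R : R) != 0 by rewrite pnatr_eq0.
have H : B w w <= n.+1%:R * \int[mu]_(r in Y) (A r / 2 + B w w / 2).
  have Hw : B w w = n.+1%:R * \int[mu]_(r in Y) B (v r - v t) w.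
    rewrite {1}/w (sipB hB)//; last by rewrite -vt.
    rewrite (dq_integral n hu Et Xw) -/D -/v -vt.
    transitivity (n.+1%:R * (\int[mu]_(r in Y) B (v r) w - \int[mu]_(r in Y) B (v t) w)).
      rewrite Rintegral_cst// [X in _ * (_ - _ * X)]muY; field.
      by rewrite addrC natr1 n0.
    rewrite -RintegralB//; last exact: (integ_cst mu mY).
    by congr (_ * _); apply: eq_Rintegral => r _; rewrite (sipB hB).
  rewrite [leLHS]Hw ler_pM2l ?ltr0n//; apply: le_Rintegral => //.
    by apply: (integD mu mY); [|exact: (integ_cst mu mY)];
      apply: (eq_integ mu mY (fun r => 2^-1 * A r)) => [r _|]; [rewrite mulrC|exact: (integZ mu mY)].
  move=> r _; have := sip_young hB ltr01 (sip_domB hB (Xv r) (Xv t)) Xw.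
  by rewrite /A invr1 !mul1r -mulrDl.
rewrite /avg (EFin_Rintegral mu mY iA) -EFinM lee_fin.
move: H; rewrite RintegralD//; last 2 first.
- by apply: (eq_integ mu mY (fun r => 2^-1 * A r)) => [r _|]; [rewrite mulrC|exact: (integZ mu mY)].
- exact: (integ_cst mu mY).
have -> : \int[mu]_(r in Y) (A r / 2) = (\int[mu]_(r in Y) A r) / 2 by rewrite RintegralZr.
have -> : \int[mu]_(r in Y) (B w w / 2) = B w w / 2 * n.+1%:R^-1.
  by rewrite Rintegral_cst//; congr (_ * _); exact: muY.
move: (\int[mu]_(r in Y) A r) => I.
rewrite (_ : _ * (I / 2 + B w w / 2 * _) = n.+1%:R * I / 2 + B w w / 2); first by move=> H; lra.
by field; rewrite addrC natr1 n0.
Qed.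

(** Increments of indicators are at most one in absolute value, so one factor of the square is
    bounded by the sum of all norms. What remains is linear in the increments, the form in which
    [osc_cvg] controls them. *)
Lemma step_diff c r t : step_in X c ->
  B (step_fun c r - step_fun c t) (step_fun c r - step_fun c t) <=
  \sum_(k < step_size c) (\sum_(j < step_size c) N (step_val j)) * N (step_val k) *
     `|(\1_(step_dom k) r : R) - \1_(step_dom k) t|.
Proof.
move=> hc; rewrite -(snorm_sqr hB).
pose dl k : R := \1_(@step_dom _ _ c k) r - \1_(@step_dom _ _ c k) t.
have dl1 k : `|dl k| <= 1.
  by rewrite /dl !indicE; do 2 case: (_ \in _); rewrite ?subrr ?subr0 ?sub0r ?normrN ?normr0 ?normr1.
have Xk k : X (@step_val _ _ c k) by have [] := hc k.
have E1 : step_fun c r - step_fun c t = \sum_(k < step_size c) dl k *: step_val k.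
  by rewrite /step_fun -sumrB; apply: eq_bigr => k _; rewrite scalerBl.
have le_sum : N (step_fun c r - step_fun c t) <= \sum_(k < step_size c) `|dl k| * N (step_val k).
  rewrite E1.
  have [] : X (\sum_(k < step_size c) dl k *: step_val k) /\
     N (\sum_(k < step_size c) dl k *: step_val k) <= \sum_(k < step_size c) `|dl k| * N (step_val k).
    apply: (big_ind2 (fun x y => X x /\ N x <= y)).
    - by split; [exact: (sip_dom0 hB)|rewrite /snorm (sip00 hB) sqrtr0].
    - move=> x1 x2 y1 y2 [Xx1 h1] [Xy1 h2]; split; first exact: (sip_domD hB).
      by apply: (le_trans (snormD hB Xx1 Xy1)); exact: lerD.
    - by move=> k _; split; [exact: (sip_domZ hB)|rewrite (snormZ hB)].
  by [].
rewrite expr2; apply: (le_trans (ler_pM (snorm_ge0 _ _) (snorm_ge0 _ _) le_sum le_sum)).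
rewrite mulr_sumr; apply: ler_sum => k _.
rewrite -/(dl k) -[leRHS]mulrA [N (step_val k) * _]mulrC.
apply: ler_wpM2r; first by rewrite mulr_ge0// snorm_ge0.
apply: ler_sum => j _; rewrite -[leRHS]mul1r.
by apply: ler_wpM2r; [exact: snorm_ge0|exact: dl1].
Qed.

Lemma near_sum_le (I : Type) (s : seq I) (a : I -> R) (f : I -> nat -> \bar R) (e : R) :
  (forall i, 0 <= a i) -> (forall i n, 0 <= f i n)%E ->
  (forall i, f i n @[n --> \oo] --> 0%E) -> 0 < e ->
  \forall n \near \oo, (\sum_(i <- s) (a i)%:E * f i n <= e%:E)%E.
Proof.
move=> a0 f0 fcvg; elim: s e => [|i s IH] e e0.
  by apply: nearW => n; rewrite big_nil lee_fin ltW.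
have e2 : 0 < e / 2 by rewrite divr_gt0.
have ai : 0 < a i + 1 by rewrite ltr_wpDl.
have e3 : 0 < e / 2 / (a i + 1) by rewrite divr_gt0.
have := cvge0_near (f0 i) e3 (fcvg i); apply: filterS2 (IH _ e2) => n sn fn.
rewrite big_cons (_ : e = e / 2 + e / 2); last by field.
rewrite EFinD; apply: leeD => //.
apply: (@le_trans _ _ ((a i)%:E * (e / 2 / (a i + 1))%:E)%E).
  by apply: lee_wpmul2l => //; rewrite lee_fin.
by rewrite -EFinM lee_fin mulrCA ger_pMr// ler_pdivrMr// mul1r lerDl.
Qed.

(** The derivative is replaced by a step function [c], and [v r - v t] is split into the error at
    [r], the increment of [c] and the error at [t]. The averaged error is controlled by
    [integral_avg], the increment by the scalar oscillation of the indicators. *)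
Theorem dq_cvg Z u du : wreg X B T Z u du ->
  (\int[mu]_(t in E `\` Z) (B (dq T n u t - du t) (dq T n u t - du t))%:E)%E
    @[n --> \oo] --> 0%E.
Proof.
move=> hu; have [mZ Z0 sdu Xu u_int] := hu.
set D := E `\` Z; set v := ext D du.
have mD : measurable D := measurable_domD T mZ.
have mE : measurable E by exact: measurable_itv.
have mT : measurable [set: R] by exact: measurableT.
have fE : (mu E < +oo)%E by rewrite lebesgue_measure_itv/= lte_fin T0 ltry.
apply: near_cvge0 => [n|e e0].
  by apply: integral_ge0 => t _; rewrite lee_fin (sip_ge0 hB).
(* The three contributions will be 2, 1 and 4 times [e / 8]. *)
have e8 : 0 < e / 8 by rewrite divr_gt0.
have [c [hc cD cK]] := step_approx hB mD sdu e8; rewrite -/v in cK.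
have sv := sqint_ext hB mD sdu.
have Xv r : X (v r) by case: sv => -[+ _] _; exact.
have Xc r : X (step_fun c r) by exact: (step_in_fun hB).
pose K r := B (v r - step_fun c r) (v r - step_fun c r).
have sK : smeas X B setT (fun r => v r - step_fun c r).
  by apply: (smeasB hB); [case: sv|exact: (smeas_step hB)].
have mK : measurable_fun [set: R] (fun r => (K r)%:E).
  by apply/measurable_EFinP; exact: (measurable_sip hB).
have K0 r : (0 <= (K r)%:E)%E by rewrite lee_fin (sip_ge0 hB).
(* The 4 comes from applying [sip_sqrD] twice to the sum of three terms. *)
pose a k : R := 4 * ((\sum_(j < step_size c) N (step_val j)) * N (@step_val _ _ c k)).
have a0 k : 0 <= a k.
  by rewrite /a !mulr_ge0 ?snorm_ge0 ?sumr_ge0// => j _; exact: snorm_ge0.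
pose g k : R -> R := \1_(@step_dom _ _ c k).
have mg k : measurable_fun [set: R] (g k).
  by apply: measurable_indic; have [] := hc k.
have oscg k : (\int[mu]_(t in E) osc n (g k) t)%E @[n --> \oo] --> 0%E.
  apply: osc_cvg => //.
    apply: (integ_bounded mu mE 1); last by move=> t _; rewrite /g indicE; case: (_ \in _); rewrite ?normr1 ?normr0.
      exact: fE.
    by apply: measurable_funTS; exact: mg.
  by move=> t Et; rewrite /g indicE memNset// => /cD[].
have og0 k n : (0 <= \int[mu]_(t in E) osc n (g k) t)%E.
  by apply: integral_ge0 => t _; exact: osc_ge0.
have := near_sum_le (index_enum 'I_(step_size c)) a0 og0 oscg e8.
apply: filterS => n sum_e.
have mavgK : measurable_fun [set: R] (avg n (fun r => (K r)%:E)).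
  apply: (@measurable_avg2 _ n (fun _ r => (K r)%:E)) => //.
  exact: (measurableT_comp mK measurable_snd).
pose H t : \bar R := (2%:E * avg n (fun r => (K r)%:E) t +
  (\sum_k (a k)%:E * osc n (g k) t + 4%:E * (K t)%:E))%E.
have bound t : D t ->
    ((B (dq T n u t - du t) (dq T n u t - du t))%:E <= H t)%E.
  move=> Dt; apply: (le_trans (dq_bound n hu Dt)); rewrite -/D -/v.
  have mosc k : measurable_fun [set: R] (fun r => `|g k r - g k t|%:E).
    by apply/measurable_EFinP; apply: measurableT_comp => //; exact: measurable_funB.
  have mak k : measurable_fun [set: R] (fun r => (a k)%:E * `|g k r - g k t|%:E)%E.
    exact: measurable_funeM.
  have ak0 k r : (0 <= (a k)%:E * `|g k r - g k t|%:E)%E.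
    by rewrite mule_ge0// lee_fin.
  have -> : H t = avg n (fun r => (2%:E * (K r)%:E +
      (\sum_k (a k)%:E * `|g k r - g k t|%:E + (4 * K t)%:E)))%E t.
    rewrite avgD//; last 4 first.
    - by move=> r; apply: mule_ge0.
    - by move=> r; apply: adde_ge0; [exact: sume_ge0|rewrite lee_fin mulr_ge0// -lee_fin].
    - exact: measurable_funeM.
    - apply: emeasurable_funD; last exact: measurable_cst.
      by apply: emeasurable_sum => k; exact: mak.
    rewrite avgZ// avgD//; last 3 first.
    - by move=> r; exact: sume_ge0.
    - by move=> r; rewrite lee_fin mulr_ge0// -lee_fin.
    - by apply: emeasurable_sum => k; exact: mak.
    rewrite avg_sum// avg_cst; last by rewrite mulr_ge0// -lee_fin.
    rewrite /H -EFinM; congr (_ + (_ + _))%E; apply: eq_bigr => k _.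
    by rewrite avgZ.
  apply: le_avg => r; first by rewrite lee_fin (sip_ge0 hB).
  move=> _; under eq_bigr do rewrite -EFinM.
  rewrite sumEFin -!EFinM -!EFinD lee_fin.
  have Xvc := sip_domB hB (Xv r) (Xc r); have Xcc := sip_domB hB (Xc r) (Xc t).
  have Xcv := sip_domB hB (Xc t) (Xv t).
  have -> : v r - v t = (v r - step_fun c r) + ((step_fun c r - step_fun c t) + (step_fun c t - v t)).
    by rewrite !subrKA.
  apply: (le_trans (sip_sqrD hB Xvc (sip_domD hB Xcc Xcv))).
  rewrite lerD2l; have := sip_sqrD hB Xcc Xcv.
  have -> : B (step_fun c t - v t) (step_fun c t - v t) = K t.
    by rewrite -(snorm_sqr hB) (snorm_distC hB)// (snorm_sqr hB).
  have := step_diff r t hc.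
  have -> : \sum_k a k * `|g k r - g k t| = 4 * \sum_(k < step_size c) (\sum_(j < step_size c) N (step_val j)) * N (step_val k) *
     `|(\1_(step_dom k) r : R) - \1_(step_dom k) t|.
    by rewrite mulr_sumr; apply: eq_bigr => k _; rewrite /a -!mulrA.
  lra.
apply: (@le_trans _ _ (\int[mu]_(t in D) H t)%E).
  by apply: ge0_le_integral_all => t Dt; [rewrite lee_fin (sip_ge0 hB)|exact: bound].
have avg0 t : (0 <= avg n (fun r => (K r)%:E) t)%E by exact: avg_ge0.
have so0 t : (0 <= \sum_k (a k)%:E * osc n (g k) t)%E.
  by apply: sume_ge0 => k _; apply: mule_ge0; [rewrite lee_fin|exact: osc_ge0].
have mso : measurable_fun [set: R] (fun t => \sum_k (a k)%:E * osc n (g k) t)%E.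
  by apply: emeasurable_sum => k; apply: measurable_funeM; exact: measurable_osc.
have m2 : measurable_fun [set: R] (fun t => 2%:E * avg n (fun r => (K r)%:E) t)%E.
  exact: measurable_funeM.
have m4 : measurable_fun [set: R] (fun t => 4%:E * (K t)%:E)%E by exact: measurable_funeM.
rewrite ge0_integralD//; last 4 first.
- by move=> t _; apply: mule_ge0.
- exact: measurable_funTS.
- by move=> t _; apply: adde_ge0 => //; apply: mule_ge0.
- by apply: emeasurable_funD; exact: measurable_funTS.
rewrite ge0_integralD//; last 3 first.
- exact: measurable_funTS.
- by move=> t _; apply: mule_ge0.
- exact: measurable_funTS.
have i2 : (\int[mu]_(t in D) (2%:E * avg n (fun r => (K r)%:E) t) <= (2 * (e / 8))%:E)%E.
  apply: (@le_trans _ _ (\int[mu]_t (2%:E * avg n (fun r => (K r)%:E) t))%E).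
    by apply: ge0_le_integral_set => // t _; apply: mule_ge0.
  by rewrite ge0_integralZl_EFin// integral_avg// EFinM lee_wpmul2l.
have i4 : (\int[mu]_(t in D) (4%:E * (K t)%:E) <= (4 * (e / 8))%:E)%E.
  apply: (@le_trans _ _ (\int[mu]_t (4%:E * (K t)%:E))%E).
    by apply: ge0_le_integral_set => // t _; apply: mule_ge0.
  by rewrite ge0_integralZl_EFin// EFinM lee_wpmul2l.
have i3 : (\int[mu]_(t in D) (\sum_k (a k)%:E * osc n (g k) t) <= (e / 8)%:E)%E.
  apply: le_trans sum_e.
  apply: (@le_trans _ _ (\int[mu]_(t in E) (\sum_k (a k)%:E * osc n (g k) t))%E).
    by apply: ge0_le_integral_set => //; exact: subDsetl.
  rewrite ge0_integral_sum//; last 2 first.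
  - by move=> k; apply: measurable_funTS; apply: measurable_funeM; exact: measurable_osc.
  - by move=> k t _; apply: mule_ge0; [rewrite lee_fin|exact: osc_ge0].
  apply: lee_sum => k _; rewrite ge0_integralZl_EFin//.
  - by move=> t _; exact: osc_ge0.
  - by apply: measurable_funTS; exact: measurable_osc.
apply: (le_trans (leeD i2 (leeD i3 i4))).
by rewrite -!EFinD lee_fin; lra.
Qed.

End difference_quotient_limit.

(** * Energy estimate *)

Section energy.
Context (R : realType) (T : R).
Hypothesis T0 : 0 < T.
Local Notation mu := (@lebesgue_measure R).
Local Notation E := (`]0, T[%classic : set R).

Lemma derivable_left_quotient (P : R -> R) (x l : R) :
  derivable P x 1 -> derive1 P x = l ->
  n.+1%:R * (P x - P (x - n.+1%:R^-1)) @[n --> \oo] --> l.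
Proof.
move=> dP Pl.
have c : h^-1 *: (P (h *: (1 : R) + x) - P x) @[h --> (0 : R)^'] --> l.
  by rewrite -Pl derive1E; exact: dP.
have h_cvg : (- n.+1%:R^-1 : R) @[n --> \oo] --> (0 : R)^'.
  move=> A; rewrite /dnbhs/within/= => /nbhs_ballP[e /= e0 He].
  have [N _ HN] := near_infty_natSinv_lt (PosNum e0).
  exists N => // n /= Nn; apply: He; last by rewrite oppr_eq0 invr_eq0 pnatr_eq0.
  rewrite /ball/= sub0r opprK gtr0_norm ?invr_gt0//.
  exact: (HN n Nn).
have := cvg_comp _ _ h_cvg c; apply: cvg_trans.
rewrite (_ : _ \o _ = (fun n => n.+1%:R * (P x - P (x - n.+1%:R^-1))))//.
apply/funext => n /=; rewrite -[_ *: 1]/(_ * _) mulr1 -[_ *: _]/(_ * _).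
by rewrite invrN invrK mulNr -mulrN opprB (addrC _ x).
Qed.

(** Integrated over ]0, tau[, the differences of the extension by zero of [En] telescope: the
    shifted integral cancels all but the last window. The case [t <= h] is a difference with the
    value zero of the extension. *)
Lemma window_energy (Z : set R) (En : R -> R) (g : R -> R) (h tau : R) (D := E `\` Z) :
  measurable Z -> mu Z = 0%E -> 0 < h -> 0 < tau -> tau <= T ->
  mu.-integrable D (EFin \o En) -> mu.-integrable D (EFin \o g) ->
  (forall t, D t -> 0 <= En t) ->
  (forall t, D t -> t <= h -> h^-1 * En t <= g t) ->
  (forall t, D t -> D (t - h) -> h^-1 * (En t - En (t - h)) <= g t) ->
  h^-1 * \int[mu]_(t in `]tau - h, tau]) ((En \_ D) t) <=
    \int[mu]_(t in `]0, tau[ `\` Z) g t.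
Proof.
move=> mZ Z0 h0 tau0 tauT iEn ig En0 En_le En_dif.
have mD : measurable D := measurable_domD T mZ.
pose Eb := En \_ D.
have Eb0 t : 0 <= Eb t by rewrite /Eb patchE; case: ifPn => //; rewrite inE => /En0.
have mEb : measurable_fun [set: R] Eb.
  by apply: (iffLR (measurable_restrictT _ mD)); exact: integ_measurable iEn.
have iEb : mu.-integrable setT (EFin \o Eb).
  have := iffLR (@integrable_mkcond _ _ _ mu D (EFin \o En) mD) iEn.
  by apply: eq_integrable => // t _; rewrite /Eb /= !patchE; case: ifP.
have iEbh : mu.-integrable setT (EFin \o (fun t => Eb (t - h))).
  apply: (ge0_integ mu).
  - apply: (measurableT_comp mEb); exact: measurable_funB.
  - by move=> t _; exact: Eb0.
  - rewrite (@ge0_integral_shift R h (EFin \o Eb)).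
    + exact: (integ_lty mu measurableT iEb).
    + exact/measurable_EFinP.
    + by move=> t; rewrite lee_fin.
(* Removing the shifted null set as well makes both [t] and [t - h] good times. *)
pose Zh := [set t | Z (t - h)].
have [mZh Zh0] : measurable Zh /\ mu Zh = 0%E := null_shift h mZ Z0.
pose I0 : set R := `]0, tau[%classic.
have mI0 : measurable I0 by exact: measurable_itv.
pose Y := I0 `\` (Z `|` Zh).
have mN : measurable (Z `|` Zh) by exact: measurableU.
have N0 : mu (Z `|` Zh) = 0%E.
  exact: (etrans (@measureU0 _ _ _ mu _ _ mZ mZh Zh0) Z0).
have mY : measurable Y by exact: measurableD.
have YD : Y `<=` D.
  move=> t [+ /not_orP[Zt _]]; rewrite /I0/= in_itv/= => /andP[t0 tt]; split => //=.
  by rewrite in_itv/= t0 (lt_le_trans tt).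
have -> : \int[mu]_(t in I0 `\` Z) g t = \int[mu]_(t in Y) g t.
  by rewrite /Rintegral (@integral_null_setD _ _ _ mu _ _ _ mZh Zh0) setDDl.
have iEbY (A : set R) : measurable A -> mu.-integrable A (EFin \o Eb).
  by move=> mA; exact: (@integrableS _ _ _ mu _ _ _ measurableT mA (@subsetT _ A) iEb).
have iEbhY (A : set R) : measurable A -> mu.-integrable A (EFin \o (fun t => Eb (t - h))).
  by move=> mA; exact: (@integrableS _ _ _ mu _ _ _ measurableT mA (@subsetT _ A) iEbh).
have igY : mu.-integrable Y (EFin \o g).
  exact: (@integrableS _ _ _ mu _ _ _ mD mY YD ig).
apply: (@le_trans _ _ (\int[mu]_(t in Y) (h^-1 * (Eb t - Eb (t - h))))); last first.
  apply: le_Rintegral => //.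
    by apply: (integZ mu mY); apply: (integB mu mY); [exact: iEbY|exact: iEbhY].
  move=> t Yt; have Dt := YD t Yt.
  have EbE s : D s -> Eb s = En s by move=> Ds; rewrite /Eb patchE mem_set.
  have [th|ht] := leP t h.
    rewrite EbE// (_ : Eb (t - h) = 0) ?subr0; first exact: En_le.
    rewrite /Eb patchE memNset// => -[/=]; rewrite in_itv/= => /andP[+ _] _.
    by rewrite subr_gt0 ltNge th.
  have Dth : D (t - h).
    move: Yt => [+ /not_orP[_ Zt]]; rewrite /I0/= in_itv/= => /andP[t0 tt]; split => //=.
    by rewrite in_itv/= subr_gt0 ht/=; lra.
  by rewrite !EbE//; exact: En_dif.
rewrite RintegralZl//; last by apply: (integB mu mY); [exact: iEbY|exact: iEbhY].
rewrite ler_pM2l ?invr_gt0// RintegralB//; [|exact: iEbY|exact: iEbhY].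
rewrite lerBrDr.
have mW : measurable (`]tau - h, tau]%classic : set R) by exact: measurable_itv.
rewrite -lee_fin EFinD -(EFin_Rintegral mu mW (iEbY _ mW)).
rewrite -(EFin_Rintegral mu mY (iEbhY _ mY)) -(EFin_Rintegral mu mY (iEbY _ mY)).
rewrite /Y -!(@integral_null_setD _ _ _ mu _ I0 _ mN N0).
pose J : set R := `](- h), (tau - h)[%classic.
have mJ : measurable J by exact: measurable_itv.
have -> : (\int[mu]_(t in I0) (Eb (t - h))%:E = \int[mu]_(t in J) (Eb t)%:E)%E.
  rewrite [LHS]integral_mkcond [RHS]integral_mkcond.
  rewrite -(@ge0_integral_shift R h ((fun t => (Eb t)%:E) \_ J)).
  - apply: eq_integral => t _; rewrite !patchE.
    rewrite (_ : (t - h \in J) = (t \in I0))//.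
    apply/idP/idP; rewrite !inE /J /I0 /= !in_itv/= => /andP[? ?]; apply/andP; split; lra.
  - apply: (iffLR (measurable_restrictT _ mJ)); apply/measurable_EFinP.
    exact: measurable_funTS.
  - by move=> t; rewrite patchE; case: ifP => // _; rewrite lee_fin.
rewrite integral_mkcond [X in (_ + X <= _)%E]integral_mkcond [X in (_ <= X)%E]integral_mkcond.
have p0 (A : set R) t : (0 <= ((fun t => (Eb t)%:E) \_ A) t)%E.
  by rewrite patchE; case: ifP => // _; rewrite lee_fin.
have mp (A : set R) : measurable A -> measurable_fun setT ((fun t => (Eb t)%:E) \_ A).
  move=> mA; apply: (iffLR (measurable_restrictT _ mA)); apply/measurable_EFinP.
  exact: measurable_funTS.
rewrite -ge0_integralD//; [|exact: mp|exact: mp].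
have m1 : measurable [set tau] by exact: measurable_set1.
have n1 : mu [set tau] = 0%E by exact: lebesgue_measure_set1.
(* The last window contains [tau], the interval ]0, tau[ does not. *)
apply: (@ge0_le_integral_null _ _ _ mu [set tau]) => //.
  by move=> t; apply: adde_ge0.
move=> t ttau; rewrite !patchE.
have Eb_neg : t <= 0 -> Eb t = 0.
  move=> t0; rewrite /Eb patchE memNset// => -[/=]; rewrite in_itv/= => /andP[+ _] _.
  by rewrite ltNge t0.
case: ifPn => [|_].
  rewrite inE/= in_itv/= => /andP[t1 t2].
  rewrite memNset ?adde0; last by rewrite /J/= in_itv/= (ltNge t) (ltW t1) andbF.
  case: ifPn => // tI; rewrite Eb_neg// leNgt; apply/negP => t0.
  move/negP : tI; apply; rewrite inE /I0/= in_itv/= t0/= lt_neqAle t2 andbT.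
  by apply/eqP => H; apply: ttau.
rewrite add0e; case: ifPn => [|_]; last by case: ifP => // _; rewrite lee_fin.
rewrite inE /J/= in_itv/= => /andP[t1 t2].
case: ifPn => // tI; rewrite Eb_neg// leNgt; apply/negP => t0.
by move/negP : tI; apply; rewrite inE /I0/= in_itv/= t0/=; lra.
Qed.

(** The window means of [En] are left difference quotients of its primitive, which converge to [En]
    almost everywhere by Lebesgue's theorem. The nonnegativity of [G] holds at every [tau],
    including T, because it uses the windows and not their limit. *)
Lemma energy_limit (Z : set R) (En : R -> R) (g : nat -> R -> R) (G : R -> R)
    (D := E `\` Z) :
  measurable Z -> mu Z = 0%E ->
  mu.-integrable D (EFin \o En) -> (forall n, mu.-integrable D (EFin \o g n)) ->
  (forall t, D t -> 0 <= En t) ->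
  (forall n t, D t -> t <= n.+1%:R^-1 -> n.+1%:R * En t <= g n t) ->
  (forall n t, D t -> D (t - n.+1%:R^-1) ->
    n.+1%:R * (En t - En (t - n.+1%:R^-1)) <= g n t) ->
  (forall tau, 0 < tau -> tau <= T ->
    \int[mu]_(t in `]0, tau[ `\` Z) g n t @[n --> \oo] --> G tau) ->
  (forall tau, 0 < tau -> tau <= T -> 0 <= G tau) /\
  {ae mu, forall t, E t -> En t <= G t}.
Proof.
move=> mZ Z0 iEn ig En0 En_le En_dif gG.
have mD : measurable D := measurable_domD T mZ.
pose Eb := En \_ D.
have Eb0 t : 0 <= Eb t by rewrite /Eb patchE; case: ifPn => //; rewrite inE => /En0.
have win n tau : 0 < tau -> tau <= T ->
    n.+1%:R * \int[mu]_(t in `]tau - n.+1%:R^-1, tau]) Eb t <=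
    \int[mu]_(t in `]0, tau[ `\` Z) g n t.
  move=> tau0 tauT; rewrite -{1}(invrK (n.+1%:R : R)).
  apply: window_energy => //.
  - by move=> t Dt th; rewrite invrK; exact: En_le.
  - by move=> t Dt Dth; rewrite invrK; exact: En_dif.
split=> [tau tau0 tauT|].
  apply: (@ler_cvg_to _ _ _ _ (cst 0) _ _ _ (cvg_cst _) (gG tau tau0 tauT)).
  apply: nearW => n; apply: le_trans (win n tau tau0 tauT).
  by rewrite mulr_ge0// Rintegral_ge0.
have iEb : mu.-integrable setT (EFin \o Eb).
  have := iffLR (@integrable_mkcond _ _ _ mu D (EFin \o En) mD) iEn.
  by apply: eq_integrable => // t _; rewrite /Eb /= !patchE; case: ifP.
have iEbA (A : set R) : measurable A -> mu.-integrable A (EFin \o Eb).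
  by move=> mA; exact: (@integrableS _ _ _ mu _ _ _ measurableT mA (@subsetT _ A) iEb).
pose P x := \int[mu]_(t in `]-oo, x]) Eb t.
have [N1 [mN1 N10 subN1]] : {ae mu, forall x, derivable P x 1 /\ derive1 P x = Eb x}.
  apply: FTC1Ny; first by move=> y; apply: iEbA; exact: measurable_itv.
  exact: integrable_locally_restrict.
exists (N1 `|` Z); split.
- exact: measurableU.
- exact: (etrans (@measureU0 _ _ _ mu _ _ mN1 mZ Z0) N10).
move=> tau /= H; apply: contrapT => /not_orP[N1tau Ztau]; apply: H => Etau.
have [dP Ptau] : derivable P tau 1 /\ derive1 P tau = Eb tau.
  by apply: contrapT => H; apply: N1tau; exact: subN1.
have /andP[tau0 tauT] : 0 < tau < T by move: Etau; rewrite /= in_itv.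
have -> : En tau = Eb tau by rewrite /Eb patchE mem_set.
apply: (ler_cvg_to (derivable_left_quotient dP Ptau) (gG tau tau0 (ltW tauT))).
apply: nearW => n; apply: le_trans (win n tau tau0 (ltW tauT)).
rewrite /P Rintegral_itvB ?bnd_simp ?gerBl ?invr_ge0//.
by apply: iEbA; exact: measurable_itv.
Qed.

End energy.

Section abstract_estimates.
Context (R : realType) (V : lmodType R) (X : set V) (B : V -> V -> R).
Hypothesis hB : semi_ip X B.
Context (T : R).
Hypothesis T0 : 0 < T.
Local Notation N := (snorm B).
Local Notation mu := (@lebesgue_measure R).
Local Notation E := (`]0, T[%classic : set R).

Lemma sqint_dqB n Z u du : wreg X B T Z u du ->
  sqint X B (E `\` Z) (fun t => dq T n u t - du t).
Proof.
move=> hu; have [mZ Z0 sdu Xu u_int] := hu.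
have mD := measurable_domD T mZ.
apply: (sqintB hB) => //.
by apply: (sqintS hB _ (sqint_dq hB T0 n hu)); exact: subDsetl.
Qed.

Lemma dq_pair_cvg Z u du F (Y : set R) : wreg X B T Z u du ->
  sqint X B (E `\` Z) F -> measurable Y -> Y `<=` E `\` Z ->
  \int[mu]_(t in Y) B (F t) (dq T n u t) @[n --> \oo] --> \int[mu]_(t in Y) B (F t) (du t).
Proof.
move=> hu sF mY YD; have [mZ Z0 sdu Xu u_int] := hu.
have mD := measurable_domD T mZ.
have sFY : sqint X B Y F := sqintS hB YD sF.
have sduY : sqint X B Y du := sqintS hB YD sdu.
have sd n : sqint X B Y (fun t => dq T n u t - du t) := sqintS hB YD (sqint_dqB n hu).
have sdq n : sqint X B Y (dq T n u).
  apply: (sqintS hB _ (sqint_dq hB T0 n hu)) => t /YD; exact: subDsetl.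
have XF t : Y t -> X (F t) by case: sFY => -[+ _] _; exact.
have Xdu t : Y t -> X (du t) by case: sduY => -[+ _] _; exact.
have Xdq n t : Y t -> X (dq T n u t) by case: (sdq n) => -[+ _] _; exact.
have iFF := sqint_integrable2 hB mY sFY.
pose C := \int[mu]_(t in Y) B (F t) (F t).
have C0 : 0 <= C by apply: Rintegral_ge0 => t _; exact: (sip_ge0 hB).
pose q n := \int[mu]_(t in Y) B (dq T n u t - du t) (dq T n u t - du t).
have qe n : (\int[mu]_(t in Y) (B (dq T n u t - du t) (dq T n u t - du t))%:E)%E = (q n)%:E.
  by rewrite (EFin_Rintegral mu mY)//; exact: (sqint_integrable2 hB).
apply/cvgrPdist_le => e e0.
have C1 : 0 < C + 1 by rewrite ltr_wpDl.
(* With this Young weight the term in [F] is at most [e / 2], even when C = 0; the other term then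
   needs the error to be at most [e * dl]. *)
pose dl := e / (C + 1).
have dl0 : 0 < dl by rewrite divr_gt0.
have e2 : 0 < e * dl by rewrite mulr_gt0.
have int0 n : (0 <= \int[mu]_(t in E `\` Z) (B (dq T n u t - du t) (dq T n u t - du t))%:E)%E.
  by apply: integral_ge0 => t _; rewrite lee_fin (sip_ge0 hB).
have := cvge0_near int0 e2 (dq_cvg hB T0 hu); apply: filterS => n Hn.
have {Hn}qn : q n <= e * dl.
  rewrite -lee_fin -qe; apply: le_trans Hn; apply: ge0_le_integral_set => // t _.
  by rewrite lee_fin (sip_ge0 hB).
rewrite distrC -RintegralB//; [|exact: (sqint_integrable hB)..].
have -> : \int[mu]_(t in Y) (B (F t) (dq T n u t) - B (F t) (du t)) =
    \int[mu]_(t in Y) B (F t) (dq T n u t - du t).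
  by apply: eq_Rintegral => t; rewrite inE => Yt; rewrite (sipBr hB)//; [exact: Xdq|exact: Xdu|exact: XF].
have iFd := sqint_integrable hB mY sFY (sd n).
apply: (le_trans (@le_normr_Rintegral _ _ _ mu _ _ mY iFd)).
apply: (@le_trans _ _ (\int[mu]_(t in Y) (dl / 2 * B (F t) (F t) +
    dl^-1 / 2 * B (dq T n u t - du t) (dq T n u t - du t)))).
  apply: le_Rintegral => //.
  - exact: integrable_norm iFd.
  - apply: (integD mu mY); first exact: (integZ mu mY).
    by apply: (integZ mu mY); exact: (sqint_integrable2 hB).
  - move=> t Yt; have XFt := XF t Yt; have Xd := sip_domB hB (Xdq n t Yt) (Xdu t Yt).
    have := sip_young hB dl0 XFt Xd; have := sip_young hB dl0 (sip_domN hB XFt) Xd.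
    rewrite (sipNr hB)//; last exact: (sip_domN hB).
    rewrite !(sipN hB)// opprK => H1 H2; rewrite ler_norml; apply/andP; split; lra.
rewrite RintegralD//; last 2 first.
- exact: (integZ mu mY).
- by apply: (integZ mu mY); exact: (sqint_integrable2 hB).
rewrite !RintegralZl//; last exact: (sqint_integrable2 hB).
rewrite -/C -/(q n).
have H1 : dl / 2 * C <= e / 2.
  rewrite /dl mulrAC ler_pM2r ?invr_gt0// mulrAC ler_pdivrMr// ler_pM2l// lerDl//.
have H2 : dl^-1 / 2 * q n <= e / 2.
  rewrite mulrAC ler_pM2r ?invr_gt0// mulrC ler_pdivrMr//.
lra.
Qed.

(** The square of the quotient is |dq - du|^2 + 2 (du, dq) - |du|^2: the first term tends to 0 and
    the cross term converges by [dq_pair_cvg]. *)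
Lemma dq_sqr_cvg Z u du : wreg X B T Z u du ->
  \int[mu]_(t in E `\` Z) B (dq T n u t) (dq T n u t) @[n --> \oo] -->
  \int[mu]_(t in E `\` Z) B (du t) (du t).
Proof.
move=> hu; have [mZ Z0 sdu Xu u_int] := hu.
set D := E `\` Z.
have mD : measurable D := measurable_domD T mZ.
have sd n : sqint X B D (fun t => dq T n u t - du t) := sqint_dqB n hu.
have sdq n : sqint X B D (dq T n u).
  by apply: (sqintS hB _ (sqint_dq hB T0 n hu)); exact: subDsetl.
have Xdu t : D t -> X (du t) by case: sdu => -[+ _] _; exact.
have Xdq n t : D t -> X (dq T n u t) by case: (sdq n) => -[+ _] _; exact.
have iq n := sqint_integrable2 hB mD (sd n).
have idu := sqint_integrable2 hB mD sdu.
have ix n := sqint_integrable hB mD sdu (sdq n).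
have E1 n : \int[mu]_(t in D) B (dq T n u t) (dq T n u t) =
   \int[mu]_(t in D) B (dq T n u t - du t) (dq T n u t - du t) +
   (2 * \int[mu]_(t in D) B (du t) (dq T n u t) - \int[mu]_(t in D) B (du t) (du t)).
  rewrite -RintegralZl// -RintegralB//; last exact: (integZ mu mD).
  rewrite -RintegralD//; last by apply: (integB mu mD) => //; exact: (integZ mu mD).
  apply: eq_Rintegral => t; rewrite inE => Dt.
  have a := Xdq n t Dt; have b := Xdu t Dt; have c := sip_domB hB a b.
  by rewrite (sipB hB)// !(sipBr hB)// (sipC hB (dq T n u t) (du t)); ring.
rewrite (_ : (fun n => _) = (fun n => \int[mu]_(t in D) B (dq T n u t - du t) (dq T n u t - du t) +
   (2 * \int[mu]_(t in D) B (du t) (dq T n u t) - \int[mu]_(t in D) B (du t) (du t)))); last first.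
  by apply/funext => n; exact: E1.
rewrite [X in _ --> X](_ : _ = 0 + (2 * \int[mu]_(t in D) B (du t) (du t) - \int[mu]_(t in D) B (du t) (du t))); last by ring.
apply: cvgD; first exact: (fine_cvg (dq_cvg hB T0 hu)).
apply: cvgB; last exact: cvg_cst.
by apply: cvgMl_tmp; exact: (dq_pair_cvg hu sdu mD (@subset_refl _ D)).
Qed.

(** The inequality passes to difference quotients, then to their limits. The alternative [s = 0]
    covers the quotients that are clamped at the initial time. *)
Lemma wreg_le Z u du v dv (k : R) : wreg X B T Z u du -> wreg X B T Z v dv -> 0 <= k ->
  (forall t s, (E `\` Z) t -> (E `\` Z) s \/ s = 0 ->
     k * B (u t - u s) (u t - u s) <= B (v t - v s) (v t - v s)) ->
  k * \int[mu]_(t in E `\` Z) B (du t) (du t) <= \int[mu]_(t in E `\` Z) B (dv t) (dv t).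
Proof.
move=> hu hv k0 uv; have [mZ Z0 sdu Xu u_int] := hu; have [_ _ sdv Xv v_int] := hv.
set D := E `\` Z.
have mD : measurable D := measurable_domD T mZ.
have sdq w dw n : wreg X B T Z w dw -> sqint X B D (dq T n w).
  by move=> hw; apply: (sqintS hB _ (sqint_dq hB T0 n hw)); exact: subDsetl.
have lim1 : k * \int[mu]_(t in D) B (dq T n u t) (dq T n u t) @[n --> \oo] -->
    k * \int[mu]_(t in D) B (du t) (du t).
  by apply: cvgMl_tmp; exact: dq_sqr_cvg hu.
apply: (ler_cvg_to lim1 (dq_sqr_cvg hv)).
apply: nearW => n.
pose Zh := [set t | Z (t - n.+1%:R^-1)].
have [mZh Zh0] : measurable Zh /\ mu Zh = 0%E := null_shift _ mZ Z0.
have iu : mu.-integrable D (EFin \o (fun t => B (dq T n u t) (dq T n u t))).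
  by apply: (sqint_integrable2 hB) => //; exact: sdq hu.
have iv : mu.-integrable D (EFin \o (fun t => B (dq T n v t) (dq T n v t))).
  by apply: (sqint_integrable2 hB) => //; exact: sdq hv.
rewrite -RintegralZl// -lee_fin -(EFin_Rintegral mu mD iv).
rewrite -(EFin_Rintegral mu mD (integZ mu mD k iu)).
rewrite (@integral_null_setD _ _ _ mu _ _ _ mZh Zh0).
rewrite [leRHS](@integral_null_setD _ _ _ mu _ _ _ mZh Zh0).
apply: ge0_le_integral_all => t [Dt Zht]; rewrite lee_fin.
  by rewrite mulr_ge0// (sip_ge0 hB).
have Xw w dw s : wreg X B T Z w dw -> X (w (clamp T s)).
  by move=> [_ _ _ Xw _]; apply: Xw; exact: clamp_itv.
have Xwt w dw : wreg X B T Z w dw -> X (w t).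
  move=> [_ _ _ Xw' _]; apply: Xw'; case: Dt => /= + _.
  by rewrite !in_itv/= => /andP[? ?]; rewrite !ltW.
have Xd w dw : wreg X B T Z w dw -> X (w t - w (clamp T (t - n.+1%:R^-1))).
  by move=> hw; apply: (sip_domB hB); [exact: Xwt hw|exact: Xw hw].
have q w dw : wreg X B T Z w dw -> B (dq T n w t) (dq T n w t) = n.+1%:R ^+ 2 *
   B (w t - w (clamp T (t - n.+1%:R^-1))) (w t - w (clamp T (t - n.+1%:R^-1))).
  move=> hw; have Xdw := Xd _ _ hw; rewrite /dq (sipZ hB)// ?(sipZr hB)//; last exact: (sip_domZ hB).
  by rewrite mulrA expr2.
rewrite (q u du)// (q v dv)// mulrCA ler_pM2l ?exprn_gt0//.
apply: uv => //; have [/= + _] := Dt; rewrite in_itv/= => /andP[t0 tT].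
have [th|ht] := leP (t - n.+1%:R^-1) 0; [right|left].
  by rewrite /clamp max_l// min_r// ltW.
have hn : 0 < n.+1%:R^-1 :> R by rewrite invr_gt0.
have thT : t - n.+1%:R^-1 < T by rewrite (le_lt_trans _ tT)// gerBl ltW.
rewrite clamp_id; last by rewrite in_itv/= !ltW.
by split => //=; rewrite in_itv/= ht thT.
Qed.

Lemma sip_null u w : X u -> X w -> B u u = 0 -> B w u = 0.
Proof.
move=> Xu Xw uu; apply/eqP; rewrite -normr_le0.
apply: (le_trans (sip_cauchy_schwarz_norm hB Xw Xu)).
by rewrite /snorm uu sqrtr0 mulr0.
Qed.

(* The bound on the increments of [En] replaces a time derivative of [En], which
   need not exist. *)
Lemma energy_estimate Z (phi dphi psi dpsi eta : R -> V) (En : R -> R)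
    (al be la c1 c2 b0 : R) (D := E `\` Z)
    (F1 := fun t => (al / la) *: eta t - (c1 + al ^+ 2 / la) *: dphi t
                    - (al * be / la - b0) *: dpsi t)
    (F2 := fun t => (be / la) *: eta t - (c2 + be ^+ 2 / la) *: dpsi t
                    - (al * be / la - b0) *: dphi t)
    (sig := fun t => al *: dphi t + be *: dpsi t) :
  0 < la -> 0 <= b0 -> b0 <= c1 -> b0 <= c2 ->
  wreg X B T Z phi dphi -> wreg X B T Z psi dpsi -> sqint X B D eta ->
  B (phi 0) (phi 0) = 0 -> B (psi 0) (psi 0) = 0 ->
  (forall t, D t -> 0 <= En t) ->
  (forall t, D t -> En t = B (F1 t) (phi t) + B (F2 t) (psi t)) ->
  (forall t s, D t -> D s ->
    En t - En s <= 2 * (B (F1 t) (phi t - phi s) + B (F2 t) (psi t - psi s))) ->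
  \int[mu]_(t in D) B (sig t) (sig t) <= \int[mu]_(t in D) B (eta t) (eta t) /\
  {ae mu, forall t, E t -> En t <= la^-1 * \int[mu]_(t in D) B (eta t) (eta t)}.
Proof.
move=> la0 b00 bc1 bc2 hphi hpsi seta phi0 psi0 En0 EnE En_dif.
have [mZ Z0 sdphi Xphi _] := hphi; have [_ _ sdpsi Xpsi _] := hpsi.
have mD : measurable D := measurable_domD T mZ.
have sF1 : sqint X B D F1.
  by apply: (sqintB hB) => //; [apply: (sqintB hB) => //|]; exact: (sqintZ hB).
have sF2 : sqint X B D F2.
  by apply: (sqintB hB) => //; [apply: (sqintB hB) => //|]; exact: (sqintZ hB).
have ssig : sqint X B D sig by apply: (sqintD hB) => //; exact: (sqintZ hB).
have sub0 w dw : wreg X B T Z w dw -> sqint X B D w.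
  by move=> hw; apply: (sqintS hB _ (sqint_wreg hB T0 hw)); exact: subDsetl.
have sdq w dw n : wreg X B T Z w dw -> sqint X B D (dq T n w).
  by move=> hw; apply: (sqintS hB _ (sqint_dq hB T0 n hw)); exact: subDsetl.
have DT t : D t -> t \in `[0, T].
  by move=> [/= + _]; rewrite !in_itv/= => /andP[? ?]; rewrite !ltW.
have T00 : 0 \in `[0, T] by rewrite in_itv/= lexx ltW.
have XF1 t : D t -> X (F1 t) by case: sF1 => -[+ _] _; exact.
have XF2 t : D t -> X (F2 t) by case: sF2 => -[+ _] _; exact.
pose g n t := 2 * (B (F1 t) (dq T n phi t) + B (F2 t) (dq T n psi t)).
pose G tau := \int[mu]_(t in `]0, tau[ `\` Z) (2 * (B (F1 t) (dphi t) + B (F2 t) (dpsi t))).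
have iEn : mu.-integrable D (EFin \o En).
  apply: (eq_integ mu mD (fun t => B (F1 t) (phi t) + B (F2 t) (psi t))).
    by move=> t Dt; rewrite EnE.
  by apply: (integD mu mD); apply: (sqint_integrable hB) => //; [exact: sub0 hphi|exact: sub0 hpsi].
have ig n : mu.-integrable D (EFin \o g n).
  apply: (integZ mu mD); apply: (integD mu mD); apply: (sqint_integrable hB) => //.
    exact: sdq hphi.
  exact: sdq hpsi.
have iG : mu.-integrable D (EFin \o (fun t => 2 * (B (F1 t) (dphi t) + B (F2 t) (dpsi t)))).
  by apply: (integZ mu mD); apply: (integD mu mD); exact: (sqint_integrable hB).
(* In the first window the quotients compare with the null initial values, so [g n t] is twice the
   left side, which is nonnegative. *)
have En_le n t : D t -> t <= n.+1%:R^-1 -> n.+1%:R * En t <= g n t.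
  move=> Dt th; have XF1t := XF1 t Dt; have XF2t := XF2 t Dt.
  have dqE w dw F : wreg X B T Z w dw -> B (w 0) (w 0) = 0 -> X F ->
      B F (dq T n w t) = n.+1%:R * B F (w t).
    move=> [_ _ _ Xw _] w0 XF.
    have c0 : clamp T (t - n.+1%:R^-1) = 0.
      have tn : t - n.+1%:R^-1 <= 0 by rewrite subr_le0.
      by rewrite /clamp max_l// min_r// ltW.
    have X0 := Xw 0 T00; have Xt := Xw t (DT t Dt).
    rewrite /dq c0 (sipZr hB)//; last exact: (sip_domB hB).
    by rewrite (sipBr hB)// (sip_null X0 XF w0) subr0.
  rewrite /g (dqE _ _ _ hphi)// (dqE _ _ _ hpsi)// -mulrDr -EnE//.
  rewrite mulrCA ler_pM2l ?ltr0n//; have := En0 t Dt; lra.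
have En_dif' n t : D t -> D (t - n.+1%:R^-1) ->
    n.+1%:R * (En t - En (t - n.+1%:R^-1)) <= g n t.
  move=> Dt Ds; have XF1t := XF1 t Dt; have XF2t := XF2 t Dt.
  rewrite /g /dq !clamp_id; [|exact: DT..].
  rewrite !(sipZr hB)//; [|by apply: (sip_domB hB); [apply: Xpsi|apply: Xpsi]; exact: DT
    |by apply: (sip_domB hB); [apply: Xphi|apply: Xphi]; exact: DT].
  by rewrite -mulrDr mulrCA ler_pM2l ?ltr0n//; exact: En_dif.
have gG tau : 0 < tau -> tau <= T ->
    \int[mu]_(t in `]0, tau[ `\` Z) g n t @[n --> \oo] --> G tau.
  move=> tau0 tauT; set Y := _ `\` Z.
  have mY : measurable Y by apply: measurableD.
  have YD : Y `<=` D := sub_domD (lexx 0) tauT.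
  have i1 n : mu.-integrable Y (EFin \o (fun t => B (F1 t) (dq T n phi t))).
    by apply: (sqint_integrable hB) => //; apply: (sqintS hB YD) => //; exact: sdq hphi.
  have i2 n : mu.-integrable Y (EFin \o (fun t => B (F2 t) (dq T n psi t))).
    by apply: (sqint_integrable hB) => //; apply: (sqintS hB YD) => //; exact: sdq hpsi.
  have j1 : mu.-integrable Y (EFin \o (fun t => B (F1 t) (dphi t))).
    by apply: (sqint_integrable hB) => //; exact: (sqintS hB YD).
  have j2 : mu.-integrable Y (EFin \o (fun t => B (F2 t) (dpsi t))).
    by apply: (sqint_integrable hB) => //; exact: (sqintS hB YD).
  rewrite (_ : (fun n => _) = (fun n => 2 * (\int[mu]_(t in Y) B (F1 t) (dq T n phi t) +
     \int[mu]_(t in Y) B (F2 t) (dq T n psi t)))); last first.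
    apply/funext => n; rewrite /g RintegralZl//; last exact: (integD mu mY).
    by rewrite RintegralD.
  rewrite /G -/Y RintegralZl//; last exact: (integD mu mY).
  rewrite RintegralD//; apply: cvgMl_tmp; apply: cvgD.
    exact: (dq_pair_cvg hphi sF1 mY YD).
  exact: (dq_pair_cvg hpsi sF2 mY YD).
have [G0 EnG] := energy_limit mZ Z0 iEn ig En0 En_le En_dif' gG.
(* The left side is (2 / la) (eta, sig) minus twice the sum of |sig|^2 / la, b0 |dphi - dpsi|^2, (c1
   - b0) |dphi|^2 and (c2 - b0) |dpsi|^2. The last three are nonnegative, and 2 (eta, sig) <=
   |eta|^2 + |sig|^2. *)
have pt t : D t -> 2 * (B (F1 t) (dphi t) + B (F2 t) (dpsi t)) <=
    la^-1 * (B (eta t) (eta t) - B (sig t) (sig t)).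
  move=> Dt.
  have Xe : X (eta t) by case: seta => -[+ _] _; exact.
  have Xp : X (dphi t) by case: sdphi => -[+ _] _; exact.
  have Xs : X (dpsi t) by case: sdpsi => -[+ _] _; exact.
  have Xsig : X (sig t) by case: ssig => -[+ _] _; exact.
  have Z1 (a : R) v : X v -> X (a *: v) by exact: (sip_domZ hB).
  have XF1' := XF1 t Dt; have XF2' := XF2 t Dt.
  have e1 : B (F1 t) (dphi t) = al / la * B (eta t) (dphi t)
      - (c1 + al ^+ 2 / la) * B (dphi t) (dphi t) - (al * be / la - b0) * B (dpsi t) (dphi t).
    rewrite /F1 !(sipB hB)//; try by [exact: Z1|apply: (sip_domB hB); exact: Z1].
    by rewrite !(sipZ hB).
  have e2 : B (F2 t) (dpsi t) = be / la * B (eta t) (dpsi t)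
      - (c2 + be ^+ 2 / la) * B (dpsi t) (dpsi t) - (al * be / la - b0) * B (dphi t) (dpsi t).
    rewrite /F2 !(sipB hB)//; try by [exact: Z1|apply: (sip_domB hB); exact: Z1].
    by rewrite !(sipZ hB).
  have e3 : B (eta t) (sig t) = al * B (eta t) (dphi t) + be * B (eta t) (dpsi t).
    by rewrite /sig (sipDr hB)//; try exact: Z1; rewrite !(sipZr hB).
  have e4 := sip_quad hB al be Xp Xs; rewrite -/(sig t) in e4.
  have e5 := sip_quad hB 1 (-1) Xp Xs.
  have e6 := sip_young hB ltr01 Xe Xsig.
  rewrite e1 e2 (sipC hB (dpsi t) (dphi t)).
  rewrite e3 in e6.
  have e7 := sip_ge0 hB (1 *: dphi t + (-1) *: dpsi t); rewrite e5 in e7.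
  have pp := sip_ge0 hB (dphi t); have ss := sip_ge0 hB (dpsi t).
  rewrite invr1 !mul1r in e6; rewrite e4.
  rewrite e4 in e6.
  have h1 : 0 <= b0 * (1 ^+ 2 * B (dphi t) (dphi t) + 2 * 1 * -1 * B (dphi t) (dpsi t) +
     (-1) ^+ 2 * B (dpsi t) (dpsi t)) by exact: mulr_ge0.
  have h2 : 0 <= (c1 - b0) * B (dphi t) (dphi t) by rewrite mulr_ge0// subr_ge0.
  have h3 : 0 <= (c2 - b0) * B (dpsi t) (dpsi t) by rewrite mulr_ge0// subr_ge0.
  have lV : 0 < la^-1 by rewrite invr_gt0.
  have h4 := ler_wpM2l (ltW lV) e6.
  move: (B (eta t) (eta t)) (B (dphi t) (dphi t)) (B (dpsi t) (dpsi t)) (B (dphi t) (dpsi t))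
    (B (eta t) (dphi t)) (B (eta t) (dpsi t)) h1 h2 h3 h4 => ee p2 s2 ps ep es h1 h2 h3 h4.
  move: (la^-1) lV h4 => li lV h4.
  lra.
have ieta := sqint_integrable2 hB mD seta.
have isig := sqint_integrable2 hB mD ssig.
have li0 : 0 <= la^-1 by rewrite invr_ge0 ltW.
have GT tau : 0 < tau -> tau <= T -> G tau <= la^-1 *
    (\int[mu]_(t in `]0, tau[ `\` Z) B (eta t) (eta t) - \int[mu]_(t in `]0, tau[ `\` Z) B (sig t) (sig t)).
  move=> tau0 tauT; rewrite /G; set Y := _ `\` Z.
  have mY : measurable Y by apply: measurableD.
  have YD : Y `<=` D := sub_domD (lexx 0) tauT.
  have iS (f : R -> R) : mu.-integrable D (EFin \o f) -> mu.-integrable Y (EFin \o f).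
    by exact: (@integrableS _ _ _ mu _ _ _ mD mY YD).
  rewrite -RintegralB//; [|exact: iS..]; rewrite -RintegralZl//; last by apply: (integB mu mY); exact: iS.
  apply: le_Rintegral => //; first exact: iS.
    by apply: (integZ mu mY); apply: (integB mu mY); exact: iS.
  by move=> t /YD; exact: pt.
split.
  (* The first estimate is the nonnegativity of [G] at the final time. *)
  have := le_trans (G0 T T0 (lexx T)) (GT T T0 (lexx T)); rewrite -/D.
  by rewrite pmulr_rge0 ?invr_gt0// subr_ge0.
have [N1 [mN1 N10 subN1]] := EnG.
exists N1; split => // t /= H; apply: subN1 => /= H2; apply: H => Et.
have /andP[t0 tT] : 0 < t < T by move: Et; rewrite /= in_itv.
apply: (le_trans (H2 Et)); apply: (le_trans (GT t t0 (ltW tT))).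
set Y := _ `\` Z.
have mY : measurable Y by apply: measurableD.
have YD : Y `<=` D := sub_domD (lexx 0) (ltW tT).
have iY : mu.-integrable Y (EFin \o (fun t => B (eta t) (eta t))).
  exact: (@integrableS _ _ _ mu _ _ _ mD mY YD ieta).
rewrite ler_wpM2l// lerBlDr (@le_trans _ _ (\int[mu]_(t in D) B (eta t) (eta t)))//.
  rewrite -lee_fin -(EFin_Rintegral mu mY iY) -(EFin_Rintegral mu mD ieta).
  by apply: ge0_le_integral_set => // s _; rewrite lee_fin (sip_ge0 hB).
by rewrite lerDl; apply: Rintegral_ge0 => s _; exact: (sip_ge0 hB).
Qed.

End abstract_estimates.

(** * The spaces of the problem *)

Section rV_borel.
Context (R : realType) (d : nat).
Local Notation E := 'rV[R]_d.

Definition box (c : E) (r : R) : set E := [set x | forall i, `|x 0 i - c 0 i| < r].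

Lemma measurable_box c r : measurable (box c r).
Proof.
rewrite (_ : box c r = ~` \bigcup_(i : 'I_d) [set x : E | r <= `|x 0 i - c 0 i|]).
  apply: measurableC; apply: countable_bigcupT_measurable => // i.
  have m : measurable_fun [set: E] (fun x : E => `|x 0 i - c 0 i|).
    apply: measurableT_comp => //; apply: measurable_funB => //.
    exact: measurable_rV_coord.
  rewrite (_ : [set x : E | _] = setT `&` (fun x : E => `|x 0 i - c 0 i|) @^-1` `[r, +oo[%classic).
    by apply: m => //; exact: measurable_itv.
  by rewrite setTI; apply/seteqP; split => x /=; rewrite in_itv/= andbT.
apply/seteqP; split => x.
  by move=> xb [i _ /=]; rewrite leNgt xb.
by move=> xb i; rewrite ltNge; apply/negP => H; apply: xb; exists i.
Qed.

(** An open set is the countable union of the boxes with rational centre and radius 1 / (n + 1) that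
    it contains, and boxes are measurable for the product sigma-algebra. *)
Lemma open_measurable_rV (U : set E) : open U -> measurable U.
Proof.
move=> oU.
pose q2r (q : 'rV[rat]_d) : E := map_mx ratr q.
pose F (p : 'rV[rat]_d * nat) : set E := [set x | box (q2r p.1) p.2.+1%:R^-1 x /\
   box (q2r p.1) p.2.+1%:R^-1 `<=` U].
rewrite (_ : U = \bigcup_p F p).
  apply: countable_bigcupT_measurable => //.
  move=> p; have [bU|bU] := pselect (box (q2r p.1) p.2.+1%:R^-1 `<=` U).
    rewrite (_ : F p = box (q2r p.1) p.2.+1%:R^-1); first exact: measurable_box.
    by apply/seteqP; split => x; [case|move=> xb; split].
  rewrite (_ : F p = set0)//; first by apply/seteqP; split => // x [_ /bU].
apply/seteqP; split => x; last by move=> [p _ [xp]]; exact.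
move=> Ux; have : nbhs x U by exact: open_nbhs_nbhs.
move=> /nbhs_ballP[e /= e0 Ue].
(* Half of the radius for the distance from [x] to the rational centre, half for the box around that
   centre. *)
have e2 : 0 < e / 2 by rewrite divr_gt0.
have [n _ Hn] := near_infty_natSinv_lt (PosNum e2).
have {Hn} := Hn n (leqnn n).
have : 0 < n.+1%:R^-1 :> R by rewrite invr_gt0.
rewrite /=; set h : R := n.+1%:R^-1 => h0 Hn.
have qx i : exists q : rat, `|ratr q - x 0 i| < h.
  have lt : x 0 i - h < x 0 i + h by lra.
  have [q] := rat_in_itvoo lt; rewrite in_itv/= => /andP[q1 q2]; exists q.
  by rewrite ltr_norml; apply/andP; split; lra.
have [q Hq] := choice qx.
exists (\row_i q i, n) => //; split => /=.
  by move=> i; rewrite !mxE distrC.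
move=> y yb; apply: Ue; split => // i j; rewrite (ord1 i).
have := yb j; rewrite !mxE => yj; rewrite /ball/=.
have -> : x 0 j - y 0 j = - (ratr (q j) - x 0 j) - (y 0 j - ratr (q j)) by ring.
apply: (le_lt_trans (ler_normB _ _)); rewrite normrN.
have := Hq j; move: yj; rewrite /= -/h; lra.
Qed.

Lemma continuous_measurable_rV (D : set E) (f : E -> R) : measurable D ->
  continuous f -> measurable_fun D f.
Proof.
move=> mD cf; apply: measurable_funTS.
apply: (measurability _ (RGenOInfty.measurableE R)) => /= _ [_ [a ->] <-].
apply: measurableI => //; apply: open_measurable_rV.
by apply: open_comp => // x _; exact: cf.
Qed.

End rV_borel.

(** * Semi-inner products derived from others *)

Section semi_ip_constructions.
Context (R : realType).

Lemma semi_ip_pull (V V' : lmodType R) (L : V -> V') (X : set V') (B : V' -> V' -> R) :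
  (forall u v, L (u + v) = L u + L v) -> (forall (a : R) u, L (a *: u) = a *: L u) ->
  semi_ip X B -> semi_ip [set v | X (L v)] (fun u v => B (L u) (L v)).
Proof.
move=> LD LZ hB; split => //=.
- by rewrite -(scale0r (0 : V)) LZ scale0r; exact: (sip_dom0 hB).
- by move=> u v Xu Xv; rewrite LD; exact: (sip_domD hB).
- by move=> a u Xu; rewrite LZ; exact: (sip_domZ hB).
- by move=> u v; rewrite (sipC hB).
- by move=> u v w Xu Xv Xw; rewrite LD (sipD hB).
- by move=> a u w Xu Xw; rewrite LZ (sipZ hB).
- by move=> u; exact: (sip_ge0 hB).
Qed.

Lemma semi_ip_add (V : lmodType R) (X X' : set V) (B B' : V -> V -> R) :
  semi_ip X B -> semi_ip X' B' ->
  semi_ip [set v | X v /\ X' v] (fun u v => B u v + B' u v).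
Proof.
move=> hB hB'; split => //=.
- by split; [exact: (sip_dom0 hB)|exact: (sip_dom0 hB')].
- by move=> u v [? ?] [? ?]; split; [exact: (sip_domD hB)|exact: (sip_domD hB')].
- by move=> a u [? ?]; split; [exact: (sip_domZ hB)|exact: (sip_domZ hB')].
- by move=> u v; rewrite (sipC hB) (sipC hB').
- by move=> u v w [? ?] [? ?] [? ?]; rewrite (sipD hB)// (sipD hB')// addrACA.
- by move=> a u w [? ?] [? ?]; rewrite (sipZ hB)// (sipZ hB')// mulrDr.
- by move=> u; rewrite addr_ge0// ?(sip_ge0 hB)// (sip_ge0 hB').
Qed.

Lemma semi_ip_sum (V : lmodType R) (I : finType) (X : I -> set V)
    (B : I -> V -> V -> R) :
  (forall i, semi_ip (X i) (B i)) ->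
  semi_ip [set v | forall i, X i v] (fun u v => \sum_i B i u v).
Proof.
move=> hB; split => /=.
- by move=> i; exact: (sip_dom0 (hB i)).
- by move=> u v Xu Xv i; exact: (sip_domD (hB i)).
- by move=> a u Xu i; exact: (sip_domZ (hB i)).
- by move=> u v; apply: eq_bigr => i _; rewrite (sipC (hB i)).
- by move=> u v w Xu Xv Xw; rewrite -big_split; apply: eq_bigr => i _; exact: (sipD (hB i)).
- by move=> a u w Xu Xw; rewrite mulr_sumr; apply: eq_bigr => i _; exact: (sipZ (hB i)).
- by move=> u; apply: sumr_ge0 => i _; exact: (sip_ge0 (hB i)).
Qed.

Lemma semi_ip_sub (V : lmodType R) (X X' : set V) (B : V -> V -> R) :
  semi_ip X B -> X' `<=` X -> X' 0 ->
  (forall u v, X' u -> X' v -> X' (u + v)) -> (forall (a : R) u, X' u -> X' (a *: u)) ->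
  semi_ip X' B.
Proof.
move=> hB XX X0 XD XZ; split => //.
- by move=> u v; exact: (sipC hB).
- by move=> u v w /XX ? /XX ? /XX ?; exact: (sipD hB).
- by move=> a u w /XX ? /XX ?; exact: (sipZ hB).
- by move=> u; exact: (sip_ge0 hB).
Qed.

End semi_ip_constructions.

Section lebesgue_sobolev.
Context (R : realType) (d : nat) (Omega : set 'rV[R]_d).
Hypothesis mO : measurable Omega.
Local Notation E := 'rV[R]_d.
Local Notation leb := (lebesgue_rV R d).
Local Notation W := (L2 Omega).

Lemma L2_sqr f : W f -> leb.-integrable Omega (EFin \o (fun x => f x ^+ 2)).
Proof.
move=> [mf fi]; apply: (ge0_integ leb) => //.
  by apply: measurable_funX.
by move=> x _; exact: sqr_ge0.
Qed.

Lemma L2_prod f g : W f -> W g -> leb.-integrable Omega (EFin \o (fun x => f x * g x)).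
Proof.
move=> hf hg; have [mf _] := hf; have [mg _] := hg.
apply: (le_integ leb mO (fun x => f x ^+ 2 + g x ^+ 2)).
- exact: measurable_funM.
- move=> x _; rewrite ler_norml; have := sqr_ge0 (f x + g x); have := sqr_ge0 (f x - g x).
  by rewrite sqrrB sqrrD => *; apply/andP; split; nra.
- by apply: (integD leb mO); exact: L2_sqr.
Qed.

Lemma L2_le (f g : E -> R) : measurable_fun Omega f -> (forall x, Omega x -> f x ^+ 2 <= g x) ->
  leb.-integrable Omega (EFin \o g) -> W f.
Proof.
move=> mf fg ig; split => //; apply: le_lt_trans (integ_lty leb mO ig).
by apply: ge0_le_integral_all => x Ox; rewrite lee_fin ?sqr_ge0// fg.
Qed.

Lemma semi_ip_L2 : semi_ip W (ip Omega).
Proof.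
split.
- split; first exact: measurable_cst.
  by rewrite integral0_eq// => x _; rewrite expr0n.
- move=> f g hf hg; have [mf _] := hf; have [mg _] := hg.
  apply: (@L2_le _ (fun x => 2 * f x ^+ 2 + 2 * g x ^+ 2)).
  + exact: measurable_funD.
  + move=> x _; rewrite -[(f + g) x]/(f x + g x); have := sqr_ge0 (f x - g x).
    by rewrite sqrrB sqrrD; lra.
  + by apply: (integD leb mO); apply: (integZ leb mO); exact: L2_sqr.
- move=> a f hf; have [mf _] := hf.
  apply: (@L2_le _ (fun x => a ^+ 2 * f x ^+ 2)).
  + exact: measurable_funM.
  + by move=> x _; rewrite -[(a *: f) x]/(a * f x) exprMn.
  + by apply: (integZ leb mO); exact: L2_sqr.
- by move=> f g; apply: eq_Rintegral => x _; rewrite mulrC.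
- move=> f g h hf hg hh; rewrite /ip -RintegralD//; [|exact: L2_prod..].
  by apply: eq_Rintegral => x _; rewrite -mulrDl.
- move=> a f h hf hh; rewrite /ip -RintegralZl//; last exact: L2_prod.
  by apply: eq_Rintegral => x _; rewrite mulrA.
- by move=> f; apply: Rintegral_ge0 => x _; rewrite -expr2 sqr_ge0.
Qed.

(** The pairs with square-integrable components, without the relation between function and gradient:
    all that the bilinearity of the H^1 form needs. *)
Definition hdom : set (hfun R d) := [set v | W v.1 /\ forall i, W (v.2 i)].

Lemma semi_ip_grad : semi_ip [set v : hfun R d | forall i, W (v.2 i)] (ip_grad Omega).
Proof.
apply: (@semi_ip_sum _ _ _ (fun i v => W (v.2 i)) (fun i v w => ip Omega (v.2 i) (w.2 i))).
by move=> i; apply: (@semi_ip_pull _ _ _ (fun v : hfun R d => v.2 i)) => //; exact: semi_ip_L2.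
Qed.

Lemma semi_ip_H1 : semi_ip hdom (fun v w => ip Omega v.1 w.1 + ip_grad Omega v w).
Proof.
apply: semi_ip_add; last exact: semi_ip_grad.
by apply: (@semi_ip_pull _ _ _ (fun v : hfun R d => v.1)) => //; exact: semi_ip_L2.
Qed.

Definition vdom : set (hvec R d) := [set u | forall k, hdom (u k)].

Lemma semi_ip_H1v : semi_ip vdom
  (fun u v => ipv Omega (hval u) (hval v) + \sum_(k < d) ip_grad Omega (u k) (v k)).
Proof.
have hval_ip : semi_ip [set u : hvec R d | forall k, W (u k).1]
    (fun u v => ipv Omega (hval u) (hval v)).
  apply: (@semi_ip_sum _ _ _ (fun k u => W (u k).1) (fun k u v => ip Omega (u k).1 (v k).1)).
  by move=> k; apply: (@semi_ip_pull _ _ _ (fun u : hvec R d => (u k).1)) => //; exact: semi_ip_L2.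
have grad_ip : semi_ip [set u : hvec R d | forall k i, W ((u k).2 i)]
    (fun u v => \sum_(k < d) ip_grad Omega (u k) (v k)).
  apply: (@semi_ip_sum _ _ _ (fun k u => forall i, W ((u k).2 i)) (fun k u v => ip_grad Omega (u k) (v k))).
  move=> k; apply: (@semi_ip_pull _ _ _ (fun u : hvec R d => u k)
    [set v : hfun R d | forall i, W (v.2 i)] (ip_grad Omega)) => //.
  exact: semi_ip_grad.
have := semi_ip_add hval_ip grad_ip; congr semi_ip.
apply/seteqP; split => u /=.
  by move=> [u1 u2] k; split; [exact: u1|exact: u2].
by move=> uk; split => [k|k i]; have [] := uk k.
Qed.

Lemma eps_in u i j : vdom u -> W (eps u i j).
Proof.
move=> hu; apply: (sip_domZ semi_ip_L2); apply: (sip_domD semi_ip_L2).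
  by have [_] := hu i; exact.
by have [_] := hu j; exact.
Qed.

Lemma divg_in u : vdom u -> W (divg u).
Proof.
by move=> hu; apply: (sip_dom_sum semi_ip_L2) => k _; have [_] := hu k; exact.
Qed.

Lemma semi_ip_eps : semi_ip vdom (ip_eps Omega).
Proof.
have := @semi_ip_sum _ _ _ (fun i u => forall j, W (eps u i j))
  (fun i u v => \sum_(j < d) ip Omega (eps u i j) (eps v i j)).
have pull i : semi_ip [set u : hvec R d | forall j, W (eps u i j)]
   (fun u v => \sum_(j < d) ip Omega (eps u i j) (eps v i j)).
  apply: (@semi_ip_sum _ _ _ (fun j u => W (eps u i j)) (fun j u v => ip Omega (eps u i j) (eps v i j))).
  move=> j; apply: (@semi_ip_pull _ _ _ (fun u : hvec R d => eps u i j)); last exact: semi_ip_L2.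
    by move=> u v; rewrite /eps -scalerDr; congr (_ *: _); exact: addrACA.
  by move=> a u; rewrite /eps scalerA mulrC -scalerA; congr (_ *: _); rewrite scalerDr.
move=> /(_ pull) H; apply: (semi_ip_sub H).
- by move=> u hu i j; exact: eps_in.
- exact: (sip_dom0 semi_ip_H1v).
- by move=> u v; exact: (sip_domD semi_ip_H1v).
- by move=> a u; exact: (sip_domZ semi_ip_H1v).
Qed.

(** The square of a half sum is at most the half sum of the squares; exchanging the two indices then
    restores the full gradient. *)
Lemma ip_eps_le_grad u : vdom u ->
  ip_eps Omega u u <= \sum_(k < d) ip_grad Omega (u k) (u k).
Proof.
move=> hu; rewrite /ip_eps /ip_grad.
have Wu i j : W ((u i).2 j) by have [_] := hu i; exact.
apply: (@le_trans _ _ (\sum_(i < d) \sum_(j < d)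
    (ip Omega ((u i).2 j) ((u i).2 j) / 2 + ip Omega ((u j).2 i) ((u j).2 i) / 2))).
  apply: ler_sum => i _; apply: ler_sum => j _.
  have Wij := sip_domD semi_ip_L2 (Wu i j) (Wu j i).
  rewrite /eps (sipZ semi_ip_L2)//; last exact: (sip_domZ semi_ip_L2).
  rewrite (sipZr semi_ip_L2)//.
  have := sip_sqrD semi_ip_L2 (Wu i j) (Wu j i); lra.
rewrite le_eqVlt; apply/orP; left; apply/eqP.
under eq_bigr do rewrite big_split.
rewrite big_split /= [X in _ + X]exchange_big /= -big_split /=.
apply: eq_bigr => i _; rewrite -big_split /=; by apply: eq_bigr => j _; field.
Qed.

Lemma nL2_le_nH1 v : nL2 Omega v.1 <= nH1 Omega v.
Proof.
rewrite /nL2 /nH1 ler_sqrt.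
  by rewrite lerDl (sip_ge0 semi_ip_grad).
by rewrite addr_ge0// ?(sip_ge0 semi_ip_L2)// (sip_ge0 semi_ip_grad).
Qed.

End lebesgue_sobolev.

(** * Boundary traces *)

(* [surface] is an outer measure that is not packaged as a measure: of the integral,
   only the supremum over simple functions is available. *)
Section lower_integral.
Context d (T : measurableType d) (R : realType) (m : set T -> \bar R).
Hypotheses (m_set0 : m set0 = 0%E) (m_ge0 : forall A, (0 <= m A)%E).
Hypothesis m_setU : forall A B, (m (A `|` B) <= m A + m B)%E.
Implicit Types (h : {nnsfun T >-> R}) (f g : T -> R).
Local Open Scope ereal_scope.
Import HBNNSimple.

Let nnint (f : T -> \bar R) : \bar R := ereal_sup [set sintegral m h |
  h in [set h : {nnsfun T >-> R} | forall x, (h x)%:E <= f x]].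

Lemma sintegral_eq0 h : (forall x, h x = 0%R) -> sintegral m h = 0.
Proof.
move=> h0; rewrite /sintegral fsbig1// => x _.
have [->|x0] := eqVneq x 0%R; first by rewrite mul0e.
rewrite (_ : _ @^-1` _ = set0) ?m_set0 ?mule0//.
by apply/seteqP; split => // y /=; rewrite h0 => /esym/eqP; rewrite (negbTE x0).
Qed.

(** The integral is a difference of suprema for the positive and negative parts; the second one
    vanishes, since a nonnegative simple function below 0 is zero. *)
Lemma ge0_lower_integralE (D : set T) f : (forall x, 0 <= f x)%R ->
  integral m D (EFin \o f) = nnint ((EFin \o f) \_ D).
Proof.
move=> f0; have fD0 x : 0 <= ((EFin \o f) \_ D) x by apply: erestrict_ge0 => y _; rewrite lee_fin.
rewrite /integral (_ : _^\+ = (EFin \o f) \_ D); last first.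
  by apply/funext => x; rewrite funeposE max_l.
rewrite [X in _ - X](_ : _ = 0) ?sube0//.
apply/eqP; rewrite eq_le; apply/andP; split.
  apply: ge_ereal_sup => _ [h hle <-]; rewrite sintegral_eq0// => x.
  apply/eqP; rewrite eq_le; apply/andP; split; last exact: fun_ge0.
  have := hle x; rewrite funenegE (max_r _) ?lee_fin//.
  by rewrite leeNl oppe0.
apply: ereal_sup_ubound; exists nnsfun0; last by rewrite sintegral_eq0.
by move=> x; rewrite funenegE le_max lexx orbT.
Qed.

(** Each level set of [h] is cut in two by [A], so finite subadditivity of [m] suffices. *)
Lemma sintegral_split h (A : set T) (mA : measurable A) :
  sintegral m h <= sintegral m (proj_nnsfun h mA) +
                   sintegral m (proj_nnsfun h (measurableC mA)).
Proof.
(* The sums are indexed by a common range: the value 0, which the projections may add, contributes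
   nothing. *)
have E (g : {nnsfun T >-> R}) : (forall x, g x = h x \/ g x = 0%R) ->
    sintegral m g = \sum_(x \in range h) x%:E * m (g @^-1` [set x]).
  move=> gh; rewrite /sintegral; apply/esym/fsbig_widen => // x [_ hx] /=.
  have [->|x0] := eqVneq x 0%R; first by rewrite mul0e.
  rewrite (_ : _ @^-1` _ = set0) ?m_set0 ?mule0//.
  apply/seteqP; split => // y /= gy; have [e|e] := gh y.
    by apply: hx; exists y => //; rewrite -e.
  by move: x0; rewrite -gy e eqxx.
have P (B : set T) (mB : measurable B) x : proj_nnsfun h mB x = if x \in B then h x else 0%R.
  by rewrite /= mindicE; case: (x \in B); rewrite (mulr1, mulr0).
have PE (B : set T) (mB : measurable B) x : proj_nnsfun h mB x = h x \/ proj_nnsfun h mB x = 0%R.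
  by rewrite P; case: ifP => _; [left|right].
rewrite (E h); last by move=> x; left.
rewrite (E _ (PE _ mA)) (E _ (PE _ (measurableC mA))).
apply: (@le_trans _ _ (\sum_(x \in range h)
    (x%:E * m (proj_nnsfun h mA @^-1` [set x]) +
     x%:E * m (proj_nnsfun h (measurableC mA) @^-1` [set x])))); last first.
  by rewrite fsbig_split.
apply: lee_fsum => //.
move=> x [y _ hy]; have [->|x0] := eqVneq x 0%R; first by rewrite !mul0e add0e.
have xge0 : 0 <= x%:E by rewrite lee_fin -hy fun_ge0.
rewrite -ge0_muleDr//; apply: lee_wpmul2l => //.
apply: le_trans (m_setU _ _); rewrite le_eqVlt; apply/orP; left; apply/eqP; congr m.
apply/seteqP; split => z.
  rewrite /preimage/= -!/(proj_nnsfun _ _ _) => hz.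
  have [Az|Az] := pselect (A z); [left|right].
    by rewrite -[LHS]/(proj_nnsfun h mA z) P mem_set.
  by rewrite -[LHS]/(proj_nnsfun h (measurableC mA) z) P mem_set.
by case=> /=; rewrite -[X in X = x]/(proj_nnsfun h _ z) P; case: ifP => // _ /esym e;
  rewrite e eqxx in x0.
Qed.

Lemma sintegral_scale h (k : R) (k0 : (0 <= k)%R) : (k != 0)%R ->
  sintegral m (scale_nnsfun h k0) = k%:E * sintegral m h.
Proof.
move=> kn0; rewrite /sintegral (@reindex_fsbigT _ _ _ _ _ ( *%R k)); last first.
  by exists ( *%R k^-1) => x; rewrite ?mulKf// mulVKf.
rewrite ge0_mule_fsumr; last first.
  move=> x; have [[y hy]|hx] := pselect (exists y, h y = x).
    by rewrite mule_ge0// lee_fin -hy fun_ge0.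
  rewrite (_ : _ @^-1` _ = set0) ?m_set0 ?mule0//.
  by apply/seteqP; split => // y /= hy; apply: hx; exists y.
apply: eq_fsbigr => x _; rewrite EFinM -muleA; congr (_ * (_ * m _)).
by apply/seteqP; split => y /=; [move/(mulfI kn0)|move=> ->].
Qed.

(** The supremum over simple functions is not known to be additive in the integrand. Cutting each
    simple function along [A] avoids adding integrands: on either piece a single one bounds it. *)
Lemma lower_integral_split (D A : set T) f g1 g2 : measurable A ->
  (forall x, 0 <= f x)%R -> (forall x, 0 <= g1 x)%R -> (forall x, 0 <= g2 x)%R ->
  (forall x, D x -> A x -> f x <= 4 * g1 x)%R ->
  (forall x, D x -> ~ A x -> f x <= 4 * g2 x)%R ->
  integral m D (EFin \o f) <=
  4%:E * integral m D (EFin \o g1) + 4%:E * integral m D (EFin \o g2).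
Proof.
move=> mA f0 g10 g20 fg1 fg2; rewrite !ge0_lower_integralE//.
apply: ge_ereal_sup => _ [h hf <-].
(* Dividing the simple function by 4 puts it below [g] itself. *)
have q0 : (0 <= 4^-1 :> R)%R by [].
have key (B : set T) (mB : measurable B) g : (forall x, 0 <= g x)%R ->
    (forall x, D x -> B x -> f x <= 4 * g x)%R ->
    sintegral m (proj_nnsfun h mB) <= 4%:E * nnint ((EFin \o g) \_ D).
  move=> g0 fg; have -> : sintegral m (proj_nnsfun h mB) =
      4%:E * sintegral m (scale_nnsfun (proj_nnsfun h mB) q0).
    by rewrite sintegral_scale ?invr_eq0// muleA -EFinM divff// mul1e.
  rewrite lee_wpmul2l//; apply: ereal_sup_ubound; exists (scale_nnsfun (proj_nnsfun h mB) q0) => //.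
  move=> x; have := hf x; rewrite /= mindicE /patch.
  case: ifPn => [/set_mem Dx|_]; rewrite lee_fin/= => hx.
    have [/set_mem Bx|_] := boolP (x \in B); rewrite ?mulr1n ?mulr0n ?mulr1 ?mulr0 lee_fin//.
    by rewrite ler_pdivrMl//; exact: (le_trans hx (fg x Dx Bx)).
  rewrite lee_fin pmulr_rle0//.
  by apply: mulr_le0_ge0.
apply: (le_trans (sintegral_split h mA)); apply: leeD; exact: key.
Qed.

(** Pointwise, (f - g)^2 is at most 4 times the larger of f^2 and g^2; the set where f^2 is the
    larger one is measurable and serves as the cut. *)
Lemma lower_integral_sqrB (D : set T) f g : measurable D ->
  measurable_fun D f -> measurable_fun D g ->
  \int[m]_(x in D) ((f x - g x) ^+ 2)%:E <=
  4%:E * \int[m]_(x in D) (f x ^+ 2)%:E + 4%:E * \int[m]_(x in D) (g x ^+ 2)%:E.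
Proof.
move=> mD mf mg.
pose A := D `&` [set x | g x ^+ 2 <= f x ^+ 2]%R.
have mA : measurable A.
  by apply: (measurable_fun_le mD); exact: measurable_funX.
apply: (lower_integral_split mA) => [x|x|x|x Dx [_ /= Ax]|x Dx Ax]; try exact: sqr_ge0.
  have := sqr_ge0 (f x + g x); rewrite sqrrB sqrrD => *; nra.
have {}Ax : (f x ^+ 2 < g x ^+ 2)%R by rewrite ltNge; apply/negP => gf; apply: Ax.
have := sqr_ge0 (f x + g x); rewrite sqrrB sqrrD => *; nra.
Qed.

Lemma lower_integral_eq0 (D : set T) f : (forall x, D x -> f x = 0%R) ->
  integral m D (EFin \o f) = 0.
Proof.
move=> f0; have -> : integral m D (EFin \o f) = integral m D (EFin \o cst 0%R).
  rewrite /integral (_ : (EFin \o f) \_ D = (EFin \o cst 0%R) \_ D)//.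
  by apply/funext => x; rewrite /patch; case: ifPn => // /set_mem Dx /=; rewrite f0.
rewrite ge0_lower_integralE//; apply/eqP; rewrite eq_le; apply/andP; split.
  apply: ge_ereal_sup => _ [h hle <-]; rewrite sintegral_eq0// => x.
  apply/eqP; rewrite eq_le; apply/andP; split; last exact: fun_ge0.
  by have := hle x; rewrite /patch; case: ifP.
by apply: ereal_sup_ubound; exists nnsfun0; [move=> x; rewrite /patch; case: ifP|rewrite sintegral_eq0].
Qed.

End lower_integral.

(** * Hausdorff measure of the boundary as an outer measure *)

Section surface_measure.
Context (R : realType) (d : nat).
Hypothesis d1 : (1 < d)%N.
Local Notation E := 'rV[R]_d.
Implicit Types A B : set E.
Local Open Scope ereal_scope.

Lemma diameter_ge0 A : 0 <= diameter A.
Proof. by apply: ereal_sup_ubound; left. Qed.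

Lemma diameter_set0 : diameter (set0 : set E) = 0.
Proof.
rewrite /diameter set0X image_set0 setU0; exact: ereal_sup1.
Qed.

Lemma hausdorff_pre_ge0 s delta A : 0 <= hausdorff_pre s delta A.
Proof.
apply: le_ereal_inf_tmp => _ [F _ <-]; apply: nneseries_ge0 => k _ _.
exact/expe_ge0/diameter_ge0.
Qed.

Lemma hausdorff_pre_le s delta A B : A `<=` B ->
  hausdorff_pre s delta A <= hausdorff_pre s delta B.
Proof.
move=> AB; apply: ereal_inf_le_tmp => _ [F [BF Fd] <-]; exists F => //.
by split => //; exact: (subset_trans AB).
Qed.

(** Two nearly optimal covers are interleaved, one at even and one at odd indices. *)
Lemma hausdorff_preU s delta A B :
  hausdorff_pre s delta (A `|` B) <= hausdorff_pre s delta A + hausdorff_pre s delta B.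
Proof.
have [/eqP->|fA] := boolP (hausdorff_pre s delta A == +oo).
  by rewrite addye ?leey// -ltNye (lt_le_trans _ (hausdorff_pre_ge0 _ _ _)).
have [/eqP->|fB] := boolP (hausdorff_pre s delta B == +oo).
  by rewrite addey ?leey// -ltNye (lt_le_trans _ (hausdorff_pre_ge0 _ _ _)).
have fin (C : set E) : hausdorff_pre s delta C != +oo -> hausdorff_pre s delta C \is a fin_num.
  by move=> fC; rewrite ge0_fin_numE ?hausdorff_pre_ge0// lt_neqAle fC leey.
apply/lee_addgt0Pr => e e0; have e2 : (0 < e / 2)%R by rewrite divr_gt0.
have [_ [F [AF Fd] <-] HF] := lb_ereal_inf_adherent e2 (fin _ fA).
have [_ [G [BG Gd] <-] HG] := lb_ereal_inf_adherent e2 (fin _ fB).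
pose H k := if odd k then G k./2 else F k./2.
have D0 (K : nat -> set E) k : 0 <= diameter (K k) ^+ s by exact/expe_ge0/diameter_ge0.
apply: (@le_trans _ _ (\sum_(0 <= k <oo) diameter (H k) ^+ s)).
  apply: ereal_inf_lbound; exists H => //; split.
    move=> x [/AF[k _ Fk]|/BG[k _ Gk]].
      by exists k.*2 => //; rewrite /H odd_double doubleK.
    by exists k.*2.+1 => //; rewrite /H/= odd_double/= uphalf_double.
  by move=> k; rewrite /H; case: odd.
apply: (@le_trans _ _ (\sum_(0 <= k <oo) diameter (F k) ^+ s +
                       \sum_(0 <= k <oo) diameter (G k) ^+ s)).
  apply: lime_le; first by apply: is_cvg_nneseries => k _ _; exact: D0.
  apply: nearW => n.
  have HE k : \sum_(0 <= i < k.*2) diameter (H i) ^+ s =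
     \sum_(0 <= i < k) diameter (F i) ^+ s + \sum_(0 <= i < k) diameter (G i) ^+ s.
    elim: k => [|k IH]; first by rewrite !big_geq// adde0.
    rewrite doubleS !big_nat_recr//= IH /H/= odd_double/= uphalf_double doubleK.
    by rewrite -addeA addeACA.
  apply: (@le_trans _ _ (\sum_(0 <= i < n.*2) diameter (H i) ^+ s)).
    have n2 : (n <= n.*2)%N by rewrite -addnn leq_addr.
    rewrite (big_cat_nat (leq0n n) n2)/=.
    by rewrite leeDl//; apply: sume_ge0 => i _; exact: D0.
  by rewrite HE; apply: leeD; apply: nneseries_lim_ge => k _ _; exact: D0.
apply: (le_trans (leeD (ltW HF) (ltW HG))).
by rewrite addeACA -EFinD -splitr.
Qed.

Lemma surface_ge0 A : 0 <= surface A.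
Proof.
apply: le_trans (hausdorff_pre_ge0 d.-1 1 A) _.
by apply: ereal_sup_ubound; exists 1%R => //=.
Qed.

(** With [1 < d] the exponent d - 1 is positive and empty sets weigh 0; with exponent 0 each of them
    would weigh 1. *)
Lemma surface_set0 : surface (set0 : set E) = 0.
Proof.
apply/eqP; rewrite eq_le surface_ge0 andbT.
apply: ge_ereal_sup => _ [delta /= d0 <-].
apply: ereal_inf_lbound; exists (fun=> set0).
  by split => // k; rewrite diameter_set0 lee_fin ltW.
rewrite eseries0// => k _ _; rewrite diameter_set0.
by case: d d1 => [//|[//|n _]]; rewrite expeS mul0e.
Qed.

Lemma le_surface A B : A `<=` B -> surface A <= surface B.
Proof.
move=> AB; apply: ge_ereal_sup => _ [delta /= d0 <-].
apply: le_trans (hausdorff_pre_le _ _ AB) _.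
by apply: ereal_sup_ubound; exists delta.
Qed.

Lemma surfaceU A B : surface (A `|` B) <= surface A + surface B.
Proof.
apply: ge_ereal_sup => _ [delta /= d0 <-].
apply: le_trans (hausdorff_preU _ _ _ _) _.
by apply: leeD; apply: ereal_sup_ubound; exists delta.
Qed.

End surface_measure.

(** * Bounded sets: finite measure and bounded continuous functions *)

Section bounded_sets.
Context (R : realType).

Lemma bounded_set_rV d (A : set 'rV[R]_d) : bounded_set A ->
  exists2 M : R, 0 < M & A `<=` box 0 M.
Proof.
move=> bA; have [M M0 AM] := ex_strict_bound_gt0 bA.
exists M => // x /AM; rewrite /= => xM i; rewrite mxE subr0.
apply: le_lt_trans xM; rewrite /Num.norm/= mx_normrE.
by apply: le_trans (le_bigmax _ _ (0, i)) => /=.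
Qed.

Lemma lebesgue_box_lty d (M : R) : (lebesgue_rV R d (box 0 M) < +oo)%E.
Proof.
elim: d => [|d IH] /=.
  by rewrite diracE; case: (_ \in _); rewrite ltry.
have -> : lebesgue_rV_step (lebesgue_rV R d) (box 0 M) =
   (@lebesgue_measure R \x lebesgue_rV R d)%E (`]-M, M[ `*` box 0 M).
  rewrite /lebesgue_rV_step /pushforward; congr (_ _).
  apply/seteqP; split => -[x v] /=; rewrite /box/= in_itv/=.
    move=> xv; split; first by have := xv ord0; rewrite /rV_cons !mxE unlift_none/= subr0 ltr_norml.
    by move=> i; move: (xv (lift ord0 i)); rewrite /rV_cons !mxE liftK.
  move=> [xM vM] i; rewrite /rV_cons !mxE; case: (unliftP ord0 i) => [j _|_].
    by have := vM j; rewrite mxE.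
  by rewrite /= subr0 ltr_norml.
rewrite product_measure1E//; last exact: measurable_box.
have Ml : (@lebesgue_measure R [set` `](- M)%R, M[%R] < +oo)%E.
  by rewrite lebesgue_measure_itv/=; case: ifP => _; rewrite ltry.
by rewrite lte_mul_pinfty// ge0_fin_numE.
Qed.

Lemma bounded_lebesgue_lty d (A : set 'rV[R]_d) : measurable A -> bounded_set A ->
  (lebesgue_rV R d A < +oo)%E.
Proof.
move=> mA /bounded_set_rV[M M0 AM]; apply: le_lt_trans (lebesgue_box_lty d M).
by apply: le_measure; rewrite ?inE//; exact: measurable_box.
Qed.

Lemma continuous_bounded_on d (A : set 'rV[R]_d) (f : 'rV[R]_d -> R) : bounded_set A ->
  continuous f -> exists M : R, forall x, A x -> `|f x| <= M.
Proof.
move=> /bounded_set_rV[M M0 AM] cf.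
pose K : set 'rV[R]_d := [set v | forall i, `[-M, M]%classic (v ord0 i)].
have cK : compact K by apply: (@rV_compact _ _ (fun=> `[-M, M]%classic)) => i; exact: segment_compact.
have : compact (f @` K) by apply: continuous_compact => //; exact: continuous_subspaceT.
move=> /compact_bounded /ex_strict_bound_gt0 [N N0 fN]; exists N => x /AM xM; apply: ltW; apply: fN.
exists x => // i; have := xM i; rewrite /= mxE subr0 ltr_norml in_itv/= => /andP[? ?].
by rewrite !ltW.
Qed.

End bounded_sets.

Section smooth_functions.
Context (R : realType) (d : nat).
Local Notation E := 'rV[R]_d.
Implicit Types f g : E -> R.

Lemma smooth_partial f i : smooth f -> smooth (partial i f).
Proof. by move=> sf s x; have := sf (rcons s i) x; rewrite foldr_rcons. Qed.

Lemma smooth_continuous f : smooth f -> continuous f.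
Proof. by move=> sf x; apply: differentiable_continuous; exact: (sf [::] x). Qed.

Lemma partialB f g i : smooth f -> smooth g ->
  partial i (f - g) = partial i f - partial i g.
Proof.
move=> sf sg; apply/funext => x; rewrite /partial deriveB//.
  by apply: diff_derivable; exact: (sf [::] x).
by apply: diff_derivable; exact: (sg [::] x).
Qed.

Lemma smoothB f g : smooth f -> smooth g -> smooth (f - g).
Proof.
move=> sf sg s x.
have -> : foldr (@partial R d) (f - g) s = foldr (@partial R d) f s - foldr (@partial R d) g s.
  have sm h : smooth h -> forall r, smooth (foldr (@partial R d) h r).
    by move=> sh r r' y; have := sh (r' ++ r) y; rewrite foldr_cat.
  elim: s => [//|i s IH] /=; rewrite IH partialB//; exact: sm.
by apply: differentiableB; [exact: sf|exact: sg].
Qed.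

End smooth_functions.

(** * Functions with zero trace *)

Section traces.
Context (R : realType) (d : nat) (Omega GD : set 'rV[R]_d).
Hypotheses (d1 : (1 < d)%N) (oO : open Omega) (bO : bounded_set Omega).
Local Notation E := 'rV[R]_d.
Local Notation W := (L2 Omega).
Local Notation leb := (lebesgue_rV R d).

Let mO : measurable Omega. Proof. exact: open_measurable_rV. Qed.
Let hL2 := semi_ip_L2 mO.
Let hH1 := semi_ip_H1 mO.

Lemma smooth_L2 (f : E -> R) : smooth f -> W f.
Proof.
move=> /smooth_continuous cf; have mf : measurable_fun Omega f by exact: continuous_measurable_rV.
have [M fM] := continuous_bounded_on bO cf.
apply: (@L2_le _ _ _ mO _ (cst (M ^+ 2))) => //.
  move=> x Ox; rewrite -(real_normK (num_real (f x))) ler_pXn2r// ?nnegrE// ?fM//.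
  by apply: le_trans (fM x Ox).
exact/(integ_cst leb mO)/bounded_lebesgue_lty.
Qed.

Lemma smooth_hdom (f : E -> R) : smooth f -> hdom Omega (grad_pair f).
Proof. by move=> sf; split => [|i]; apply: smooth_L2 => //; exact: smooth_partial. Qed.

Lemma H1_hdom v : H1 Omega v -> hdom Omega v.
Proof. by case. Qed.

Lemma H1B v w : H1 Omega v -> H1 Omega w -> H1 Omega (v - w).
Proof.
move=> hv hw; have [v1 v2 v3] := hv; have [w1 w2 w3] := hw.
have [vw1 vw2] := sip_domB hH1 (H1_hdom hv) (H1_hdom hw).
split => // theta i ht; have [st _] := ht.
rewrite (sipB hL2)//; last exact/smooth_L2/smooth_partial.
rewrite v3// w3// (sipB hL2)//; last exact: smooth_L2.
by rewrite opprB opprK addrC.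
Qed.

Let boundaryE x : boundary Omega x -> ~ Omega x.
Proof. by move=> [_ nO] Ox; apply: nO; exact: open_nbhs_nbhs. Qed.

Lemma measurable_boundary : measurable (boundary Omega).
Proof.
apply: measurableD; last by apply: open_measurable_rV; exact: open_interior.
rewrite -(setCK (closure Omega)); apply: measurableC; apply: open_measurable_rV.
exact/closed_openC/closed_closure.
Qed.

(** The approximating test functions vanish on the boundary, since their supports lie in the open
    set Omega, so the zero trace is attained exactly. This makes [poincare] available for the
    transport unknowns. *)
Lemma H10_zero_trace v : H10 Omega v -> H1_zero_trace Omega GD v.
Proof.
move=> [hv [f tf fv]]; split => //; exists (cst 0).
  split; first exact: measurable_cst.
  exists f; split => // [n|]; first by have [] := tf n.
  rewrite (_ : (fun n => _) = cst 0%E); first exact: cvg_cst.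
  apply/funext => n.
  apply: (lower_integral_eq0 (@surface_set0 R d d1) (D := boundary Omega)
    (f := fun x => (f n x - cst 0 x) ^+ 2)) => x bx.
  have [_ [K [_ KO] fK]] := tf n; rewrite fK ?subr0 ?expr0n//.
  by move/KO; exact: boundaryE.
rewrite (_ : _ `&` _ = set0) ?surface_set0//.
by apply/seteqP; split => // x [_ /=]; rewrite eqxx.
Qed.

(** Needed for an error, a difference of displacements, to be an admissible test function. The
    traces are subtracted; their convergence relies on [lower_integral_sqrB], and the set where the
    difference is nonzero on [GD] lies in a union of two null sets. *)
Lemma H1_zero_traceB v w : H1_zero_trace Omega GD v -> H1_zero_trace Omega GD w ->
  H1_zero_trace Omega GD (v - w).
Proof.
move=> [hv [tv [mtv [f [sf fv ftv]]] gv]] [hw [tw [mtw [g [sg gw gtw]]] gw0]].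
split; first exact: H1B.
have mb := measurable_boundary.
exists (fun x => tv x - tw x).
  split; first exact: measurable_funB.
  exists (fun n => f n - g n); split.
  - by move=> n; exact: smoothB.
  - have fgvw : (nH1 Omega (v - grad_pair (f n)) + nH1 Omega (w - grad_pair (g n)))
        @[n --> \oo] --> (0 : R).
      rewrite -[X in _ --> X]addr0; exact: (cvgD fv gw).
    apply: (@squeeze_dist R _ _ _ _
      (fun n => nH1 Omega (v - grad_pair (f n)) + nH1 Omega (w - grad_pair (g n))) _ _ fgvw).
    apply: nearW => n.
    rewrite sub0r normrN ger0_norm ?sqrtr_ge0//.
    have -> : v - w - grad_pair (f n - g n) = (v - grad_pair (f n)) - (w - grad_pair (g n)).
      have -> : grad_pair (f n - g n) = grad_pair (f n) - grad_pair (g n).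
        by congr pair; apply/funext => i; rewrite partialB.
      by rewrite !opprB addrACA [RHS]addrACA; congr (_ + _); exact: addrC.
    exact: (snormB hH1 (sip_domB hH1 (H1_hdom hv) (smooth_hdom (sf n)))
        (sip_domB hH1 (H1_hdom hw) (smooth_hdom (sg n)))).
  - have I0 (h : E -> R) : (0 <= \int[@surface R d]_(x in boundary Omega) (h x ^+ 2)%:E)%E.
      rewrite (ge0_lower_integralE (@surface_set0 R d d1) _ (f := fun x => h x ^+ 2)); last by move=> x; exact: sqr_ge0.
      apply: ereal_sup_ubound; exists nnsfun0; first by move=> x; apply: erestrict_ge0 => y _; rewrite lee_fin sqr_ge0.
      exact: (sintegral_eq0 (@surface_set0 R d d1)).
    apply: near_cvge0 => [n|e e0]; first exact: I0.
    have e8 : 0 < e / 8 by rewrite divr_gt0.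
    have F := cvge0_near (fun n => I0 (fun x => f n x - tv x)) e8 ftv.
    have G := cvge0_near (fun n => I0 (fun x => g n x - tw x)) e8 gtw.
    near=> n.
    have Fn : (\int[@surface R d]_(x in boundary Omega) ((f n x - tv x) ^+ 2)%:E <= (e / 8)%:E)%E by near: n.
    have Gn : (\int[@surface R d]_(x in boundary Omega) ((g n x - tw x) ^+ 2)%:E <= (e / 8)%:E)%E by near: n.
    rewrite (_ : (fun x => _) = fun x => (((f n x - tv x) - (g n x - tw x)) ^+ 2)%:E); last first.
      by apply/funext => x; congr ((_ ^+ 2)%:E); rewrite !fctE; ring.
    apply: le_trans (lower_integral_sqrB (@surface_set0 R d d1) (@surface_ge0 R d)
      (@surfaceU R d) mb _ _) _.
    + by apply: measurable_funB => //; apply: continuous_measurable_rV => //; exact: smooth_continuous.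
    + by apply: measurable_funB => //; apply: continuous_measurable_rV => //; exact: smooth_continuous.
    + apply: (@le_trans _ _ (4%:E * (e / 8)%:E + 4%:E * (e / 8)%:E)%E).
        by apply: leeD; apply: lee_wpmul2l.
      by rewrite -!EFinM -EFinD lee_fin; lra.
apply/eqP; rewrite eq_le surface_ge0 andbT.
apply: (@le_trans _ _ (surface ((GD `&` [set x | tv x != 0]) `|` (GD `&` [set x | tw x != 0])))).
  apply: le_surface => x [Gx /= txw].
  have [tv0|tv0] := eqVneq (tv x) 0; last by left.
  by right; split => //=; apply: contra_neq txw => ->; rewrite tv0 subr0.
by apply: le_trans (surfaceU _ _) _; rewrite gv gw0 adde0.
Unshelve. all: by end_near.
Qed.

Lemma VDB u v : VD Omega GD u -> VD Omega GD v -> VD Omega GD (u - v).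
Proof. by move=> hu hv k; apply: H1_zero_traceB; [exact: hu|exact: hv]. Qed.

Lemma VD_vdom u : VD Omega GD u -> vdom Omega u.
Proof. by move=> hu k; have [/H1_hdom] := hu k. Qed.

Lemma H10_hdom v : H10 Omega v -> hdom Omega v.
Proof. by move=> [/H1_hdom]. Qed.

(* Korn's inequality for the displacement (v, 0, ..., 0). *)
Lemma poincare (CK : R) :
  (forall v, VD Omega GD v -> nH1v Omega v <= CK * Num.sqrt (ip_eps Omega v v)) ->
  0 < CK ->
  forall v, H1_zero_trace Omega GD v -> nH1 Omega v <= CK * Num.sqrt (ip_grad Omega v v).
Proof.
move=> korn CK0 v hv; have hG := semi_ip_grad mO.
have d0 : (0 < d)%N by exact: ltnW.
pose i0 := Ordinal d0.
(* The zero components are written [v - v], so that their zero trace follows from that of [v]. *)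
pose u : hvec R d := fun k => if k == i0 then v else v - v.
have hu : VD Omega GD u.
  move=> k; rewrite /u; case: ifP => _; [exact: hv|exact: (H1_zero_traceB hv hv)].
have vv0 : v - v = 0 by rewrite subrr.
have gu : \sum_(k < d) ip_grad Omega (u k) (u k) = ip_grad Omega v v.
  rewrite (bigD1 i0)//= big1 ?addr0 => [|k /negbTE ki]; rewrite /u ?eqxx// ki vv0.
  by rewrite (sip0 hG)//; exact: (sip_dom0 hG).
have := korn _ hu; rewrite /nH1v gu => le1.
apply: (@le_trans _ _ (CK * Num.sqrt (ip_eps Omega u u))); last first.
  by rewrite ler_pM2l// ler_wsqrtr// -gu (ip_eps_le_grad mO)//; exact: VD_vdom.
apply: le_trans le1; rewrite /nH1 ler_wsqrtr// lerD2r.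
rewrite /ipv (bigD1 i0)//= /hval {2 3}/u eqxx lerDl; apply: sumr_ge0 => k _.
exact: (sip_ge0 hL2).
Qed.

End traces.

(** * Error estimates *)

Section mechanics_error.
Context (R : realType) (d : nat) (Omega GD : set 'rV[R]_d).
Hypotheses (d1 : (1 < d)%N) (oO : open Omega) (bO : bounded_set Omega).
Local Notation W := (L2 Omega).
Local Notation V := (VD Omega GD).

Let mO : measurable Omega. Proof. exact: open_measurable_rV. Qed.
Let hL2 := semi_ip_L2 mO.
Let hE := semi_ip_eps mO.
Let hV := semi_ip_H1v mO.

Context (la m Cis : R).
Hypotheses (la0 : 0 < la) (m0 : 0 < m) (Cis0 : 0 < Cis).
Hypothesis infsup : forall w, W w ->
  ((Cis * nL2 Omega w)%:E <=
   ereal_sup [set (ip Omega (divg v) w / nH1v Omega v)%:E |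
                v in [set v | V v /\ nH1v Omega v != 0%R]])%E.

(* The mechanics equations for an error, with load r in place of
   [alpha e_phi + beta e_psi]. *)
Definition mech_err (U : hvec R d) (X r : 'rV[R]_d -> R) : Prop :=
  [/\ [/\ V U, W X & W r],
      forall v, V v -> 2 * m * ip_eps Omega U v = ip Omega X (divg v) &
      forall w, W w -> la * ip Omega (divg U) w + ip Omega X w = ip Omega r w].

Lemma divgB (U U' : hvec R d) : divg (U - U') = divg U - divg U'.
Proof. exact: (sumrB (index_enum 'I_d) xpredT). Qed.

Let divL u : V u -> W (divg u). Proof. by move=> /VD_vdom; exact: divg_in. Qed.

Lemma mech_errB U X r U' X' r' : mech_err U X r -> mech_err U' X' r' ->
  mech_err (U - U') (X - X') (r - r').
Proof.
move=> [[hU hX hr] e1 e2] [[hU' hX' hr'] e1' e2']; split.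
- by split; [exact: VDB|exact: (sip_domB hL2)|exact: (sip_domB hL2)].
- move=> v hv; rewrite (sipB hE); [|exact: VD_vdom hU|exact: VD_vdom hU'|exact: VD_vdom hv].
  rewrite mulrBr e1// e1'// (sipB hL2)//; exact: divL.
- move=> w hw; rewrite divgB !(sipB hL2)//; [|exact: divL..].
  by have := e2 w hw; have := e2' w hw; lra.
Qed.

(** For time 0, at which the equations are not assumed: the initial errors have zero seminorm, and
    by Cauchy-Schwarz every term vanishes. *)
Lemma mech_err_null U X r : V U -> W X -> W r ->
  nH1v Omega U = 0 -> nL2 Omega X = 0 -> nL2 Omega r = 0 -> mech_err U X r.
Proof.
move=> hU hX hr U0 X0 r0.
have null u w : W u -> nL2 Omega u = 0 -> W w -> ip Omega u w = 0.
  move=> hu u0 hw; have := sip_cauchy_schwarz_norm hL2 hu hw.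
  rewrite -[snorm _ u]/(nL2 Omega u) u0 mul0r => le0.
  by apply/eqP; rewrite -normr_eq0 eq_le normr_ge0 le0.
have VU := VD_vdom hU.
have G0 : ip_eps Omega U U <= 0.
  apply: le_trans (ip_eps_le_grad mO VU) _.
  have := snorm_sqr hV U; rewrite -[snorm _ U]/(nH1v Omega U) U0 expr0n/= => /esym.
  have : 0 <= ipv Omega (hval U) (hval U) by apply: sumr_ge0 => k _; exact: (sip_ge0 hL2).
  lra.
have eps0 v : V v -> ip_eps Omega U v = 0.
  move=> /VD_vdom hv; have := sip_cauchy_schwarz_norm hE VU hv.
  rewrite {1}/snorm [Num.sqrt (ip_eps Omega U U)]ler0_sqrtr// mul0r => le0.
  by apply/eqP; rewrite -normr_eq0 eq_le normr_ge0 le0.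
have div0 w : W w -> ip Omega (divg U) w = 0.
  move=> hw; rewrite (sip_suml hL2)// => [|k _]; last by have [_] := VU k; exact.
  apply: big1 => k _; apply: null => //; first by have [_] := VU k; exact.
  have := snorm_sqr hV U; rewrite -[snorm _ U]/(nH1v Omega U) U0 expr0n/= => /esym /eqP.
  have vge0 : 0 <= ipv Omega (hval U) (hval U) by apply: sumr_ge0 => j _; exact: (sip_ge0 hL2).
  have gge0 j : 0 <= ip_grad Omega (U j) (U j) by exact: (sip_ge0 (semi_ip_grad mO)).
  rewrite paddr_eq0//; last by apply: sumr_ge0.
  move=> /andP[_ ]; rewrite psumr_eq0// => /allP/(_ k (mem_index_enum _))/implyP/(_ isT).
  rewrite /ip_grad psumr_eq0; last by move=> j _; exact: (sip_ge0 hL2).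
  move=> /allP/(_ k (mem_index_enum _))/implyP/(_ isT)/eqP.
  by rewrite /nL2 => ->; rewrite sqrtr0.
split => //.
- move=> v hv; rewrite eps0// mulr0 null//; exact: divL.
- by move=> w hw; rewrite div0// !null// mulr0 add0r.
Qed.

(** Testing with [U] and [X] gives the energy identity [test]. The inf-sup condition bounds the
    pressure by the strain through the first equation, so part of the elastic energy counts as
    pressure. *)
Lemma mech_err_bound U X r : mech_err U X r ->
  (1 + 2 * la * (Cis ^+ 2 / (2 * m))) * ip Omega X X <= ip Omega r r /\
  2 * m * la * ip_eps Omega U U <= ip Omega r r.
Proof.
move=> [[hU hX hr] e1 e2]; have VU := VD_vdom hU.
have EU0 : 0 <= ip_eps Omega U U by exact: (sip_ge0 hE).
have XX0 : 0 <= ip Omega X X by exact: (sip_ge0 hL2).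
have test : 2 * m * la * ip_eps Omega U U + ip Omega X X = ip Omega r X.
  have := e1 U hU; have := e2 X hX; rewrite (sipC hL2 (divg U)) => <- <-; ring.
have stab : Cis * nL2 Omega X <= 2 * m * snorm (ip_eps Omega) U.
  rewrite -lee_fin; apply: (le_trans (infsup hX)).
  apply: ge_ereal_sup => _ [v [hv v0] <-]; rewrite lee_fin.
  have Nv0 : 0 < nH1v Omega v by rewrite lt_neqAle eq_sym v0 sqrtr_ge0.
  rewrite ler_pdivrMr// (sipC hL2) -e1// -!mulrA ler_pM2l// ler_pM2l//.
  apply: le_trans (sip_cauchy_schwarz hE VU (VD_vdom hv)) _.
  rewrite ler_wpM2l ?snorm_ge0// ler_wsqrtr//.
  apply: le_trans (ip_eps_le_grad mO (VD_vdom hv)) _.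
  by rewrite lerDr; apply: sumr_ge0 => k _; exact: (sip_ge0 hL2).
have {}stab : Cis ^+ 2 * ip Omega X X <= 4 * m ^+ 2 * ip_eps Omega U U.
  rewrite -(snorm_sqr hL2) -(snorm_sqr hE).
  have -> : 4 * m ^+ 2 * snorm (ip_eps Omega) U ^+ 2 = (2 * m * snorm (ip_eps Omega) U) ^+ 2 by ring.
  rewrite -exprMn ler_pXn2r// nnegrE ?mulr_ge0 ?snorm_ge0 ?ltW//.
(* The stability bound divided by 2m: C |X|^2 is at most the elastic energy 2m |eps U|^2. *)
pose C := Cis ^+ 2 / (2 * m); rewrite -/C.
have C0 : 0 < C by rewrite divr_gt0 ?exprn_gt0// mulr_gt0.
have CX : la * (C * ip Omega X X) <= la * (2 * m * ip_eps Omega U U).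
  rewrite ler_pM2l//; have -> : C * ip Omega X X = (2 * m)^-1 * (Cis ^+ 2 * ip Omega X X).
    by rewrite /C; ring.
  rewrite ler_pdivrMl ?mulr_gt0//; apply: (le_trans stab); rewrite le_eqVlt.
  by apply/orP; left; apply/eqP; ring.
have k0 : 0 < 1 + la * C by rewrite addr_gt0// mulr_gt0.
have R0 : 0 <= ip Omega r r by exact: (sip_ge0 hL2).
split; last first.
  have := sip_young hL2 ltr01 hr hX; rewrite invr1; nra.
(* With this weight Young's inequality absorbs exactly half of (1 + la C) |X|^2 and leaves (1 + la
   C)^2 |X|^2 <= |r|^2; the claim drops the term (la C)^2. *)
have ki0 : 0 < (1 + la * C)^-1 by rewrite invr_gt0.
have := sip_young hL2 ki0 hr hX; rewrite invrK => yg.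
have le1 : (1 + la * C) * ip Omega X X <= (1 + la * C)^-1 * ip Omega r r.
  by move: yg test CX; set k := (_)^-1; lra.
move: le1; rewrite ler_pdivlMl// => le1; apply: le_trans le1.
have : 0 <= (la * C) ^+ 2 * ip Omega X X by rewrite mulr_ge0// sqr_ge0.
lra.
Qed.

End mechanics_error.

(** * Continuous linear images of functions of time *)

Section time_map.
Context (R : realType) (V V' : lmodType R) (L : V -> V').
Context (X : set V) (N : V -> R) (X' : set V') (N' : V' -> R).
Hypotheses (LD : forall u v, L (u + v) = L u + L v)
           (LZ : forall (a : R) u, L (a *: u) = a *: L u)
           (LX : forall u, X u -> X' (L u))
           (LN : forall u, N' (L u) <= N u) (N'0 : forall u, 0 <= N' u).
Local Notation mu := (@lebesgue_measure R).

Let L0 : L 0 = 0. Proof. by rewrite -(scale0r 0) LZ scale0r. Qed.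

Let LB u v : L (u - v) = L u - L v.
Proof. by rewrite LD -(scaleN1r v) LZ scaleN1r. Qed.

Let map_step (c : step_data V) : step_data V' :=
  StepData (@step_dom _ _ c) (fun k => L (@step_val _ _ c k)).

Let map_step_fun c t : step_fun (map_step c) t = L (step_fun c t).
Proof. by rewrite /step_fun (big_morph L LD L0); apply: eq_bigr => k _; rewrite LZ. Qed.

Let map_step_int D c : step_int D (map_step c) = L (step_int D c).
Proof. by rewrite /step_int (big_morph L LD L0); apply: eq_bigr => k _; rewrite LZ. Qed.

Let map_step_in c : step_in X c -> step_in X' (map_step c).
Proof. by move=> hc k; have [? ?] := hc k; split => //; exact: LX. Qed.

Let cvg_map (T : Type) (F : set_system T) {FF : Filter F} (f g : T -> V) :
  N (f x - g x) @[x --> F] --> 0 -> N' (L (f x) - L (g x)) @[x --> F] --> 0.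
Proof.
move=> fg; apply: (@squeeze_dist R _ _ _ _ (fun x => N (f x - g x)) _ _ fg).
by apply: nearW => x; rewrite sub0r normrN ger0_norm// -LB.
Qed.

Lemma strongly_measurable_map D u : strongly_measurable X N D u ->
  strongly_measurable X' N' D (L \o u).
Proof.
move=> [Xu [c cX cu]]; split.
  apply: (@filterS _ _ (ae_filter_ringOfSetsType mu)) Xu => t Xut /Xut; exact: LX.
exists (fun n => map_step (c n)) => [n|]; first exact: map_step_in.
apply: (@filterS _ _ (ae_filter_ringOfSetsType mu)) cu => t cut /cut ct.
under eq_fun do rewrite map_step_fun.
exact: (cvg_map (f := fun=> u t)).
Qed.

Lemma time_L2_map T u : time_L2 X N T u -> time_L2 X' N' T (L \o u).
Proof.
move=> [su iu]; split; first exact: strongly_measurable_map.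
apply: le_lt_trans iu; apply: ge0_le_integral_all => t _; rewrite lee_fin ?sqr_ge0//.
by apply: lerXn2r; rewrite ?nnegrE ?N'0//; exact: le_trans (LN _).
Qed.

Lemma bochner_integral_map D u I : bochner_integral X N D u I ->
  bochner_integral X' N' D (L \o u) (L I).
Proof.
move=> [XI su [c [cX cu cI]]]; split; [exact: LX|exact: strongly_measurable_map|].
exists (fun n => map_step (c n)); split => [n|//|]; first exact: map_step_in.
  have i0 n : (0 <= \int[mu]_(t in D) (N (u t - step_fun (c n) t))%:E)%E.
    by apply: integral_ge0 => t _; rewrite lee_fin; exact: le_trans (LN _).
  apply: near_cvge0 => [n|e e0]; first by apply: integral_ge0 => t _; rewrite lee_fin.
  have := cvge0_near i0 e0 cu; apply: filterS => n; apply: le_trans.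
  apply: ge0_le_integral_all => t _; rewrite lee_fin//.
  by rewrite /= map_step_fun -LB.
under eq_fun do rewrite map_step_int.
exact: (cvg_map (f := fun=> I)).
Qed.

(** A linear contraction maps step functions to step functions and commutes with their integrals. It
    serves to forget the gradient of the coupled solution, which then has the regularity of an
    iterate. *)
Lemma time_H1_map T u du : time_H1 X N T u du -> time_H1 X' N' T (L \o u) (L \o du).
Proof.
move=> [Lu Ldu wd cu]; split; [exact: time_L2_map|exact: time_L2_map| |].
  have scaleL (f : R -> R) w : (fun t => f t *: (L \o w) t) = L \o (fun t => f t *: w t).
    by apply/funext => t /=; rewrite LZ.
  move=> theta /wd[I I1 I2]; exists (L I).
    by rewrite (scaleL (derive1 theta)); exact: bochner_integral_map.
  have -> : - L I = L (- I) by rewrite -(scaleN1r I) LZ scaleN1r.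
  by rewrite scaleL; exact: bochner_integral_map.
move=> t /cu[Xut ut]; split; first exact: LX.
exact: (cvg_map (f := u) (g := fun=> u t)).
Qed.

End time_map.

(** * Errors of the transport step *)

Section transport_error.
Context (R : realType) (d : nat) (Omega GD : set 'rV[R]_d).
Hypotheses (d1 : (1 < d)%N) (oO : open Omega) (bO : bounded_set Omega).
Local Notation E := 'rV[R]_d.
Local Notation W := (L2 Omega).
Local Notation Q := (H10 Omega).

Let mO : measurable Omega. Proof. exact: open_measurable_rV. Qed.
Let hL2 := semi_ip_L2 mO.
Let hG := semi_ip_grad mO.
Let hH := semi_ip_H1 mO.

Context (k1 k2 ga : R).
Hypotheses (k10 : 0 < k1) (k20 : 0 < k2) (ga0 : 0 <= ga).

(** Stated for a single test function, so that differences such as the errors are reached by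
    subtracting equations ([trans_errB]) instead of subtracting inside [H10]. *)
Definition trans_err (f1 f2 : E -> R) (A B q : hfun R d) : Prop :=
  [/\ hdom Omega q,
      k1 * ip_grad Omega A q + ga * ip Omega (A.1 - B.1) q.1 = ip Omega f1 q.1 &
      k2 * ip_grad Omega B q + ga * ip Omega (B.1 - A.1) q.1 = ip Omega f2 q.1].

Lemma trans_errB f1 f2 A B q q' : W f1 -> W f2 -> hdom Omega A -> hdom Omega B ->
  trans_err f1 f2 A B q -> trans_err f1 f2 A B q' -> trans_err f1 f2 A B (q - q').
Proof.
move=> hf1 hf2 hA hB [hq e1 e2] [hq' e1' e2'].
have [A1 A2] := hA; have [B1 B2] := hB; have [q1 q2] := hq; have [q1' q2'] := hq'.
have ipr f : W f -> ip Omega f (q - q').1 = ip Omega f q.1 - ip Omega f q'.1.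
  by move=> hf; exact: (sipBr hL2).
split; first exact: (sip_domB hH).
- rewrite (sipBr hG)// !ipr//; last exact: (sip_domB hL2).
  by rewrite -e1 -e1'; ring.
- rewrite (sipBr hG)// !ipr//; last exact: (sip_domB hL2).
  by rewrite -e2 -e2'; ring.
Qed.

Definition trans_energy (A B : hfun R d) : R :=
  k1 * ip_grad Omega A A + k2 * ip_grad Omega B B + ga * ip Omega (A.1 - B.1) (A.1 - B.1).

Lemma trans_energy_ge0 A B : 0 <= trans_energy A B.
Proof.
by rewrite /trans_energy !addr_ge0// mulr_ge0 ?(ltW k10) ?(ltW k20) ?(sip_ge0 hG)// (sip_ge0 hL2).
Qed.

Lemma trans_energyE f1 f2 A B :
  trans_err f1 f2 A B A -> trans_err f1 f2 A B B ->
  trans_energy A B = ip Omega f1 A.1 + ip Omega f2 B.1.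
Proof.
move=> [hA e1 _] [hB _ e2]; have [A1 _] := hA; have [B1 _] := hB.
rewrite -e1 -e2 /trans_energy.
have AB := sip_domB hL2 A1 B1.
rewrite -[B.1 - A.1]opprB (sipN hL2)// [in LHS](sipBr hL2)//; ring.
Qed.

(** Each of the three quadratic forms is convex, whence b(u,u) - b(v,v) <= 2 b(u, u - v). The right
    side then involves the equations at the first time only, tested with increments. *)
Lemma trans_energyB f1 f2 A B A' B' : hdom Omega A' -> hdom Omega B' ->
  W f1 -> W f2 ->
  trans_err f1 f2 A B A -> trans_err f1 f2 A B B ->
  trans_err f1 f2 A B A' -> trans_err f1 f2 A B B' ->
  trans_energy A B - trans_energy A' B' <=
  2 * (ip Omega f1 (A.1 - A'.1) + ip Omega f2 (B.1 - B'.1)).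
Proof.
move=> hA' hB' hf1 hf2 tA tB tA' tB'; have [hA _ _] := tA; have [hB _ _] := tB.
have [_ e1 _] := trans_errB hf1 hf2 hA hB tA tA'.
have [_ _ e2] := trans_errB hf1 hf2 hA hB tB tB'.
have convex (Y : lmodType R) (X : set Y) (b : Y -> Y -> R) (hb : semi_ip X b) u v :
    X u -> X v -> b u u - b v v <= 2 * b u (u - v).
  move=> Xu Xv; have := sip_ge0 hb (u - v).
  have Xuv := sip_domB hb Xu Xv.
  rewrite (sipB hb)// !(sipBr hb)// (sipC hb v u); lra.
have [A1 A2] := hA; have [B1 B2] := hB; have [A1' A2'] := hA'; have [B1' B2'] := hB'.
have c1 := convex _ _ _ hG A A' A2 A2'.
have c2 := convex _ _ _ hG B B' B2 B2'.
have AB := sip_domB hL2 A1 B1; have AB' := sip_domB hL2 A1' B1'.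
have c3 := convex _ _ _ hL2 _ _ AB AB'.
rewrite -[A.1 - A'.1]/(A - A').1 -[B.1 - B'.1]/(B - B').1 -e1 -e2.
rewrite /trans_energy -[B.1 - A.1]opprB (sipN hL2)//; last exact: (sip_domB hL2).
have e3 : ip Omega (A.1 - B.1) ((A.1 - B.1) - (A'.1 - B'.1)) =
    ip Omega (A.1 - B.1) (A - A').1 - ip Omega (A.1 - B.1) (B - B').1.
  rewrite -(sipBr hL2)//; try exact: (sip_domB hL2).
  by congr (ip _ _ _); rewrite !opprB addrACA [RHS]addrACA; congr (_ + _); exact: addrC.
rewrite e3 in c3.
have := ler_wpM2l (ltW k10) c1; have := ler_wpM2l (ltW k20) c2; have := ler_wpM2l ga0 c3.
lra.
Qed.

End transport_error.

Lemma null_setU (R : realType) (A B : set R) :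
  measurable A /\ @lebesgue_measure R A = 0%E -> measurable B /\ @lebesgue_measure R B = 0%E ->
  measurable (A `|` B) /\ @lebesgue_measure R (A `|` B) = 0%E.
Proof.
move=> [mA A0] [mB B0]; split; first exact: measurableU.
exact: etrans (@measureU0 _ _ _ (@lebesgue_measure R) _ _ mA mB B0) A0.
Qed.

Lemma null_cover (R : realType) (s : seq (set R)) :
  foldr (fun A P => (measurable A /\ @lebesgue_measure R A = 0%E) /\ P) True s ->
  exists Z, [/\ measurable Z, @lebesgue_measure R Z = 0%E &
    forall i, (i < size s)%N -> nth set0 s i `<=` Z].
Proof.
elim: s => [_|A s IH /= [nA /IH[Z [mZ Z0 sZ]]]].
  by exists set0; split => //; exact: measure0.
have [mAZ AZ0] := null_setU nA (conj mZ Z0); exists (A `|` Z); split => // -[_|i si] t At.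
  by left.
by right; exact: sZ At.
Qed.

Lemma snorm_null_dist (R : realType) (V : lmodType R) (X : set V) (B : V -> V -> R)
    (hB : semi_ip X B) a b c : X a -> X b -> X c ->
  snorm B (a - c) = 0 -> snorm B (b - c) = 0 -> snorm B (a - b) = 0.
Proof.
move=> Xa Xb Xc ac bc; apply/eqP; rewrite eq_le snorm_ge0 andbT.
have -> : a - b = (a - c) - (b - c) by rewrite opprB addrA subrK.
by apply: le_trans (snormB hB (sip_domB hB Xa Xc) (sip_domB hB Xb Xc)) _; rewrite ac bc addr0.
Qed.

Lemma le_sum4 (R : realDomainType) (a b c e : R) : 0 <= a -> 0 <= b -> 0 <= c -> 0 <= e ->
  [/\ a <= a + b + c + e, b <= a + b + c + e, c <= a + b + c + e & e <= a + b + c + e].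
Proof. by move=> *; split; lra. Qed.

(** * One step of the iteration *)

Section iteration.
Context (R : realType) (d : nat) (Omega GD : set 'rV[R]_d).
Hypotheses (d1 : (1 < d)%N) (oO : open Omega) (bO : bounded_set Omega).
Context (T : R) (p : coefficients R) (F : sources R d) (I0 : initial_data R d).
Hypotheses (T0 : 0 < T) (hp : admissible p) (hI0 : regular_initial_data Omega GD I0).
Local Notation D := 'rV[R]_d.
Local Notation W := (L2 Omega).
Local Notation V := (VD Omega GD).
Local Notation Q := (H10 Omega).
Local Notation leb1 := (@lebesgue_measure R).
Local Notation E := (`]0, T[%classic : set R).

Let mO : measurable Omega. Proof. exact: open_measurable_rV. Qed.
Let hL2 := semi_ip_L2 mO.
Let hE := semi_ip_eps mO.
Let hV := semi_ip_H1v mO.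
Let hH := semi_ip_H1 mO.
Let hG := semi_ip_grad mO.

Context (Cis CK : R).
Hypotheses (Cis0 : 0 < Cis) (CK0 : 0 < CK).
Hypothesis infsup : forall w, W w ->
  ((Cis * nL2 Omega w)%:E <=
   ereal_sup [set (ip Omega (divg v) w / nH1v Omega v)%:E |
                v in [set v | V v /\ nH1v Omega v != 0%R]])%E.
Hypothesis korn : forall v, V v -> nH1v Omega v <= CK * Num.sqrt (ip_eps Omega v v).

Lemma nH1v_null_dist (a b c : hvec R d) : vdom Omega a -> vdom Omega b -> vdom Omega c ->
  nH1v Omega (a - c) = 0 -> nH1v Omega (b - c) = 0 -> nH1v Omega (a - b) = 0.
Proof.
have E u : nH1v Omega u = snorm (fun u v : hvec R d =>
  ipv Omega (hval u) (hval v) + \sum_(k < d) ip_grad Omega (u k) (v k)) u by [].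
by rewrite !E => Va Vb Vc; exact: (snorm_null_dist hV Va Vb Vc).
Qed.

Definition sqr_L2L2 (w : R -> D -> R) : R :=
  \int[leb1]_(t in `]0, T[) ((nL2 Omega (w t)) ^+ 2).

Lemma sqr_L2L2_setD w (Z : set R) : measurable Z -> leb1 Z = 0%E ->
  sqr_L2L2 w = \int[leb1]_(t in E `\` Z) ip Omega (w t) (w t).
Proof.
move=> mZ Z0; rewrite /sqr_L2L2 /Rintegral (@integral_null_setD _ _ _ leb1 _ _ _ mZ Z0).
by congr fine; apply: eq_integral => t _; rewrite -(snorm_sqr hL2).
Qed.

Lemma time_H1_H10_parabolic phi dphi :
  time_H1_H10 Omega T phi dphi -> time_parabolic Omega T phi dphi.
Proof.
move=> [Dphi hphi dphiE]; split; first by case: hphi.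
have -> : dphi = fst \o Dphi by apply/funext => t; rewrite dphiE.
apply: (time_H1_map (L := fst : hfun R d -> _)) hphi => //.
- by move=> u [[]].
- by move=> u; exact: nL2_le_nH1.
- by move=> u; exact: sqrtr_ge0.
Qed.

(** The energy bound controls K |grad e_phi|^2 and D |grad e_psi|^2 by S / lambda, and Poincare's
    inequality gives [mphi] and [mpsi]. The load alpha e_phi + beta e_psi then gives [mrho], and
    Korn's inequality with the second bound of [mech_err_bound] gives [m_u]. Their sum is one
    constant for all four errors. *)
Let mphi := CK ^+ 2 / (lambda p * kK p).
Let mpsi := CK ^+ 2 / (lambda p * kD p).
Let mrho := 2 * alpha p ^+ 2 * mphi + 2 * beta p ^+ 2 * mpsi.
Let m_u := CK ^+ 2 * mrho / (2 * mu p * lambda p).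
Definition conv_cst := mphi + mpsi + mrho + m_u.

Lemma error_bounds (A B : hfun R d) (U : hvec R d) (X : D -> R) (S : R) :
  H1_zero_trace Omega GD A -> H1_zero_trace Omega GD B -> 0 <= S ->
  trans_energy Omega (kK p) (kD p) (gamma p) A B <= (lambda p)^-1 * S ->
  mech_err Omega GD (lambda p) (mu p) U X (alpha p *: A.1 + beta p *: B.1) ->
  [/\ nH1v Omega U ^+ 2 <= conv_cst * S, nL2 Omega X ^+ 2 <= conv_cst * S,
      nH1 Omega A ^+ 2 <= conv_cst * S & nH1 Omega B ^+ 2 <= conv_cst * S].
Proof.
have [[a0 b0' l0] [m0 K0 D0] [_ _ _ g0] _ _] := hp.
move=> hA hB S0 En me; have [[hU hX hr] _ _] := me.
have [/H1_hdom dA _] := hA; have [/H1_hdom dB _] := hB.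
have [A1 A2] := dA; have [B1 B2] := dB.
have gA0 : 0 <= ip_grad Omega A A by exact: (sip_ge0 hG).
have gB0 : 0 <= ip_grad Omega B B by exact: (sip_ge0 hG).
have AB0 : 0 <= ip Omega (A.1 - B.1) (A.1 - B.1) by exact: (sip_ge0 hL2).
have gAB0 := mulr_ge0 g0 AB0.
have KA := mulr_ge0 (ltW K0) gA0; have DB := mulr_ge0 (ltW D0) gB0.
have H1le (C : hfun R d) k : 0 < k -> H1_zero_trace Omega GD C ->
    k * ip_grad Omega C C <= (lambda p)^-1 * S ->
    nH1 Omega C ^+ 2 <= CK ^+ 2 / (lambda p * k) * S.
  move=> k0 hC kC; have gC0 : 0 <= ip_grad Omega C C by exact: (sip_ge0 hG).
  apply: (@le_trans _ _ ((CK * Num.sqrt (ip_grad Omega C C)) ^+ 2)).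
    apply: lerXn2r; rewrite ?nnegrE ?mulr_ge0 ?sqrtr_ge0 ?(ltW CK0)//.
    exact: (poincare d1 oO bO korn CK0 hC).
  rewrite exprMn sqr_sqrtr// -mulrA; apply: ler_wpM2l; first exact: sqr_ge0.
  by rewrite ler_pdivlMl ?mulr_gt0// -mulrA -ler_pdivlMl.
have bA : nH1 Omega A ^+ 2 <= mphi * S.
  by apply: H1le => //; apply: le_trans En; rewrite /trans_energy; lra.
have bB : nH1 Omega B ^+ 2 <= mpsi * S.
  by apply: H1le => //; apply: le_trans En; rewrite /trans_energy; lra.
have LA (C : hfun R d) : ip Omega C.1 C.1 <= nH1 Omega C ^+ 2.
  rewrite -(snorm_sqr hL2); apply: lerXn2r; rewrite ?nnegrE ?sqrtr_ge0//.
  exact: nL2_le_nH1.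
have rS : ip Omega (alpha p *: A.1 + beta p *: B.1) (alpha p *: A.1 + beta p *: B.1)
    <= mrho * S.
  have aA : W (alpha p *: A.1) by exact: (sip_domZ hL2).
  have bB1 : W (beta p *: B.1) by exact: (sip_domZ hL2).
  apply: (le_trans (sip_sqrD hL2 aA bB1)).
  rewrite !(sipZ hL2)// !(sipZr hL2)//.
  have := ler_wpM2l (sqr_ge0 (alpha p)) (le_trans (LA A) bA).
  have := ler_wpM2l (sqr_ge0 (beta p)) (le_trans (LA B) bB).
  rewrite /mrho; lra.
have [e1 e2] := mech_err_bound oO l0 m0 Cis0 infsup me.
have XX0 : 0 <= ip Omega X X by exact: (sip_ge0 hL2).
have bX : nL2 Omega X ^+ 2 <= mrho * S.
  rewrite (snorm_sqr hL2); apply: le_trans rS; apply: le_trans e1.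
  rewrite ler_peMl// lerDl; apply: mulr_ge0; first by apply: mulr_ge0 => //; exact: ltW.
  by apply: divr_ge0; [exact: sqr_ge0|apply: mulr_ge0 => //; exact: ltW].
have bU : nH1v Omega U ^+ 2 <= m_u * S.
  have gU0 : 0 <= ip_eps Omega U U by exact: (sip_ge0 hE).
  apply: (@le_trans _ _ ((CK * Num.sqrt (ip_eps Omega U U)) ^+ 2)).
    by apply: lerXn2r; rewrite ?nnegrE ?mulr_ge0 ?sqrtr_ge0 ?(ltW CK0)//; exact: korn.
  have -> : m_u * S = CK ^+ 2 * ((2 * mu p * lambda p)^-1 * (mrho * S)) by rewrite /m_u; ring.
  rewrite exprMn sqr_sqrtr//; apply: ler_wpM2l; first exact: sqr_ge0.
  by rewrite ler_pdivlMl ?mulr_gt0//; exact: le_trans e2 rS.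
have c0 k : 0 < k -> 0 <= CK ^+ 2 / (lambda p * k).
  by move=> k0; rewrite divr_ge0 ?sqr_ge0 ?mulr_ge0 ?ltW.
have p0 : 0 <= mphi := c0 _ K0; have q0 : 0 <= mpsi := c0 _ D0.
have r0 : 0 <= mrho.
  by apply: addr_ge0; apply: mulr_ge0 => //; apply: mulr_ge0 => //; exact: sqr_ge0.
have u0 : 0 <= m_u.
  apply: divr_ge0; first by apply: mulr_ge0 => //; exact: sqr_ge0.
  by apply: ltW; rewrite !mulr_gt0.
have pS := mulr_ge0 p0 S0; have qS := mulr_ge0 q0 S0.
have rS' := mulr_ge0 r0 S0; have uS := mulr_ge0 u0 S0.
have [s1 s2 s3 s4] := le_sum4 pS qS rS' uS.
rewrite /conv_cst 3!mulrDl.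
by split; [exact: (le_trans bU s4)|exact: (le_trans bX s3)|exact: (le_trans bA s1)|exact: (le_trans bB s2)].
Qed.

Lemma mechanics_err y z t :
  mechanics Omega GD p F y t -> mechanics Omega GD p F z t ->
  V (ev_u y t) -> V (ev_u z t) -> W (ev_xi y t) -> W (ev_xi z t) ->
  W (ev_phi y t).1 -> W (ev_phi z t).1 -> W (ev_psi y t).1 -> W (ev_psi z t).1 ->
  mech_err Omega GD (lambda p) (mu p) (ev_u y t - ev_u z t) (ev_xi y t - ev_xi z t)
    (alpha p *: ((ev_phi y t).1 - (ev_phi z t).1) +
     beta p *: ((ev_psi y t).1 - (ev_psi z t).1)).
Proof.
have [[_ _ l0] _ _ _ _] := hp.
move=> [y1 y2] [z1 z2] uy uz xy xz fy fz gy gz.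
have Wf := sip_domB hL2 fy fz; have Wg := sip_domB hL2 gy gz.
split.
- split; [exact: (VDB d1 oO bO uy uz)|exact: (sip_domB hL2)|].
  by apply: (sip_domD hL2); exact: (sip_domZ hL2).
- move=> v hv; have Wv : W (divg v) by apply: divg_in => //; exact: (VD_vdom hv).
  rewrite (sipB hE) ?(sipB hL2)//; [|exact: (VD_vdom uy)|exact: (VD_vdom uz)|exact: (VD_vdom hv)].
  by have := y1 v hv; have := z1 v hv; lra.
- move=> w hw; rewrite divgB (sipB hL2)//; [|exact/(divg_in mO)/(VD_vdom uy)|exact/(divg_in mO)/(VD_vdom uz)].
  rewrite (sipB hL2 xy xz hw) (sipD hL2)//; [|exact: (sip_domZ hL2)..].
  rewrite !(sipZ hL2)// !(sipB hL2)//.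
  (* The second mechanics equation multiplied by lambda, as [mech_err] has it. *)
  have eq_la a b c e : a + (lambda p)^-1 * b - alpha p / lambda p * c - beta p / lambda p * e = 0 ->
      lambda p * a + b = alpha p * c + beta p * e.
    move=> h; have -> : a = alpha p / lambda p * c + beta p / lambda p * e - (lambda p)^-1 * b by lra.
    by field; rewrite gt_eqF.
  by have := eq_la _ _ _ _ (y2 w hw); have := eq_la _ _ _ _ (z2 w hw); lra.
Qed.

Lemma transport_err y z (dx dx' : R -> D -> R) t q :
  transport Omega p F dx y t -> transport Omega p F dx' z t ->
  hdom Omega (ev_phi y t) -> hdom Omega (ev_phi z t) ->
  hdom Omega (ev_psi y t) -> hdom Omega (ev_psi z t) ->
  W (dx t) -> W (dx' t) -> W (ev_dphi y t) -> W (ev_dphi z t) ->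
  W (ev_dpsi y t) -> W (ev_dpsi z t) -> Q q ->
  trans_err Omega (kK p) (kD p) (gamma p)
    ((alpha p / lambda p) *: (dx t - dx' t)
     - (c1 p + alpha p ^+ 2 / lambda p) *: (ev_dphi y t - ev_dphi z t)
     - (alpha p * beta p / lambda p - b0 p) *: (ev_dpsi y t - ev_dpsi z t))
    ((beta p / lambda p) *: (dx t - dx' t)
     - (c2 p + beta p ^+ 2 / lambda p) *: (ev_dpsi y t - ev_dpsi z t)
     - (alpha p * beta p / lambda p - b0 p) *: (ev_dphi y t - ev_dphi z t))
    (ev_phi y t - ev_phi z t) (ev_psi y t - ev_psi z t) q.
Proof.
move=> [y1 y2] [z1 z2] fy fz gy gz hx hx' hfy hfz hgy hgz Qq.
have hq := H10_hdom Qq; have [q1 q2] := hq.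
have [fy1 fy2] := fy; have [fz1 fz2] := fz; have [gy1 gy2] := gy; have [gz1 gz2] := gz.
have Wx := sip_domB hL2 hx hx'; have Wf := sip_domB hL2 hfy hfz.
have Wg := sip_domB hL2 hgy hgz.
have Wfyz := sip_domB hL2 fy1 fz1; have Wgyz := sip_domB hL2 gy1 gz1.
have ip3 a b c u v w : W u -> W v -> W w ->
    ip Omega (a *: u - b *: v - c *: w) q.1 =
    a * ip Omega u q.1 - b * ip Omega v q.1 - c * ip Omega w q.1.
  move=> hu hv hw; have au := sip_domZ hL2 a hu; have bv := sip_domZ hL2 b hv.
  have cw := sip_domZ hL2 c hw; have auv := sip_domB hL2 au bv.
  by rewrite (sipB hL2 auv cw q1) (sipB hL2 au bv q1) !(sipZ hL2).
have ip2 u v : W u -> W v -> ip Omega (u - v) q.1 = ip Omega u q.1 - ip Omega v q.1.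
  by move=> hu hv; exact: (sipB hL2).
have := y1 q Qq; have := y2 q Qq; have := z1 q Qq; have := z2 q Qq.
rewrite !ip2// => e1 e2 e3 e4; split => //.
- rewrite ip3// (sipB hG)// -[(_ - _).1]/((ev_phi y t).1 - (ev_phi z t).1).
  rewrite -[(_ - _).1 in X in ip _ (_ - X)]/((ev_psi y t).1 - (ev_psi z t).1) !ip2//; lra.
- rewrite ip3// (sipB hG)// -[(_ - _).1]/((ev_psi y t).1 - (ev_psi z t).1).
  rewrite -[(_ - _).1 in X in ip _ (_ - X)]/((ev_phi y t).1 - (ev_phi z t).1) !ip2//; lra.
Qed.

(** The inverse square of the contraction factor: the step is stated for squared norms. *)
Definition xi_contraction := 1 + 2 * lambda p * (Cis ^+ 2 / (2 * mu p)).

(** The previous pressure enters as an arbitrary [x] with time derivative [dx]. Thus the lemma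
    covers the initial guess, of which nothing else is known, and also a coupled solution seen as
    its own predecessor. *)
Lemma iteration_step (z y : evolution R d) (x dx : R -> D -> R) :
  coupled_solution Omega GD T p F I0 z ->
  time_H1 W (nL2 Omega) T x dx ->
  regular_u_xi Omega GD T y ->
  time_parabolic Omega T (ev_phi y) (ev_dphi y) ->
  time_parabolic Omega T (ev_psi y) (ev_dpsi y) ->
  {ae leb1, forall t, t \in `]0, T] ->
     transport Omega p F dx y t /\ mechanics Omega GD p F y t} ->
  initial_u_xi Omega p I0 y ->
  nL2 Omega ((ev_phi y 0).1 - (init_phi I0).1) = 0 ->
  nL2 Omega ((ev_psi y 0).1 - (init_psi I0).1) = 0 ->
  xi_contraction * sqr_L2L2 (ev_dxi y - ev_dxi z) <= sqr_L2L2 (dx - ev_dxi z) /\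
  {ae leb1, forall t, E t ->
     [/\ nH1v Omega (ev_u y t - ev_u z t) ^+ 2 <= conv_cst * sqr_L2L2 (dx - ev_dxi z),
         nL2 Omega (ev_xi y t - ev_xi z t) ^+ 2 <= conv_cst * sqr_L2L2 (dx - ev_dxi z),
         nH1 Omega (ev_phi y t - ev_phi z t) ^+ 2 <= conv_cst * sqr_L2L2 (dx - ev_dxi z) &
         nH1 Omega (ev_psi y t - ev_psi z t) ^+ 2 <= conv_cst * sqr_L2L2 (dx - ev_dxi z)]}.
Proof.
have [[a0 b0' l0] [m0 K0 D0] [c10 c20 b00 g0] cb1 cb2] := hp.
have [Vu0 Qphi0 Qpsi0] := hI0.
move=> [[hzu hzxi] [hzphi hzpsi] aez [zu0 zxi0] [zphi0 zpsi0]].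
move=> hx [hyu hyxi] hyphi hypsi aey [yu0 yxi0] yphi0 ypsi0.
have [zphiL2 zphiH1] := time_H1_H10_parabolic hzphi.
have [zpsiL2 zpsiH1] := time_H1_H10_parabolic hzpsi.
have [yphiL2 yphiH1] := hyphi; have [ypsiL2 ypsiH1] := hypsi.
have [Z1 w1] := wreg_of_time_H1 hL2 T0 hyxi.
have [Z2 w2] := wreg_of_time_H1 hL2 T0 hzxi.
have [Z3 w3] := wreg_of_time_H1 hL2 T0 hx.
have [Z4 w4] := wreg_of_time_H1 hL2 T0 yphiH1.
have [Z5 w5] := wreg_of_time_H1 hL2 T0 zphiH1.
have [Z6 w6] := wreg_of_time_H1 hL2 T0 ypsiH1.
have [Z7 w7] := wreg_of_time_H1 hL2 T0 zpsiH1.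
have [N8 [mN8 N80 sN8]] : leb1.-negligible (~` [set t | E t -> Q (ev_phi y t)]) := yphiL2.1.1.
have [N9 [mN9 N90 sN9]] : leb1.-negligible (~` [set t | E t -> Q (ev_psi y t)]) := ypsiL2.1.1.
have [N10 [mN10 N100 sN10]] : leb1.-negligible (~` [set t | E t -> Q (ev_phi z t)]) := zphiL2.1.1.
have [N11 [mN11 N110 sN11]] : leb1.-negligible (~` [set t | E t -> Q (ev_psi z t)]) := zpsiL2.1.1.
have [N12 [mN12 N120 sN12]] := aey.
have [N13 [mN13 N130 sN13]] := aez.
have wnull Z' u du : wreg W (ip Omega) T Z' u du -> measurable Z' /\ leb1 Z' = 0%E by case.
(* A single null set outside which all regularity properties and all equations hold; the numbers
   used below are positions in this list. *)
have [Z [mZ Z0 sZ]] := @null_cover R [:: Z1; Z2; Z3; Z4; Z5; Z6; Z7; N8; N9; N10; N11; N12; N13]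
  (conj (wnull _ _ _ w1) (conj (wnull _ _ _ w2) (conj (wnull _ _ _ w3) (conj (wnull _ _ _ w4)
  (conj (wnull _ _ _ w5) (conj (wnull _ _ _ w6) (conj (wnull _ _ _ w7) (conj (conj mN8 N80)
  (conj (conj mN9 N90) (conj (conj mN10 N100) (conj (conj mN11 N110) (conj (conj mN12 N120)
  (conj (conj mN13 N130) I))))))))))))).
have wZ Z' u du : wreg W (ip Omega) T Z' u du -> Z' `<=` Z -> wreg W (ip Omega) T Z u du.
  by move=> hw sZ'; have := wreg_null hL2 hw mZ Z0; rewrite (_ : Z' `|` Z = Z)//; exact/setUidPr.
have {}w1 := wZ _ _ _ w1 (sZ 0%N isT).
have {}w2 := wZ _ _ _ w2 (sZ 1%N isT).
have {}w3 := wZ _ _ _ w3 (sZ 2%N isT).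
have {}w4 := wZ _ _ _ w4 (sZ 3%N isT).
have {}w5 := wZ _ _ _ w5 (sZ 4%N isT).
have {}w6 := wZ _ _ _ w6 (sZ 5%N isT).
have {}w7 := wZ _ _ _ w7 (sZ 6%N isT).
have aeZ (P : R -> Prop) N : ~` [set t | P t] `<=` N -> N `<=` Z -> forall t, ~ Z t -> P t.
  by move=> PN NZ t Zt; apply: contrapT => nP; exact/Zt/NZ/PN.
have {}sN8 := aeZ _ _ sN8 (sZ 7%N isT).
have {}sN9 := aeZ _ _ sN9 (sZ 8%N isT).
have {}sN10 := aeZ _ _ sN10 (sZ 9%N isT).
have {}sN11 := aeZ _ _ sN11 (sZ 10%N isT).
have {}sN12 := aeZ _ _ sN12 (sZ 11%N isT).
have {}sN13 := aeZ _ _ sN13 (sZ 12%N isT).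
have wB u du v dv : wreg W (ip Omega) T Z u du -> wreg W (ip Omega) T Z v dv ->
    wreg W (ip Omega) T Z (fun t => u t - v t) (fun t => du t - dv t).
  by move=> hu hv; have := wregB hL2 T0 hu hv; rewrite setUid.
have hxi := wB _ _ _ _ w1 w2.
have hphi := wB _ _ _ _ w4 w5.
have hpsi := wB _ _ _ _ w6 w7.
have hrho : wreg W (ip Omega) T Z
    (fun t => alpha p *: ((ev_phi y t).1 - (ev_phi z t).1) + beta p *: ((ev_psi y t).1 - (ev_psi z t).1))
    (fun t => alpha p *: (ev_dphi y t - ev_dphi z t) + beta p *: (ev_dpsi y t - ev_dpsi z t)).
  by have := wregD hL2 T0 (wregZ hL2 T0 (alpha p) hphi) (wregZ hL2 T0 (beta p) hpsi); rewrite setUid.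
pose DZ := E `\` Z.
have mDZ : measurable DZ := measurable_domD T mZ.
have sx : sqint W (ip Omega) DZ (fun t => dx t - ev_dxi z t).
  by case: w2 => _ _ s2 _ _; case: w3 => _ _ s3 _ _; exact: (sqintB hL2 mDZ s3 s2).
have T00 : 0 \in `[0, T] by rewrite in_itv/= lexx ltW.
have DZ0T t : DZ t -> t \in `[0, T].
  by move=> [/= + _]; rewrite !in_itv/= => /andP[? ?]; rewrite !ltW.
have DZT t : DZ t -> t \in `]0, T].
  by move=> [/= + _]; rewrite !in_itv/= => /andP[-> ?]; rewrite ltW.
have yuV t : t \in `[0, T] -> V (ev_u y t) by case: hyu => _ _ _ H /H[].
have zuV t : t \in `[0, T] -> V (ev_u z t) by case: hzu => _ _ _ H /H[].
have inW Z' u du t : wreg W (ip Omega) T Z' u du -> t \in `[0, T] -> W (u t).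
  by move=> [_ _ _ H _]; exact: H.
have inWd u du t : wreg W (ip Omega) T Z u du -> DZ t -> W (du t).
  by move=> [_ _ [[H _] _] _ _]; exact: H.
have phi0 : nL2 Omega ((ev_phi y 0).1 - (ev_phi z 0).1) = 0.
  have z0 : nL2 Omega ((ev_phi z 0).1 - (init_phi I0).1) = 0.
    have := nL2_le_nH1 mO (ev_phi z 0 - init_phi I0); rewrite zphi0 => le0.
    by apply/eqP; rewrite eq_le sqrtr_ge0 andbT; exact: le0.
  exact: (snorm_null_dist hL2 (inW _ _ _ _ w4 T00) (inW _ _ _ _ w5 T00) (H10_hdom Qphi0).1 yphi0 z0).
have psi0 : nL2 Omega ((ev_psi y 0).1 - (ev_psi z 0).1) = 0.
  have z0 : nL2 Omega ((ev_psi z 0).1 - (init_psi I0).1) = 0.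
    have := nL2_le_nH1 mO (ev_psi z 0 - init_psi I0); rewrite zpsi0 => le0.
    by apply/eqP; rewrite eq_le sqrtr_ge0 andbT; exact: le0.
  exact: (snorm_null_dist hL2 (inW _ _ _ _ w6 T00) (inW _ _ _ _ w7 T00) (H10_hdom Qpsi0).1 ypsi0 z0).
pose rho t := alpha p *: ((ev_phi y t).1 - (ev_phi z t).1) + beta p *: ((ev_psi y t).1 - (ev_psi z t).1).
have me t : DZ t \/ t = 0 -> mech_err Omega GD (lambda p) (mu p)
    (ev_u y t - ev_u z t) (ev_xi y t - ev_xi z t)
    (alpha p *: ((ev_phi y t).1 - (ev_phi z t).1) + beta p *: ((ev_psi y t).1 - (ev_psi z t).1)).
  move=> [Dt|->].
    have Tt := DZ0T t Dt; have [_ my] := sN12 t Dt.2 (DZT t Dt).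
    have [mz _] := sN13 t Dt.2 (DZT t Dt).
    apply: (mechanics_err my mz); [exact: yuV|exact: zuV|exact: inW w1 Tt|exact: inW w2 Tt|
      exact: inW w4 Tt|exact: inW w5 Tt|exact: inW w6 Tt|exact: inW w7 Tt].
  have {}Vu0 : vdom Omega (init_u I0) := VD_vdom Vu0.
  have Wp0 : W (init_phi I0).1 by have [] := H10_hdom Qphi0.
  have Wq0 : W (init_psi I0).1 by have [] := H10_hdom Qpsi0.
  have Wxi0 : W (init_xi p I0).
    have Wd : W (divg (init_u I0)) by exact: (divg_in mO Vu0).
    apply: (sip_domD hL2); last exact: (sip_domZ hL2).
    by apply: (sip_domD hL2); exact: (sip_domZ hL2).
  have Vy := yuV _ T00; have Vz := zuV _ T00.
  have Wf : W ((ev_phi y 0).1 - (ev_phi z 0).1) := sip_domB hL2 (inW _ _ _ _ w4 T00) (inW _ _ _ _ w5 T00).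
  have Wg : W ((ev_psi y 0).1 - (ev_psi z 0).1) := sip_domB hL2 (inW _ _ _ _ w6 T00) (inW _ _ _ _ w7 T00).
  apply: (mech_err_null oO).
  - exact: (VDB d1 oO bO Vy Vz).
  - exact: (sip_domB hL2 (inW _ _ _ _ w1 T00) (inW _ _ _ _ w2 T00)).
  - by apply: (sip_domD hL2); exact: (sip_domZ hL2).
  - exact: (nH1v_null_dist (VD_vdom Vy) (VD_vdom Vz) Vu0 yu0 zu0).
  - exact: (snorm_null_dist hL2 (inW _ _ _ _ w1 T00) (inW _ _ _ _ w2 T00) Wxi0 yxi0 zxi0).
  - apply/eqP; rewrite eq_le sqrtr_ge0 andbT.
    apply: le_trans (snormD hL2 (sip_domZ hL2 (alpha p) Wf) (sip_domZ hL2 (beta p) Wg)) _.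
    rewrite (snormZ hL2 (alpha p) Wf) (snormZ hL2 (beta p) Wg).
    have phi0' : snorm (ip Omega) ((ev_phi y 0).1 - (ev_phi z 0).1) = 0 := phi0.
    have psi0' : snorm (ip Omega) ((ev_psi y 0).1 - (ev_psi z 0).1) = 0 := psi0.
    by rewrite phi0' psi0' !mulr0 addr0.
have hle t s : DZ t -> DZ s \/ s = 0 -> xi_contraction *
    ip Omega ((ev_xi y t - ev_xi z t) - (ev_xi y s - ev_xi z s)) ((ev_xi y t - ev_xi z t) - (ev_xi y s - ev_xi z s)) <=
    ip Omega (rho t - rho s) (rho t - rho s).
  move=> Dt Ds; have Dt' : DZ t \/ t = 0 by left.
  have [+ _] := mech_err_bound oO l0 m0 Cis0 infsup (mech_errB d1 oO bO (me _ Dt') (me _ Ds)).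
  by [].
have k0 : 0 <= xi_contraction.
  apply: addr_ge0 => //; apply: mulr_ge0; first by apply: mulr_ge0 => //; exact: ltW.
  by apply: divr_ge0; [exact: sqr_ge0|apply: mulr_ge0 => //; exact: ltW].
have xi_rho := wreg_le hL2 T0 hxi hrho k0 hle.
have hd t : DZ t -> [/\ hdom Omega (ev_phi y t), hdom Omega (ev_phi z t),
    hdom Omega (ev_psi y t) & hdom Omega (ev_psi z t)].
  by move=> [Et Zt]; split; apply: H10_hdom; [exact: sN8|exact: sN10|exact: sN9|exact: sN11].
pose A t := ev_phi y t - ev_phi z t; pose B t := ev_psi y t - ev_psi z t.
have hAB t : DZ t -> hdom Omega (A t) /\ hdom Omega (B t).
  by move=> /hd[h1 h2 h3 h4]; split; exact: (sip_domB hH).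
pose F1 t := (alpha p / lambda p) *: (dx t - ev_dxi z t)
     - (c1 p + alpha p ^+ 2 / lambda p) *: (ev_dphi y t - ev_dphi z t)
     - (alpha p * beta p / lambda p - b0 p) *: (ev_dpsi y t - ev_dpsi z t).
pose F2 t := (beta p / lambda p) *: (dx t - ev_dxi z t)
     - (c2 p + beta p ^+ 2 / lambda p) *: (ev_dpsi y t - ev_dpsi z t)
     - (alpha p * beta p / lambda p - b0 p) *: (ev_dphi y t - ev_dphi z t).
have WF t : DZ t -> W (F1 t) /\ W (F2 t).
  move=> Dt; have wx : W (dx t - ev_dxi z t) := sip_domB hL2 (inWd _ _ _ w3 Dt) (inWd _ _ _ w2 Dt).
  have wf : W (ev_dphi y t - ev_dphi z t) := sip_domB hL2 (inWd _ _ _ w4 Dt) (inWd _ _ _ w5 Dt).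
  have wg : W (ev_dpsi y t - ev_dpsi z t) := sip_domB hL2 (inWd _ _ _ w6 Dt) (inWd _ _ _ w7 Dt).
  by split; do 2 (apply: (sip_domB hL2); last exact: (sip_domZ hL2)); exact: (sip_domZ hL2).
have tQ t q : DZ t -> Q q -> trans_err Omega (kK p) (kD p) (gamma p) (F1 t) (F2 t) (A t) (B t) q.
  move=> Dt Qq; have [h1 h2 h3 h4] := hd _ Dt.
  have [ty _] := sN12 t Dt.2 (DZT t Dt); have [_ tz] := sN13 t Dt.2 (DZT t Dt).
  exact: (transport_err ty tz h1 h2 h3 h4 (inWd _ _ _ w3 Dt) (inWd _ _ _ w2 Dt)
    (inWd _ _ _ w4 Dt) (inWd _ _ _ w5 Dt) (inWd _ _ _ w6 Dt) (inWd _ _ _ w7 Dt) Qq).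
(* The equations at time [t] are tested with the errors at time [s], by subtracting the tests with
   the values of [y] and of [z] at [s]. *)
have tAB t s : DZ t -> DZ s ->
    trans_err Omega (kK p) (kD p) (gamma p) (F1 t) (F2 t) (A t) (B t) (A s) /\
    trans_err Omega (kK p) (kD p) (gamma p) (F1 t) (F2 t) (A t) (B t) (B s).
  move=> Dt Ds; have [At Bt] := hAB _ Dt; have [f1 f2] := WF _ Dt.
  split; apply: (trans_errB oO f1 f2 At Bt); apply: (tQ t _ Dt).
  - exact: (sN8 s Ds.2 Ds.1).
  - exact: (sN10 s Ds.2 Ds.1).
  - exact: (sN9 s Ds.2 Ds.1).
  - exact: (sN11 s Ds.2 Ds.1).
pose En t := trans_energy Omega (kK p) (kD p) (gamma p) (A t) (B t).
have En0 t : DZ t -> 0 <= En t by move=> _; exact: (trans_energy_ge0 oO).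
have EnE t : DZ t -> En t = ip Omega (F1 t) (A t).1 + ip Omega (F2 t) (B t).1.
  by move=> Dt; have [tA tB] := tAB _ _ Dt Dt; exact: (trans_energyE oO tA tB).
have EnB t s : DZ t -> DZ s -> En t - En s <=
    2 * (ip Omega (F1 t) ((A t).1 - (A s).1) + ip Omega (F2 t) ((B t).1 - (B s).1)).
  move=> Dt Ds; have [tA tB] := tAB _ _ Dt Dt; have [tA' tB'] := tAB _ _ Dt Ds.
  have [As Bs] := hAB _ Ds; have [f1 f2] := WF _ Dt.
  exact: (trans_energyB oO K0 D0 g0 As Bs f1 f2 tA tB tA' tB').
have sq0 u : nL2 Omega u = 0 -> ip Omega u u = 0.
  by move=> u0; rewrite -(snorm_sqr hL2) -[snorm _ u]/(nL2 Omega u) u0 expr0n.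
have bc1 : b0 p <= c1 p by rewrite -subr_ge0.
have bc2 : b0 p <= c2 p by rewrite -subr_ge0.
have [rho_eta En_eta] := energy_estimate hL2 T0 l0 b00 bc1 bc2 hphi hpsi sx
  (sq0 _ phi0) (sq0 _ psi0) En0 EnE EnB.
split.
  rewrite !(sqr_L2L2_setD _ mZ Z0); exact: le_trans xi_rho rho_eta.
have nZt : {ae leb1, forall t, ~ Z t}.
  by exists Z; split => // t /= nnZ; apply: contrapT => nZ; exact: nnZ.
apply: (@filterS2 _ _ (ae_filter_ringOfSetsType leb1)) nZt En_eta => t Zt Ent Et.
have Dt : DZ t by split.
apply: error_bounds.
- apply: (H1_zero_traceB d1 oO bO); apply: (H10_zero_trace GD d1 oO).
    exact: (sN8 t Zt Et).
  exact: (sN10 t Zt Et).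
- apply: (H1_zero_traceB d1 oO bO); apply: (H10_zero_trace GD d1 oO).
    exact: (sN9 t Zt Et).
  exact: (sN11 t Zt Et).
- by apply: Rintegral_ge0 => s _; exact: sqr_ge0.
- by have := Ent Et; rewrite (sqr_L2L2_setD _ mZ Z0).
- by apply: me; left.
Qed.

End iteration.

(** * Essential suprema in time and continuous representatives *)

Section time_norms.
Context (R : realType) (V : lmodType R) (X : set V) (N : V -> R) (T : R).
Hypotheses (T0 : 0 < T) (N0 : forall v, 0 <= N v).
Local Notation mu := (@lebesgue_measure R).
Local Notation E := (`]0, T[%classic : set R).

Lemma time_Linf_norm_ge0 (w : R -> V) : (0 <= time_Linf_norm N T w)%E.
Proof.
apply: (@ess_sup_gee _ _ _ mu).
  apply: lt_le_trans (_ : (0 < mu `]0%R, T[%classic)%E) _.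
    by rewrite lebesgue_measure_itv/= lte_fin T0 sube0 lte_fin.
  by apply: le_measure; rewrite ?inE//.
by apply: (@filterE _ _ (ae_filter_ringOfSetsType mu)) => t; apply: erestrict_ge0 => s _; rewrite lee_fin.
Qed.

Lemma time_Linf_norm_le (w : R -> V) (b : R) : 0 <= b ->
  {ae mu, forall t, E t -> N (w t) ^+ 2 <= b} ->
  (time_Linf_norm N T w <= (Num.sqrt b)%:E)%E.
Proof.
move=> b0 wb; apply/(@ess_supP _ _ _ mu).
apply: (@filterS _ _ (ae_filter_ringOfSetsType mu)) wb => t wt.
rewrite /patch; case: ifPn => [/set_mem Et|_]; rewrite lee_fin ?sqrtr_ge0//.
by rewrite -(@ler_pXn2r _ 2)// ?nnegrE ?sqrtr_ge0// sqr_sqrtr// wt.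
Qed.

(** The bounds concern the indices from 1 on, since nothing is known of the initial guess; the limit
    does not see the shift. *)
Lemma time_Linf_norm_cvg (w : nat -> R -> V) (b : nat -> R) :
  (forall i, 0 <= b i) -> b i @[i --> \oo] --> 0 ->
  (forall i, {ae mu, forall t, E t -> N (w i.+1 t) ^+ 2 <= b i}) ->
  time_Linf_norm N T (w i) @[i --> \oo] --> 0%E.
Proof.
move=> b0 cb wb; rewrite -(cvg_shiftS (fun i => time_Linf_norm N T (w i))).
apply: near_cvge0 => [i|e e0]; first exact: time_Linf_norm_ge0.
have e2 : 0 < e ^+ 2 by rewrite exprn_gt0.
move/cvgrPdist_lt : cb => /(_ _ e2); apply: filterS => i.
rewrite sub0r normrN ger0_norm// => bi.
apply: le_trans (time_Linf_norm_le (b0 i) (wb i)) _; rewrite lee_fin.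
by rewrite -(@ler_pXn2r _ 2)// ?nnegrE ?sqrtr_ge0 ?(ltW e0)// sqr_sqrtr// ltW.
Qed.

Hypothesis tri : forall a b c, X a -> X b -> X c -> N (a - b) <= N (a - c) + N (c - b).
Hypothesis sym : forall a b, X a -> X b -> N (a - b) = N (b - a).

(** Arbitrarily close to any [t] of [0, T] there is a time at which the two functions agree, because
    a null set contains no interval; continuity carries the equality over to [t]. *)
Lemma time_H1_ae_eq (u du v dv : R -> V) :
  time_H1 X N T u du -> time_H1 X N T v dv ->
  {ae mu, forall t, E t -> N (u t - v t) ^+ 2 <= 0} ->
  forall t, t \in `[0, T] -> N (u t - v t) = 0.
Proof.
move=> [_ _ _ hu] [_ _ _ hv] [Z [mZ Z0 uvZ]] t tT.
have [Xu cu] := hu t tT; have [Xv cv] := hv t tT.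
apply/eqP; rewrite eq_le N0 andbT; apply/ler_addgt0Pr => e e0; rewrite add0r.
have e2 : 0 < e / 2 by rewrite divr_gt0.
move/cvgrPdist_lt : cu => /(_ _ e2) /nbhs_ballP [r1 /= r10 h1].
move/cvgrPdist_lt : cv => /(_ _ e2) /nbhs_ballP [r2 /= r20 h2].
pose r := Num.min r1 r2.
have r0 : 0 < r by rewrite lt_min r10.
have /andP[t0 tT'] : 0 <= t <= T by move: tT; rewrite in_itv.
(* Cutting the neighbourhood to ]0, T[ leaves a nonempty interval even when [t] is an end point. *)
pose I := `]Num.max 0 (t - r), Num.min T (t + r)[%classic : set R.
have Ilt : Num.max 0 (t - r) < Num.min T (t + r).
  by rewrite gt_max !lt_min T0/=; apply/andP; split; [|apply/andP; split]; lra.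
have [s [Is nZs]] : exists s, I s /\ ~ Z s.
  apply: contrapT => H; have IZ : I `<=` Z.
    by move=> s Is; apply: contrapT => nZ; apply: H; exists s.
  have : (mu I <= mu Z)%E by apply: le_measure; rewrite ?inE//; exact: measurable_itv.
  rewrite [mu Z]Z0 [mu I]lebesgue_measure_itv/= lte_fin Ilt lee_fin.
  by rewrite subr_le0 leNgt Ilt.
move: Is; rewrite /I/= in_itv/= gt_max lt_min => /andP[/andP[s0 ts] /andP[sT st]].
have sE : E s by rewrite /= in_itv/= s0.
have s0T : s \in `[0, T] by rewrite in_itv/= !ltW.
have [Xus _] := hu s s0T; have [Xvs _] := hv s s0T.
have ball_s r' : r <= r' -> ball t r' s.
  move=> rr; rewrite /ball/= distrC ltr_distl; apply/andP; split; lra.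
have us : N (u s - u t) < e / 2.
  have := h1 s (ball_s r1 _) s0T; rewrite sub0r normrN ger0_norm//; apply.
  by rewrite ge_min lexx.
have vs : N (v s - v t) < e / 2.
  have := h2 s (ball_s r2 _) s0T; rewrite sub0r normrN ger0_norm//; apply.
  by rewrite ge_min lexx orbT.
have uvs : N (u s - v s) = 0.
  apply/eqP; rewrite -sqrf_eq0 eq_le sqr_ge0 andbT.
  suff : E s -> N (u s - v s) ^+ 2 <= 0 by exact.
  by apply: contrapT => nuv; exact/nZs/uvZ.
have := tri Xu Xv Xus; have := tri Xus Xv Xvs.
rewrite uvs (sym Xu Xus); lra.
Qed.

End time_norms.

(** * Convergence *)

Lemma geometric_decay (R : realType) (k : R) (S : nat -> R) : 1 < k ->
  (forall i, 0 <= S i) -> (forall i, k * S i.+1 <= S i) -> S i @[i --> \oo] --> 0.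
Proof.
move=> k1 S0 kS; have k0 : 0 < k by exact: lt_trans ltr01 k1.
have Sle i : S i <= k^-1 ^+ i * S 0%N.
  elim: i => [|i IH]; first by rewrite expr0 mul1r.
  rewrite exprS -mulrA ler_pdivlMl//; exact: le_trans (kS i) IH.
have q1 : `|k^-1| < 1 by rewrite ger0_norm ?invr_ge0 ?ltW// invf_lt1.
have : k^-1 ^+ i * S 0%N @[i --> \oo] --> 0 * S 0%N by apply: cvgMr_tmp; exact: cvg_expr.
rewrite mul0r => cq.
apply: (@squeeze_dist R _ _ _ _ (fun i => k^-1 ^+ i * S 0%N)) cq.
by apply: nearW => i; rewrite sub0r normrN ger0_norm.
Qed.

Lemma snorm_tri (R : realType) (V : lmodType R) (X : set V) (B : V -> V -> R)
    (hB : semi_ip X B) a b c : X a -> X b -> X c ->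
  snorm B (a - b) <= snorm B (a - c) + snorm B (c - b).
Proof.
move=> Xa Xb Xc; have -> : a - b = (a - c) + (c - b) by rewrite addrA subrK.
by apply: (snormD hB); exact: (sip_domB hB).
Qed.

Section convergence.
Context (R : realType) (d : nat) (Omega GD : set 'rV[R]_d).
Hypotheses (d1 : (1 < d)%N) (oO : open Omega) (bO : bounded_set Omega).
Context (T : R) (p : coefficients R) (F : sources R d) (I0 : initial_data R d).
Hypotheses (T0 : 0 < T) (hp : admissible p) (hI0 : regular_initial_data Omega GD I0).
Local Notation W := (L2 Omega).
Local Notation V := (VD Omega GD).
Local Notation Q := (H10 Omega).
Local Notation leb1 := (@lebesgue_measure R).

Let mO : measurable Omega. Proof. exact: open_measurable_rV. Qed.

Context (Cis CK : R).
Hypotheses (Cis0 : 0 < Cis) (CK0 : 0 < CK).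
Hypothesis infsup : forall w, W w ->
  ((Cis * nL2 Omega w)%:E <=
   ereal_sup [set (ip Omega (divg v) w / nH1v Omega v)%:E |
                v in [set v | V v /\ nH1v Omega v != 0%R]])%E.
Hypothesis korn : forall v, V v -> nH1v Omega v <= CK * Num.sqrt (ip_eps Omega v v).

Let hstep := iteration_step d1 oO bO (F := F) T0 hp hI0 Cis0 CK0 infsup korn.
Let k := xi_contraction p Cis.
Let M := conv_cst p CK.

Lemma xi_contraction_gt1 : 1 < k.
Proof.
have [[_ _ l0] [m0 _ _] _ _ _] := hp.
by rewrite /k /xi_contraction ltrDl !mulr_gt0// ?invr_gt0 ?mulr_gt0// exprn_gt0.
Qed.

Lemma sqr_L2L2_ge0 w : 0 <= sqr_L2L2 Omega T w.
Proof. by apply: Rintegral_ge0 => t _; exact: sqr_ge0. Qed.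

Lemma conv_cst_ge0 : 0 <= M.
Proof.
have [[a0 b0 l0] [m0 K0 D0] _ _ _] := hp.
have c0 x : 0 < x -> 0 <= CK ^+ 2 / (lambda p * x).
  by move=> x0; apply: divr_ge0; [exact: sqr_ge0|apply: ltW; rewrite mulr_gt0].
have r0 : 0 <= 2 * alpha p ^+ 2 * (CK ^+ 2 / (lambda p * kK p)) +
    2 * beta p ^+ 2 * (CK ^+ 2 / (lambda p * kD p)).
  apply: addr_ge0; apply: mulr_ge0; try exact: c0;
    by apply: mulr_ge0 => //; exact: sqr_ge0.
apply: addr_ge0; first by apply: addr_ge0 => //; apply: addr_ge0; exact: c0.
apply: divr_ge0; first by apply: mulr_ge0 => //; exact: sqr_ge0.
by apply: ltW; rewrite !mulr_gt0.
Qed.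

Section iteration.
Context (z : evolution R d) (y : nat -> evolution R d).
Hypotheses (hz : coupled_solution Omega GD T p F I0 z)
           (hy : decoupled_iteration Omega GD T p F I0 y).

Let S i := sqr_L2L2 Omega T (ev_dxi (y i) - ev_dxi z).

Lemma iteration_xi i : time_H1 W (nL2 Omega) T (ev_xi (y i)) (ev_dxi (y i)).
Proof. by case: i => [|i]; [case: hy|have [_ /(_ i)[[]]] := hy]. Qed.

Let stepi i : k * S i.+1 <= S i /\ {ae leb1, forall t, `]0, T[%classic t ->
   [/\ nH1v Omega (ev_u (y i.+1) t - ev_u z t) ^+ 2 <= M * S i,
       nL2 Omega (ev_xi (y i.+1) t - ev_xi z t) ^+ 2 <= M * S i,
       nH1 Omega (ev_phi (y i.+1) t - ev_phi z t) ^+ 2 <= M * S i &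
       nH1 Omega (ev_psi (y i.+1) t - ev_psi z t) ^+ 2 <= M * S i]}.
Proof.
have [_ /(_ i)[hu [hphi hpsi] ae [u0 xi0] [phi0 psi0]]] := hy.
exact: (hstep hz (iteration_xi i) hu hphi hpsi ae (conj u0 xi0) phi0 psi0).
Qed.

Lemma err_dxi_contraction i : k * S i.+1 <= S i.
Proof. by case: (stepi i). Qed.

Lemma iteration_converges : converges_to Omega T y z.
Proof.
have M0 := conv_cst_ge0.
have S0 i : 0 <= S i by exact: sqr_L2L2_ge0.
have MS0 i : 0 <= M * S i by exact: mulr_ge0.
have cS : M * S i @[i --> \oo] --> 0.
  have := geometric_decay xi_contraction_gt1 S0 err_dxi_contraction.
  by move=> cS; rewrite -(mulr0 M); exact: cvgMl_tmp.
have FF := ae_filter_ringOfSetsType leb1.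
have nV0 (v : hvec R d) : 0 <= nH1v Omega v by exact: sqrtr_ge0.
have nW0 v : 0 <= nL2 Omega v by exact: sqrtr_ge0.
have nQ0 v : 0 <= nH1 Omega v by exact: sqrtr_ge0.
split.
- apply: (time_Linf_norm_cvg T0 nV0 (w := fun i t => ev_u (y i) t - ev_u z t) MS0 cS) => i.
  by have [_] := stepi i; apply: (@filterS _ _ FF) => t h /h[].
- apply: (time_Linf_norm_cvg T0 nW0 (w := fun i t => ev_xi (y i) t - ev_xi z t) MS0 cS) => i.
  by have [_] := stepi i; apply: (@filterS _ _ FF) => t h /h[].
- apply: (time_Linf_norm_cvg T0 nQ0 (w := fun i t => ev_phi (y i) t - ev_phi z t) MS0 cS) => i.
  by have [_] := stepi i; apply: (@filterS _ _ FF) => t h /h[].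
- apply: (time_Linf_norm_cvg T0 nQ0 (w := fun i t => ev_psi (y i) t - ev_psi z t) MS0 cS) => i.
  by have [_] := stepi i; apply: (@filterS _ _ FF) => t h /h[].
Qed.

End iteration.

Lemma coupled_constant_iteration z : coupled_solution Omega GD T p F I0 z ->
  decoupled_iteration Omega GD T p F I0 (fun=> z).
Proof.
move=> [hu [hphi hpsi] ae hi [phi0 psi0]]; split; first by case: hu.
move=> _; split => //.
- by split; exact: time_H1_H10_parabolic.
- by apply: (@filterS _ _ (ae_filter_ringOfSetsType leb1)) ae => t H /H[].
- have nul v : nH1 Omega v = 0 -> nL2 Omega v.1 = 0.
    move=> v0; have := nL2_le_nH1 mO v; rewrite v0 => le0.
    by apply/eqP; rewrite eq_le sqrtr_ge0 andbT; exact: le0.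
  by split; [exact: (nul _ phi0)|exact: (nul _ psi0)].
Qed.

Lemma coupled_unique z z' : coupled_solution Omega GD T p F I0 z ->
  coupled_solution Omega GD T p F I0 z' -> same_evolution Omega T z' z.
Proof.
move=> hz hz'; have hy := coupled_constant_iteration hz'.
set S := sqr_L2L2 Omega T (ev_dxi z' - ev_dxi z).
(* Both consecutive errors of the constant iteration are [S], so the contraction reads k S <= S with
   k > 1. *)
have S0 : S = 0.
  apply/eqP; rewrite eq_le sqr_L2L2_ge0 andbT.
  have := err_dxi_contraction hz hy 0%N; rewrite -/S.
  have := xi_contraction_gt1; have : 0 <= S := sqr_L2L2_ge0 _; nra.
have [hu [hphi hpsi] _ _ _] := hz; have [hu' [hphi' hpsi'] ae' hi' [phi0' psi0']] := hz'.
have [_ /(_ 0%N)[_ [b1 b2] aey e [f1 f2]]] := hy.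
(* With [z'] as its own predecessor, the bounds of the step are multiples of [S], hence zero for
   almost every time. *)
have [_] := hstep hz hu'.2 hu' b1 b2 aey e f1 f2.
move=> H.
have FF := ae_filter_ringOfSetsType leb1.
have hL2 := semi_ip_L2 mO; have hH := semi_ip_H1 mO; have hV := semi_ip_H1v mO.
have [Dphi hDphi _] := hphi; have [Dphi' hDphi' _] := hphi'.
have [Dpsi hDpsi _] := hpsi; have [Dpsi' hDpsi' _] := hpsi'.
have nV0 (v : hvec R d) : 0 <= nH1v Omega v by exact: sqrtr_ge0.
have nW0 v : 0 <= nL2 Omega v by exact: sqrtr_ge0.
have nQ0 v : 0 <= nH1 Omega v by exact: sqrtr_ge0.
have E (u : hvec R d) : nH1v Omega u = snorm (fun u v : hvec R d =>
  ipv Omega (hval u) (hval v) + \sum_(k < d) ip_grad Omega (u k) (v k)) u by [].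
have triV (a b c : hvec R d) : V a -> V b -> V c ->
    nH1v Omega (a - b) <= nH1v Omega (a - c) + nH1v Omega (c - b).
  by rewrite !E => /VD_vdom Va /VD_vdom Vb /VD_vdom Vc; exact: (snorm_tri hV Va Vb Vc).
have symV (a b : hvec R d) : V a -> V b -> nH1v Omega (a - b) = nH1v Omega (b - a).
  by rewrite !E => /VD_vdom Va /VD_vdom Vb; exact: (snorm_distC hV Va Vb).
have triQ (a b c : hfun R d) : Q a -> Q b -> Q c ->
    nH1 Omega (a - b) <= nH1 Omega (a - c) + nH1 Omega (c - b).
  by move=> /H10_hdom Va /H10_hdom Vb /H10_hdom Vc; exact: (snorm_tri hH Va Vb Vc).
have symQ (a b : hfun R d) : Q a -> Q b -> nH1 Omega (a - b) = nH1 Omega (b - a).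
  by move=> /H10_hdom Va /H10_hdom Vb; exact: (snorm_distC hH Va Vb).
move=> t tT; split.
- apply: (time_H1_ae_eq T0 nV0 triV symV hu'.1 hu.1) tT.
  apply: (@filterS _ _ FF) H => s h /h[h1 _ _ _]; rewrite -(mulr0 (conv_cst p CK)) -S0; exact: h1.
- apply: (time_H1_ae_eq T0 nW0 (snorm_tri hL2) (snorm_distC hL2) hu'.2 hu.2) tT.
  apply: (@filterS _ _ FF) H => s h /h[_ h1 _ _]; rewrite -(mulr0 (conv_cst p CK)) -S0; exact: h1.
- apply: (time_H1_ae_eq T0 nQ0 triQ symQ hDphi' hDphi) tT.
  apply: (@filterS _ _ FF) H => s h /h[_ _ h1 _]; rewrite -(mulr0 (conv_cst p CK)) -S0; exact: h1.
- apply: (time_H1_ae_eq T0 nQ0 triQ symQ hDpsi' hDpsi) tT.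
  apply: (@filterS _ _ FF) H => s h /h[_ _ _ h1]; rewrite -(mulr0 (conv_cst p CK)) -S0; exact: h1.
Qed.

End convergence.

Unset Implicit Arguments.

Theorem theorem2 (R : realType) (d : nat) (hd : (d = 2 \/ d = 3)%N)
  (Omega GD GN : set 'rV[R]_d)
  (hOmega : lipschitz_domain Omega)
  (hGamma : boundary_partition Omega GD GN)
  (hinfsup : inf_sup Omega GD)
  (hkorn : korn Omega GD)
  (T : R) (hT : 0 < T)
  (p : coefficients R) (hp : admissible p)
  (F : sources R d) (hF : regular_sources Omega T F)
  (I0 : initial_data R d) (hI0 : regular_initial_data Omega GD I0) :
  exists2 Cmu : R, 0 < Cmu &
    let Lcon := 1 / Num.sqrt (1 + 2 * lambda p * Cmu) in
    Lcon < 1 /\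
    forall z : evolution R d, coupled_solution Omega GD T p F I0 z ->
      (forall y : nat -> evolution R d,
         decoupled_iteration Omega GD T p F I0 y ->
         (forall i : nat, (1 <= i)%N ->
            err_dxi Omega T z (y i) <= Lcon * err_dxi Omega T z (y i.-1)) /\
         converges_to Omega T y z) /\
      (forall z' : evolution R d, coupled_solution Omega GD T p F I0 z' ->
         same_evolution Omega T z' z).
Proof.
have d1 : (1 < d)%N by case: hd => ->.
have [oO _ bO _] := hOmega; have [Cis Cis0 infsup] := hinfsup; have [CK CK0 kornCK] := hkorn.
have [_ [m0 _ _] _ _ _] := hp.
(* The constant of [mech_err_bound], for which the radicand of [Lcon] is [xi_contraction]. *)
exists (Cis ^+ 2 / (2 * mu p)); first by rewrite divr_gt0 ?exprn_gt0 ?mulr_gt0.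
move=> Lcon; have k1 : 1 < xi_contraction p Cis by exact: xi_contraction_gt1.
have k0 : 0 < xi_contraction p Cis by exact: lt_trans ltr01 k1.
have LconE : Lcon = (Num.sqrt (xi_contraction p Cis))^-1 by rewrite /Lcon div1r.
have sk0 : 0 < Num.sqrt (xi_contraction p Cis) by rewrite sqrtr_gt0.
split.
  by rewrite LconE invf_lt1// -(sqrtr1 R) ltr_sqrt.
move=> z hz; split => [y hy|z' hz']; last exact: (coupled_unique d1 oO bO hT hp hI0 Cis0 CK0 infsup kornCK hz hz').
split=> [[//|i] _|]; last exact: (iteration_converges d1 oO bO hT hp hI0 Cis0 CK0 infsup kornCK hz hy).
have := err_dxi_contraction d1 oO bO hT hp hI0 Cis0 CK0 infsup kornCK hz hy i => kS.
rewrite LconE ler_pdivlMl// /err_dxi /time_L2_norm /=.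
rewrite -sqrtrM ?(ltW k0)// ler_wsqrtr//.
Qed.
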